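(* \textsc{Diameter} can be solved in $O(k\cdot(n+m)+2^{16k}k)$ time on graphs with $n$ vertices, $m$ edges and distance $k$ to cographs.
   Context: \textsc{Diameter}: given an undirected, connected, unweighted graph $G=(V,E)$ with $n=|V|$, $m=|E|$, compute the length of a longest shortest path in $G$. A cograph is a graph containing no induced path on four vertices ($P_4$-free). The distance to cographs of $G$ is the minimum number of vertices whose deletion from $G$ yields a cograph. The deletion set is not assumed to be given.
   Formalization: In the running time the factor k is read as k+1, since for distance k = 0 (cographs) the stated bound would be 0 steps; for k at least 1 this changes only the constant. *)

(* Defs.v *)
From mathcomp Require Import all_boot.
Set Implicit Arguments. Unset Strict Implicit. Unset Printing Implicit Defensive.

(* Vertices are the naturals 0..n-1; the edge list s lists every edge once,
   as an (unordered) pair (u,v). *)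

Definition adj (s : seq (nat * nat)) : rel nat :=
  fun x y => ((x, y) \in s) || ((y, x) \in s).

Definition valid_graph (n : nat) (s : seq (nat * nat)) : Prop :=
  [/\ all (fun p => (p.1 < n) && (p.2 < n) && (p.1 != p.2)) s,
      uniq s
    & forall u v, (u, v) \in s -> (v, u) \notin s].

Definition walk (s : seq (nat * nat)) (x y : nat) (p : seq nat) : Prop :=
  path (adj s) x p /\ last x p = y.

Definition connected_graph (n : nat) (s : seq (nat * nat)) : Prop :=
  forall x y, x < n -> y < n -> exists p, walk s x y p.

Definition is_dist (s : seq (nat * nat)) (x y d : nat) : Prop :=
  (exists p, walk s x y p /\ size p = d) /\
  (forall p, walk s x y p -> d <= size p).

Definition is_diameter (n : nat) (s : seq (nat * nat)) (d : nat) : Prop :=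
  (exists x y, [/\ x < n, y < n & is_dist s x y d]) /\
  (forall x y d', x < n -> y < n -> is_dist s x y d' -> d' <= d).

Definition induced_P4_avoiding (n : nat) (s : seq (nat * nat)) (S : seq nat)
  (a b c d : nat) : Prop :=
  [/\ [/\ a < n, b < n, c < n & d < n],
      [/\ a \notin S, b \notin S, c \notin S & d \notin S],
      uniq [:: a; b; c; d],
      [/\ adj s a b, adj s b c & adj s c d]
    & [/\ ~~ adj s a c, ~~ adj s b d & ~~ adj s a d]].

Definition cograph_deletion_set (n : nat) (s : seq (nat * nat)) (S : seq nat) : Prop :=
  [/\ uniq S, all (fun v => v < n) S
    & forall a b c d, ~ induced_P4_avoiding n s S a b c d].

Definition is_dist_to_cograph (n : nat) (s : seq (nat * nat)) (k : nat) : Prop :=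
  (exists S, cograph_deletion_set n s S /\ size S = k) /\
  (forall S, cograph_deletion_set n s S -> k <= size S).

(* Registers are indexed by naturals and hold naturals; indirect addressing.
   Word-size restriction is imposed in the theorem statement. *)
Inductive instr : Type :=
| IConst of nat & nat
| IAdd of nat & nat & nat
| ISub of nat & nat & nat
| IMul of nat & nat & nat
| ILoad of nat & nat
| IStore of nat & nat
| IJz of nat & nat
| IHalt.

Record state := State { pc : nat; regs : nat -> nat }.

Definition upd (f : nat -> nat) (i v : nat) : nat -> nat :=
  fun j => if j == i then v else f j.

Definition fetch (P : seq instr) (st : state) : instr := nth IHalt P (pc st).

Definition step (P : seq instr) (st : state) : state :=
  let R := regs st in
  let q := (pc st).+1 in
  match fetch P st with
  | IConst r v => State q (upd R r v)
  | IAdd r a b => State q (upd R r (R a + R b))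
  | ISub r a b => State q (upd R r (R a - R b))
  | IMul r a b => State q (upd R r (R a * R b))
  | ILoad r a => State q (upd R r (R (R a)))
  | IStore a b => State q (upd R (R a) (R b))
  | IJz r l => State (if R r == 0 then l else q) R
  | IHalt => st
  end.

Definition halted (P : seq instr) (st : state) : bool :=
  if fetch P st is IHalt then true else false.

Definition exec (P : seq instr) (t : nat) (st : state) : state := iter t (step P) st.

(* Input encoding: R[0] = n, R[1] = m = size s, and for i < m,
   R[2+2i], R[3+2i] are the two endpoints of the i-th edge; all else 0. *)
Definition init_regs (n : nat) (s : seq (nat * nat)) : nat -> nat :=
  fun j =>
    if j == 0 then n
    else if j == 1 then size s
    else if (2 <= j) && (j < 2 + 2 * size s) then
      let p := nth (0, 0) s ((j - 2) %/ 2) in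
      if odd j then p.2 else p.1
    else 0.

Definition init_state (n : nat) (s : seq (nat * nat)) : state :=
  State 0 (init_regs n s).

Definition runs_in (P : seq instr) (n : nat) (s : seq (nat * nat))
  (t out W : nat) : Prop :=
  [/\ halted P (exec P t (init_state n s)),
      regs (exec P t (init_state n s)) 0 = out
    & forall j r, j <= t -> regs (exec P j (init_state n s)) r <= W].

(* Main.v *)
Require Import Defs.
From mathcomp Require Import all_boot.
From mathcomp Require Import zify.
Set Implicit Arguments. Unset Strict Implicit. Unset Printing Implicit Defensive.

(** Find a set K of at most 4k vertices such that every connected component of
    G - K has diameter at most 2.  As long as some component lacks a simple
    certificate of this, that component contains an induced P4, which is found
    in time O(n + m); all four of its vertices are moved to K, and any cograph
    deletion set contains at least one of them.

    The certificate: let r be the least vertex of the component and suppose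
    that r is within distance 2 of everything.  Let a be a neighbour of r with
    the most neighbours at distance 2 from r.  If a is adjacent to every vertex
    at distance 2, and every other neighbour of r is adjacent to a or to all
    vertices at distance 2, then any two vertices are at distance at most 2.

    A walk between vertices of different components of G - K passes through K,
    so distances are determined by the distances to K, and these by the local
    distances, along walks with no inner vertex in K.  By the diameter bound,
    local distances from K to the other vertices are 1, 2, 3 or infinite, so
    there are at most 4^|K| + |K| distinct vectors of local distances.
    Floyd-Warshall with intermediate vertices in K turns the vectors of one
    representative per class into true distances, and all pairs of classes
    are compared in time (4^|K| + |K|)^2 |K| = O(2^(16k) k).

    The RAM program is compiled from a loop language whose loops run a
    precomputed number of times, so that its semantics is a total function.
    Stored values exceed earlier ones by a constant at most, so words stay
    polynomial in the running time. *)

(** * Induced paths and components of small diameter *)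

Definition P4 (e : rel nat) (a b c d : nat) : Prop :=
  [/\ uniq [:: a; b; c; d], e a b, e b c, e c d
    & [/\ ~~ e a c, ~~ e b d & ~~ e a d]].

Section Certificate.
Variables (n : nat) (L : seq (nat * nat)).
Let e : rel nat := fun u w => (u, w) \in L.
Hypothesis L_uniq : uniq L.
Hypothesis e_sym : forall u w, e u w -> e w u.
Hypothesis e_irr : forall u, ~~ e u u.
Hypothesis e_lt : forall u w, e u w -> u < n.

Variables (lb1 lb2 par cnt best : nat -> nat).
Hypothesis lb1_in : forall v, v < n -> lb1 v = v \/ e v (lb1 v).
Hypothesis lb1_le : forall v, v < n -> lb1 v <= v.
Hypothesis lb1_min : forall u w, e u w -> lb1 u <= w.
Hypothesis lb2_par : forall v, v < n -> lb2 v = lb1 (par v).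
Hypothesis par_in : forall v, v < n -> par v = v \/ e v (par v).
Hypothesis lb2_le : forall v, v < n -> lb2 v <= lb1 v.
Hypothesis lb2_min : forall u w, e u w -> lb2 u <= lb1 w.

Let e_lt2 u w : e u w -> w < n. Proof. by move/e_sym/e_lt. Qed.

Lemma P4_far u w : e u w -> lb2 u < lb2 w -> P4 e (lb2 u) (par u) u w.
Proof.
move=> uw lt; have un := e_lt uw; have wn := e_lt2 uw; have wu := e_sym uw.
have Ep := lb2_par un; set p := par u in Ep *; set r := lb2 u in Ep lt *.
have w1 := lb2_min wu; have w2 := lb2_le wn; have w3 := lb1_le wn.
have u1 := lb1_le un.
have up : e u p.
  by case: (par_in un) => // pu; rewrite -/p in pu; rewrite pu in Ep; lia.
have pn := e_lt2 up; have pu := e_sym up.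
have pr : e p r.
  rewrite Ep; case: (lb1_in pn) => // rp; rewrite -Ep in rp.
  by have := lb1_min up; lia.
have rp := e_sym pr.
have nru : ~~ e r u by apply/negP => /e_sym /lb1_min; lia.
have nrw : ~~ e r w by apply/negP => /e_sym /lb1_min; lia.
have npw : ~~ e p w by apply/negP => /e_sym /lb2_min; lia.
split=> //; rewrite /= !inE !negb_or !andbT; do !(apply/andP; split).
- by apply/eqP => E; move: rp; rewrite E; exact/negP/e_irr.
- by apply/eqP => E; clear -lt w1 w2 w3 u1 E; lia.
- by apply/eqP => E; clear -lt w1 w2 w3 u1 E; lia.
- by apply/eqP => E; move: pu; rewrite E; exact/negP/e_irr.
- by apply/eqP => E; move: Ep; rewrite E; clear -lt w2; lia.
- by apply/eqP => E; move: uw; rewrite E; exact/negP/e_irr.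
Qed.

Hypothesis lb2_const : forall u w, e u w -> lb2 u = lb2 w.

Lemma leader v : v < n ->
  [/\ lb2 v < n, lb2 (lb2 v) = lb2 v & lb1 (lb2 v) = lb2 v].
Proof.
move=> vn; have E := lb2_par vn.
have pn : par v < n by case: (par_in vn) => [->|/e_lt2].
have rn : lb2 v < n by rewrite E; case: (lb1_in pn) => [->|/e_lt2].
have E1 : lb2 (par v) = lb2 v by case: (par_in vn) => [->|/lb2_const].
have E2 : lb2 (lb2 v) = lb2 v.
  by rewrite {1}E; case: (lb1_in pn) => [->|/lb2_const <-].
by split=> //; have := lb1_le rn; have := lb2_le rn; lia.
Qed.

(* Within the component of leader [r], vertices with [lb1 = lb2] are [r] and
   its neighbours; those with [lb2 < lb1] are at distance two from [r]. *)
Definition far v := lb2 v < lb1 v.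

Lemma near_leader v : v < n -> ~~ far v -> v = lb2 v \/ e v (lb2 v).
Proof.
move=> vn; rewrite /far -leqNgt => h; have := lb2_le vn => h2.
have -> : lb2 v = lb1 v by lia.
by case: (lb1_in vn) => [->|]; auto.
Qed.

Lemma far_leader v : far v -> ~~ e v (lb2 v).
Proof. by move=> fv; apply/negP => /lb1_min; rewrite /far in fv; lia. Qed.

Lemma far_neq v : v < n -> far v -> v != lb2 v.
Proof.
move=> vn fv; apply/eqP => E; have := lb1_le vn; rewrite /far -E in fv; lia.
Qed.

Lemma far_par v : v < n -> far v ->
  [/\ e v (par v), e (par v) (lb2 v) & ~~ far (par v)].
Proof.
move=> vn fv; have E := lb2_par vn.
have vp : e v (par v).
  by case: (par_in vn) => // pv; rewrite pv in E; rewrite /far in fv; lia.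
have pn := e_lt2 vp; have El := lb2_const vp.
have nf : ~~ far (par v) by rewrite /far -El E ltnn.
split=> //; rewrite E; case: (lb1_in pn) => // Ep.
have := lb1_min vp; rewrite -Ep -E; rewrite /far in fv; lia.
Qed.

Definition fnb u := [seq p.2 | p <- L & (p.1 == u) && far p.2].
Hypothesis cntE : forall u, cnt u = size (fnb u).

Lemma mem_fnb u w : (w \in fnb u) = e u w && far w.
Proof.
apply/mapP/andP => [[[u' w'] /=]|[uw fw]].
  by rewrite mem_filter /= => /andP [/andP [/eqP -> fw] h] ->.
by exists (u, w) => //; rewrite mem_filter /= eqxx fw.
Qed.

Lemma uniq_fnb u : uniq (fnb u).
Proof.
rewrite map_inj_in_uniq ?filter_uniq // => -[u1 w1] [u2 w2].
rewrite !mem_filter /= => /andP [/andP [/eqP -> _] _] /andP [/andP [/eqP -> _] _].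
by move=> ->.
Qed.

Lemma cnt_lt a b m : e b m -> far m -> ~~ e a m -> cnt b <= cnt a ->
  exists w, [/\ e a w, far w & ~~ e b w].
Proof.
move=> bm fm am; rewrite !cntE => le.
case: (boolP (has (fun w => ~~ e b w) (fnb a))) => [/hasP [w]|/hasPn h].
  by rewrite mem_fnb => /andP [aw fw] bw; exists w.
suff : size (m :: fnb a) <= size (fnb b) by move=> /= ?; lia.
apply: uniq_leq_size; first by rewrite /= mem_fnb (negbTE am) uniq_fnb.
move=> w; rewrite inE => /orP [/eqP ->|wa]; first by rewrite mem_fnb bm.
have := h w wa; rewrite negbK mem_fnb => ->.
by move: wa; rewrite mem_fnb => /andP [].
Qed.

Hypothesis best_in : forall r, r < n -> best r = r \/
  [/\ best r < n, lb2 (best r) = r & ~~ far (best r)].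
Hypothesis best_max : forall v, v < n -> ~~ far v -> cnt v <= cnt (best (lb2 v)).

(* In the second case [m] is arbitrary. *)
Definition bad r m b : Prop :=
  [/\ m < n, lb2 m = r, far m, ~~ e (best r) m & b = par m] \/
  [/\ b < n, lb2 b = r, ~~ far b, ~~ e (best r) b & cnt b < cnt (best r)].

Lemma best_adj r b m : r < n -> lb2 r = r -> e b m -> far m -> lb2 m = r ->
  e (best r) r /\ ~~ far (best r).
Proof.
move=> rn Er bm fm Em; have bn := e_lt bm; have mn := e_lt2 bm.
have [mp pr np] := far_par mn fm; rewrite Em in pr.
have pn := e_lt2 mp.
have := best_max pn np; rewrite -(lb2_const mp) Em !cntE => le.
have pos : 0 < size (fnb (best r)).
  apply: leq_trans le; have : m \in fnb (par m) by rewrite mem_fnb e_sym.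
  by case: (fnb _).
have fr : ~~ e (best r) r -> best r = r -> False.
  move=> _ E; move: pos; rewrite E; case Ef : (fnb r) => [//|w s'] _.
  have : w \in fnb r by rewrite Ef mem_head.
  rewrite mem_fnb => /andP [rw fw]; have := far_leader fw.
  by rewrite -(lb2_const rw) Er e_sym.
have nr : best r <> r.
  by move=> E; apply: fr => //; rewrite E e_irr.
case: (best_in rn) => // -[an Ea na]; split=> //.
by case: (near_leader an na) => //; rewrite Ea // => /nr.
Qed.

Lemma bad_leader r m b : bad r m b -> r < n /\ lb2 r = r.
Proof. by case=> -[h <- _ _ _]; case: (leader h). Qed.

Lemma bad_wit r m b : bad r m b -> exists w,
  [/\ e (best r) w, far w & ~~ e b w].
Proof.
move=> B; have [rn Er] := bad_leader B.
case: B => -[].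
  move=> mn Em fm am ->; have [mp pr np] := far_par mn fm.
  apply: (cnt_lt (m := m)) => //; first exact: e_sym.
  by have := best_max (e_lt2 mp) np; rewrite -(lb2_const mp) Em.
move=> bn Eb nb ab; rewrite !cntE => lt.
case: (boolP (has (fun w => ~~ e b w) (fnb (best r)))) => [/hasP [w]|/hasPn h].
  by rewrite mem_fnb => /andP [aw fw] bw; exists w.
suff : size (fnb (best r)) <= size (fnb b) by move=> ?; lia.
apply: uniq_leq_size (uniq_fnb _) _ => w wa.
have := h w wa; rewrite negbK mem_fnb => ->.
by move: wa; rewrite mem_fnb => /andP [].
Qed.

Lemma bad_P4 r m b w : bad r m b -> e (best r) w -> far w -> ~~ e b w ->
  if e (best r) b then
    if e m w then P4 e r (best r) w m else P4 e w (best r) b m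
  else P4 e w (best r) r b.
Proof.
move=> B aw fw bw; have [rn Er] := bad_leader B.
have wn := e_lt2 aw; set a := best r in aw *.
have Ew : lb2 w = r.
  rewrite -(lb2_const aw) /a; case: (best_in rn) => [->|[_ -> _]]; auto.
have [ar na] : e a r /\ ~~ far a by apply: best_adj aw fw Ew.
have wr := far_leader fw; rewrite Ew in wr; have nwr := far_neq wn fw.
rewrite Ew in nwr.
have neq u v x : e u x -> ~~ e v x -> u != v.
  by move=> h1 h2; apply/eqP => E; move: h2; rewrite -E h1.
have neqe u v : e u v -> u != v.
  by move=> h; apply/eqP => E; move: h; rewrite E; exact/negP/e_irr.
have wa := e_sym aw; have ra := e_sym ar.
have sn u v : ~~ e u v -> ~~ e v u by apply: contra; apply: e_sym.
case: ifP => ab.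
- have ab' : e a b by [].
  case: B => -[]; last by rewrite -/a ab'.
  move=> mn Em fm; rewrite -/a => am Eb.
  have [mb br nb] := far_par mn fm; rewrite -Eb Em in mb br nb.
  have bm := e_sym mb; have mr := far_leader fm; rewrite Em in mr.
  have nmr := far_neq mn fm; rewrite Em in nmr.
  have nbw : b != w by apply: contraNneq nb => ->.
  have nam : a != m by apply: contraNneq na => ->.
  case: ifP => mw.
    split=> //; first last.
    - by split=> //; apply: sn.
    - exact: e_sym.
    rewrite /= !inE !negb_or !andbT; do !(apply/andP; split) => //.
    + exact: neqe.
    + by rewrite eq_sym.
    + by rewrite eq_sym.
    + exact: neqe.
    + by rewrite eq_sym; apply: neqe.
  split=> //; first last.
  - by split=> //; apply: sn; rewrite ?mw.
  rewrite /= !inE !negb_or !andbT; do !(apply/andP; split) => //.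
  + exact: neqe.
  + by rewrite eq_sym.
  + by apply: contraTneq aw => ->.
  + exact: neqe.
  + exact: neqe.
- have nab : ~~ e a b by rewrite ab.
  have nba : ~~ e b a by apply: sn.
  have [bn [Eb [fb nEab]]] : b < n /\ lb2 b = r /\ ~~ far b /\ a != b.
    case: B => -[].
      move=> mn Em fm am Eb'; have [mb br nb] := far_par mn fm.
      rewrite -Eb' in mb br nb.
      split; [exact: e_lt2 mb|split; [by rewrite -(lb2_const mb)|split=> //]].
      by rewrite -/a in am; rewrite eq_sym; apply: neq (e_sym mb) am.
    by move=> bn Eb nb _ lt; do !split=> //; apply: contraTneq lt => <-; rewrite ltnn.
  have nbr : b != r by apply: contraNneq nab => ->.
  have br : e b r by case: (near_leader bn fb); rewrite Eb // => E; rewrite E eqxx in nbr.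
  split=> //; first by rewrite /= !inE !negb_or !andbT; do !(apply/andP; split) => //;
    [exact: neqe|by apply: contraNneq fb => <-|exact: neqe|by rewrite eq_sym].
  + exact: e_sym.
  + by split=> //; apply: sn.
Qed.

Hypothesis ok_far : forall v, v < n -> far v -> e (best (lb2 v)) v.
Hypothesis ok_near : forall v, v < n -> ~~ far v -> ~~ e (best (lb2 v)) v ->
  cnt (best (lb2 v)) <= cnt v.

Lemma diam2 u w : u < n -> w < n -> lb2 u = lb2 w ->
  [\/ u = w, e u w | exists2 c, e u c & e c w].
Proof.
move=> un wn E.
have wlog_far x y : x < n -> y < n -> lb2 x = lb2 y -> far y ->
    [\/ x = y, e x y | exists2 c, e x c & e c y].
  move=> xn yn Exy fy; have ay := ok_far yn fy.
  have [rn Er _] := leader yn; set r := lb2 y in Exy ay rn Er *.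
  have [ar na] : e (best r) r /\ ~~ far (best r) by apply: best_adj ay fy erefl.
  set a := best r in ay ar na *.
  case: (boolP (e a x)) => ax; first by constructor 3; exists a => //; apply: e_sym.
  case: (eqVneq x r) => [->|xr].
    by constructor 3; exists a => //; apply: e_sym.
  case: (eqVneq x a) => [->|xa]; first by constructor 2.
  have nx : ~~ far x.
    by apply: contra ax => fx; have := ok_far xn fx; rewrite Exy.
  have := ok_near xn nx; rewrite Exy -/a => /(_ ax); rewrite !cntE => le.
  constructor 2; apply: contraTT (uniq_fnb x) => nxy; exfalso.
  suff : size (y :: fnb x) <= size (fnb a) by move=> /= ?; lia.
  apply: uniq_leq_size; first by rewrite /= mem_fnb (negbTE nxy) uniq_fnb.
  move=> z; rewrite inE => /orP [/eqP ->|]; first by rewrite mem_fnb ay.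
  rewrite !mem_fnb => /andP [xz fz]; rewrite fz andbT.
  by have := ok_far (e_lt2 xz) fz; rewrite -(lb2_const xz) Exy.
case: (boolP (far w)) => fw; first exact: wlog_far.
case: (boolP (far u)) => fu.
  case: (wlog_far w u) => // [->|/e_sym h|[c wc cu]].
  - by constructor 1.
  - by constructor 2.
  - by constructor 3; exists c; apply: e_sym.
have := near_leader un fu; have := near_leader wn fw; rewrite -E.
case=> [Ew|wr] [Eu|ur].
- by constructor 1; rewrite Eu -Ew.
- by constructor 2; rewrite Ew.
- by constructor 2; rewrite Eu; apply: e_sym.
- by constructor 3; exists (lb2 u) => //; apply: e_sym.
Qed.

End Certificate.

(** * Loop language and its compiler *)

Inductive expr : Type :=
| Num of nat
| Var of nat
| Rd of nat & expr
| Add of expr & expr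
| Sub of expr & expr
| Mul of expr & expr.

Inductive cmd : Type :=
| Skip
| Asg of nat & expr
| St of nat & expr & expr
| Seq of cmd & cmd
| If of expr & cmd & cmd
| For of nat & expr & cmd.

Record store := Store { var : nat -> nat; arr : nat -> nat -> nat }.

Definition setv (m : store) (x a : nat) : store := Store (upd (var m) x a) (arr m).
Definition seta (m : store) (A i a : nat) : store :=
  Store (var m) (fun B => if B == A then upd (arr m A) i a else arr m B).

Fixpoint ev (m : store) (e : expr) : nat :=
  match e with
  | Num c => c
  | Var x => var m x
  | Rd A e => arr m A (ev m e)
  | Add a b => ev m a + ev m b
  | Sub a b => ev m a - ev m b
  | Mul a b => ev m a * ev m b
  end.

Fixpoint run (c : cmd) (m : store) : store :=
  match c with
  | Skip => m
  | Asg x e => setv m x (ev m e)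
  | St A e1 e2 => seta m A (ev m e1) (ev m e2)
  | Seq a b => run b (run a m)
  | If e a b => if ev m e == 0 then run b m else run a m
  | For x e c => iteri (ev m e) (fun k s => run c (setv s x k)) m
  end.

Definition loop (x : nat) (c : cmd) (m : store) (k : nat) : store :=
  iteri k (fun k s => run c (setv s x k)) m.

(* [et] and [tm] are the exact running times of the compiled code. *)
Fixpoint et (e : expr) : nat :=
  match e with
  | Num _ => 1
  | Var _ => 2
  | Rd _ e => et e + 6
  | Add a b | Sub a b | Mul a b => et a + et b + 1
  end.

Fixpoint tm (c : cmd) (m : store) : nat :=
  match c with
  | Skip => 0
  | Asg x e => et e + 2
  | St A e1 e2 => et e1 + et e2 + 6
  | Seq a b => tm a m + tm b (run a m)
  | If e a b => et e + 1 + (if ev m e == 0 then tm b m else tm a m + 2)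
  | For x e c =>
      et e + 5 + \sum_(0 <= k < ev m e) (tm c (setv (loop x c m k) x k) + 8)
  end.

(* Register map: variables in [0, NV), the base address of the arrays in NV,
   a counter and a limit for each of 5 loop nesting levels in [NV+1, TB),
   expression temporaries in [TB, FX).  Cell i of array A is at
   base + i * NA + A, so that arrays are unbounded and never overlap. *)
Notation NV := 40.
Notation LR := 41.
Notation TB := 51.
Notation FX := 61.
Notation NA := 18.

Fixpoint cexp (e : expr) (d : nat) : seq instr :=
  let t := TB + d in
  match e with
  | Num c => [:: IConst t c]
  | Var x => [:: IConst t 0; IAdd t x t]
  | Rd A e => cexp e d ++ [:: IConst t.+1 NA; IMul t t t.+1; IAdd t t NV;
                              IConst t.+1 A; IAdd t t t.+1; ILoad t t]
  | Add a b => cexp a d ++ cexp b d.+1 ++ [:: IAdd t t t.+1]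
  | Sub a b => cexp a d ++ cexp b d.+1 ++ [:: ISub t t t.+1]
  | Mul a b => cexp a d ++ cexp b d.+1 ++ [:: IMul t t t.+1]
  end.

Fixpoint code (c : cmd) (dl p : nat) : seq instr :=
  match c with
  | Skip => [::]
  | Asg x e => cexp e 0 ++ [:: IConst TB.+1 0; IAdd x TB TB.+1]
  | St A e1 e2 =>
      cexp e1 0 ++ [:: IConst TB.+1 NA; IMul TB TB TB.+1; IAdd TB TB NV;
                       IConst TB.+1 A; IAdd TB TB TB.+1]
      ++ cexp e2 1 ++ [:: IStore TB TB.+1]
  | Seq a b => let k := code a dl p in k ++ code b dl (p + size k)
  | If e a b =>
      let p1 := p + et e + 1 in
      let k1 := code a dl p1 in
      let p2 := p1 + size k1 + 2 in
      let k2 := code b dl p2 in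
      cexp e 0 ++ IJz TB p2 :: k1 ++
      IConst TB 0 :: IJz TB (p2 + size k2) :: k2
  | For x e c =>
      let lc := LR + 2 * dl in
      let p1 := p + et e + 3 in
      let k := code c dl.+1 (p1 + 4) in
      cexp e 0 ++ [:: IConst lc 0; IConst TB.+1 0; IAdd lc.+1 TB TB.+1] ++
      [:: ISub TB lc.+1 lc; IJz TB (p1 + size k + 8);
          IConst TB 0; IAdd x lc TB] ++ k ++
      [:: IConst TB 1; IAdd lc lc TB; IConst TB 0; IJz TB p1]
  end.

(* [ev m e <= (v + 2) ^ dg e] when [v] bounds all values of [m]. *)
Fixpoint dg (e : expr) : nat :=
  match e with
  | Num _ | Var _ | Rd _ _ => 1
  | Add a b | Mul a b => dg a + dg b
  | Sub a b => dg a
  end.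

Notation DG := 8.

Fixpoint wfe (d : nat) (e : expr) : bool :=
  (dg e <= DG) && (d + 2 <= FX - TB) &&
  match e with
  | Num c => c <= 8
  | Var x => x < NV
  | Rd A e => (A < NA) && wfe d e
  | Add a b | Sub a b | Mul a b => wfe d a && wfe d.+1 b
  end.

(* Expressions exceeding the largest value in memory by at most 8. *)
Fixpoint gr (e : expr) : bool :=
  match e with
  | Num c => c <= 8
  | Var _ | Rd _ _ => true
  | Add (Var _) (Num c) | Add (Rd _ _) (Num c) => c <= 8
  | Sub a _ => gr a
  | _ => false
  end.

Fixpoint wf (dl : nat) (c : cmd) : bool :=
  match c with
  | Skip => true
  | Asg x e => [&& x < NV, gr e & wfe 0 e]
  | St A e1 e2 => [&& A < NA, gr e2, wfe 0 e1 & wfe 1 e2]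
  | Seq a b => wf dl a && wf dl b
  | If e a b => [&& wfe 0 e, wf dl a & wf dl b]
  | For x e c => [&& x < NV, gr e, wfe 0 e, dl < 5 & wf dl.+1 c]
  end.

Definition code_at (P : seq instr) (p : nat) (k : seq instr) : Prop :=
  forall i, i < size k -> nth IHalt P (p + i) = nth IHalt k i.

Lemma code_at_cat P p k1 k2 :
  code_at P p (k1 ++ k2) -> code_at P p k1 /\ code_at P (p + size k1) k2.
Proof.
move=> H; split=> i Hi.
  by rewrite H ?size_cat ?ltn_addr // nth_cat Hi.
rewrite -addnA H ?size_cat ?ltn_add2l // nth_cat ltnNge leq_addr /=.
by rewrite addKn.
Qed.

Lemma code_at_cons P p i k :
  code_at P p (i :: k) -> nth IHalt P p = i /\ code_at P p.+1 k.
Proof.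
move=> H; split; first by have := H 0 isT; rewrite addn0.
by move=> j Hj; rewrite addSnnS H.
Qed.

Definition allle (W : nat) (R : nat -> nat) : Prop := forall r, R r <= W.

Lemma allle_upd W R r a : allle W R -> a <= W -> allle W (upd R r a).
Proof. by move=> H Ha q; rewrite /upd; case: ifP. Qed.

Definition steps (P : seq instr) (W : nat) (st : state) (t : nat) (st' : state)
  : Prop :=
  exec P t st = st' /\ forall j r, j <= t -> regs (exec P j st) r <= W.

Lemma steps_refl P W st : allle W (regs st) -> steps P W st 0 st.
Proof. by move=> H; split=> // j r; rewrite leqn0 => /eqP ->; apply: H. Qed.

Lemma exec_add P a b st : exec P (a + b) st = exec P b (exec P a st).
Proof. by rewrite /exec addnC iterD. Qed.

Lemma steps_trans P W st1 t1 st2 t2 st3 :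
  steps P W st1 t1 st2 -> steps P W st2 t2 st3 -> steps P W st1 (t1 + t2) st3.
Proof.
move=> [e1 b1] [e2 b2]; split; first by rewrite exec_add e1.
move=> j r Hj; case: (leqP j t1) => H; first exact: b1.
have -> : j = t1 + (j - t1) by lia.
by rewrite exec_add e1; apply: b2; lia.
Qed.

Lemma steps_le P W st t st' : steps P W st t st' -> allle W (regs st').
Proof. by case=> <- H r; apply: H. Qed.

Lemma steps_cons P W st st1 t st' :
  step P st = st1 -> allle W (regs st) -> steps P W st1 t st' ->
  steps P W st t.+1 st'.
Proof.
move=> e H1 H2; rewrite -add1n; apply: (steps_trans (st2 := st1)) => //.
split; first by rewrite /exec /= e.
case=> [|[|j]] r Hj; [exact: (H1 r)| |by []].
rewrite /exec /= e; have [_ H] := H2; exact: (H 0 r).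
Qed.

Section StepLemmas.
Variables (P : seq instr) (W p : nat) (R : nat -> nat).
Variables (t : nat) (st' : state).
Hypothesis HR : allle W R.

Lemma st_const r v : nth IHalt P p = IConst r v -> v <= W ->
  (allle W (upd R r v) -> steps P W (State p.+1 (upd R r v)) t st') ->
  steps P W (State p R) t.+1 st'.
Proof.
move=> e Hv H; apply: steps_cons (H _) => //; last exact: allle_upd.
by rewrite /step /fetch /= e.
Qed.

Lemma st_add r a b : nth IHalt P p = IAdd r a b -> R a + R b <= W ->
  (allle W (upd R r (R a + R b)) ->
   steps P W (State p.+1 (upd R r (R a + R b))) t st') ->
  steps P W (State p R) t.+1 st'.
Proof.
move=> e Hv H; apply: steps_cons (H _) => //; last exact: allle_upd.
by rewrite /step /fetch /= e.
Qed.

Lemma st_sub r a b : nth IHalt P p = ISub r a b ->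
  (allle W (upd R r (R a - R b)) ->
   steps P W (State p.+1 (upd R r (R a - R b))) t st') ->
  steps P W (State p R) t.+1 st'.
Proof.
move=> e H; apply: steps_cons (H _) => //; first by rewrite /step /fetch /= e.
by apply: allle_upd => //; apply: leq_trans (leq_subr _ _) (HR a).
Qed.

Lemma st_mul r a b : nth IHalt P p = IMul r a b -> R a * R b <= W ->
  (allle W (upd R r (R a * R b)) ->
   steps P W (State p.+1 (upd R r (R a * R b))) t st') ->
  steps P W (State p R) t.+1 st'.
Proof.
move=> e Hv H; apply: steps_cons (H _) => //; last exact: allle_upd.
by rewrite /step /fetch /= e.
Qed.

Lemma st_load r a : nth IHalt P p = ILoad r a ->
  (allle W (upd R r (R (R a))) ->
   steps P W (State p.+1 (upd R r (R (R a)))) t st') ->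
  steps P W (State p R) t.+1 st'.
Proof.
move=> e H; apply: steps_cons (H _) => //; first by rewrite /step /fetch /= e.
exact: allle_upd.
Qed.

Lemma st_store a b : nth IHalt P p = IStore a b ->
  (allle W (upd R (R a) (R b)) ->
   steps P W (State p.+1 (upd R (R a) (R b))) t st') ->
  steps P W (State p R) t.+1 st'.
Proof.
move=> e H; apply: steps_cons (H _) => //; first by rewrite /step /fetch /= e.
exact: allle_upd.
Qed.

Lemma st_jz r l : nth IHalt P p = IJz r l ->
  steps P W (State (if R r == 0 then l else p.+1) R) t st' ->
  steps P W (State p R) t.+1 st'.
Proof. by move=> e H; apply: steps_cons H => //; rewrite /step /fetch /= e. Qed.

End StepLemmas.

Definition sim (base : nat) (m : store) (R : nat -> nat) : Prop :=
  [/\ forall x, x < NV -> R x = var m x,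
      R NV = base
    & forall A i, A < NA -> R (base + i * NA + A) = arr m A i].

Definition bounded (m : store) (b : nat) : Prop :=
  (forall x, x < NV -> var m x <= b) /\
  (forall A i, A < NA -> arr m A i <= b).

Lemma bounded_mono m a b : bounded m a -> a <= b -> bounded m b.
Proof. by move=> [H1 H2] ab; split=> *; apply: leq_trans ab; auto. Qed.

Lemma ev_dg m b e d : bounded m b -> 8 <= b -> wfe d e ->
  ev m e <= (b + 2) ^ dg e.
Proof.
move=> [B1 B2] Hb.
have pw k : 0 < k -> 2 <= (b + 2) ^ k.
  by move=> k0; apply: (@leq_trans ((b + 2) ^ 1)); rewrite ?leq_exp2l; lia.
have dg0 e' : 0 < dg e' by elim: e' => //= *; lia.
elim: e d => //=.
- by move=> c d /andP [_ H]; rewrite expn1; lia.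
- by move=> x d /andP [_ H]; rewrite expn1; have := B1 x H; lia.
- by move=> A e _ d /and3P [_ HA _]; rewrite expn1; have := B2 A (ev m e) HA; lia.
- move=> a IHa c IHc d /andP [_] /andP [/IHa Ha /IHc Hc].
  rewrite expnD; have := pw _ (dg0 a); have := pw _ (dg0 c); nia.
- by move=> a IHa c IHc d /andP [_] /andP [/IHa Ha /IHc Hc]; lia.
- move=> a IHa c IHc d /andP [_] /andP [/IHa Ha /IHc Hc].
  by rewrite expnD; apply: leq_mul.
Qed.

Lemma wfe_dg d e : wfe d e -> dg e <= DG.
Proof. by case: e => /= *; lia. Qed.

Lemma ev_gr m b e d : bounded m b -> 8 <= b -> wfe d e -> gr e ->
  ev m e <= b + 8.
Proof.
move=> [B1 B2] Hb; elim: e d => //=.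
- by move=> *; lia.
- by move=> x d /andP [_ /B1]; lia.
- by move=> A e _ d /and3P [_ HA _] _; have := B2 A (ev m e) HA; lia.
- case=> // [x _|A e _]; case=> // c _ d /= /andP [_] /andP [/andP [_ H] _] Hc.
    by have := B1 x H; lia.
  have /andP [HA _] := H; have := B2 A (ev m e) HA; lia.
- by move=> a IHa c IHc d /andP [_] /andP [/IHa Ha _] /Ha; lia.
Qed.

Lemma bounded_setv m b x a : bounded m b -> a <= b -> bounded (setv m x a) b.
Proof. by move=> [H1 H2] Ha; split=> //= y Hy; rewrite /upd; case: ifP; auto. Qed.

Lemma bounded_seta m b A i a : bounded m b -> a <= b -> A < NA ->
  bounded (seta m A i a) b.
Proof.
move=> [H1 H2] Ha HA; split=> //= B j HB; case: ifP; auto.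
by rewrite /upd; case: ifP; auto.
Qed.

Lemma loopS x c m k : loop x c m k.+1 = run c (setv (loop x c m k) x k).
Proof. by []. Qed.

Lemma run_bounded c m b dl : wf dl c -> bounded m b -> 8 <= b ->
  bounded (run c m) (b + 8 * tm c m).
Proof.
elim: c m b dl => /=.
- by move=> m b dl _ H _; rewrite muln0 addn0.
- move=> x e m b dl /and3P [Hx Hg Hw] Hb H8.
  have := ev_gr Hb H8 Hw Hg => Hv.
  by apply: bounded_setv; [apply: bounded_mono Hb _|]; lia.
- move=> A e1 e2 m b dl /and4P [HA Hg H1 H2] Hb H8.
  have := ev_gr Hb H8 H2 Hg => Hv.
  by apply: bounded_seta => //; [apply: bounded_mono Hb _|]; lia.
- move=> c1 IH1 c2 IH2 m b dl /andP [H1 H2] Hb H8.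
  by rewrite mulnDr addnA; apply: IH2 H2 _ _; [apply: IH1 H1 _ _|lia].
- move=> e c1 IH1 c2 IH2 m b dl /and3P [_ H1 H2] Hb H8; case: ifP => _.
    by apply: bounded_mono; [apply: IH2 H2 Hb H8|lia].
  by apply: bounded_mono; [apply: IH1 H1 Hb H8|lia].
- move=> x e c IH m b dl /and5P [Hx Hg Hw _ Hc] Hb H8.
  have Hv := ev_gr Hb H8 Hw Hg.
  rewrite -[iteri _ _ _]/(loop x c m (ev m e)).
  have : ev m e <= ev m e by [].
  elim: {1 3 4}(ev m e) => [_|k IHk Hk].
    by rewrite big_geq //=; apply: bounded_mono Hb _; lia.
  rewrite big_nat_recr //= -/(loop x c m k).
  have Hk' := IHk (ltnW Hk).
  set t := \sum_(0 <= i < k) _ in Hk' *.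
  have Hs : bounded (setv (loop x c m k) x k) (b + 8 * (et e + 5 + t)).
    by apply: bounded_setv => //; lia.
  by apply: bounded_mono (IH _ _ _ Hc Hs _) _; lia.
Qed.

Section Compile.
Variables (P : seq instr) (W base : nat).
Hypothesis Hbase : FX <= base.

Definition wok (v : nat) : Prop := base + NA * (v + 2) ^ DG + 2 * NA <= W.

Lemma wok_mono v v' : wok v -> v' <= v -> wok v'.
Proof.
rewrite /wok => H Hv.
have : (v' + 2) ^ DG <= (v + 2) ^ DG by rewrite leq_exp2r //; lia.
lia.
Qed.

Lemma size_cexp e d : size (cexp e d) = et e.
Proof.
elim: e d => //= [A e IH d|a IHa b IHb d|a IHa b IHb d|a IHa b IHb d].
- by rewrite size_cat IH.
- by rewrite !size_cat IHa IHb /= addnA.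
- by rewrite !size_cat IHa IHb /= addnA.
- by rewrite !size_cat IHa IHb /= addnA.
Qed.

Lemma sim_eq m R R' : sim base m R ->
  (forall r, r <= NV \/ FX <= r -> R' r = R r) -> sim base m R'.
Proof.
move=> [H1 H2 H3] H; split=> *; rewrite H; auto; try lia.
Qed.

Lemma wok_ev m v d e : bounded m v -> 8 <= v -> wok v -> wfe d e ->
  base + NA * ev m e + 2 * NA <= W.
Proof.
move=> Hb H8 Hv Hw; move: Hv; rewrite /wok; have := ev_dg Hb H8 Hw.
have : (v + 2) ^ dg e <= (v + 2) ^ DG by rewrite leq_exp2l ?(wfe_dg Hw) //; lia.
lia.
Qed.

Definition stepsR p R t p' (Q : (nat -> nat) -> Prop) : Prop :=
  exists2 R', steps P W (State p R) t (State p' R') & Q R'.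

Lemma stepsR_trans p R t1 p1 Q1 t2 p2 Q :
  stepsR p R t1 p1 Q1 ->
  (forall R1, Q1 R1 -> allle W R1 -> stepsR p1 R1 t2 p2 Q) ->
  stepsR p R (t1 + t2) p2 Q.
Proof.
move=> [R1 s1 q1] H; have [R2 s2 q2] := H R1 q1 (steps_le s1).
by exists R2 => //; apply: steps_trans s1 s2.
Qed.

Lemma updE R r a q : upd R r a q = if q == r then a else R q.
Proof. by []. Qed.

Lemma cexp_ok m v e d p R :
  wfe d e -> bounded m v -> 8 <= v -> wok v -> code_at P p (cexp e d) ->
  sim base m R -> allle W R ->
  stepsR p R (et e) (p + et e) (fun R' =>
    R' (TB + d) = ev m e /\ forall r, r < TB + d \/ FX <= r -> R' r = R r).
Proof.
move=> + Hb H8 Hv.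
elim: e d p R => [c|x|A e IH|a IHa b IHb|a IHa b IHb|a IHa b IHb] d p R Hw0;
  move: (Hw0) => /= Hw.
- move=> Hc Hr HR; have [i0 _] := code_at_cons Hc.
  exists (upd R (TB + d) c).
    have := wok_ev Hb H8 Hv Hw0 => /= H.
    by apply: (st_const HR i0) => [|H']; [lia|rewrite addn1; apply: steps_refl].
  by split=> [|r Hr']; rewrite updE; case: ifP; lia.
- move=> Hc [Hr1 _ _] HR; have [i0 /code_at_cons [i1 _]] := code_at_cons Hc.
  have Hx : x < NV by lia.
  have := wok_ev Hb H8 Hv Hw0 => /= H.
  pose R1 := upd R (TB + d) 0.
  exists (upd R1 (TB + d) (R1 x + R1 (TB + d))).
    apply: (st_const HR i0) => // HR1.
    apply: (st_add HR1 i1) => [|HR2].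
      by rewrite /R1 !updE eqxx addn0; case: ifP.
    by rewrite addn2; apply: steps_refl.
  split=> [|r Hr']; rewrite /R1 !updE.
    by rewrite eqxx; case: ifP => [|_]; [lia|rewrite addn0 Hr1].
  by do ?case: ifP => //; lia.
- move=> Hc Hr HR; have [Hc1] := code_at_cat Hc; rewrite size_cexp => Hc2.
  have [i1 /code_at_cons [i2 /code_at_cons [i3 /code_at_cons [i4
    /code_at_cons [i5 /code_at_cons [i6 _]]]]]] := code_at_cons Hc2.
  have [Hd HA Hwe] : [/\ d + 2 <= FX - TB, A < NA & wfe d e] by split; lia.
  have Hidx := wok_ev Hb H8 Hv Hwe.
  rewrite addnA.
  apply: stepsR_trans (IH _ _ _ Hwe Hc1 Hr HR) _ => R1 [E1 F1] HR1.
  have Hr1 : sim base m R1 by apply: sim_eq Hr _ => r ?; apply: F1; lia.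
  have [_ Eb Ea] := Hr1.
  set i := ev m e in E1 Hidx *; set t := TB + d in E1 F1 i1 i2 i3 i4 i5 i6 *.
  pose R2 := upd R1 t.+1 NA; pose R3 := upd R2 t (R2 t * R2 t.+1).
  pose R4 := upd R3 t (R3 t + R3 NV); pose R5 := upd R4 t.+1 A.
  pose R6 := upd R5 t (R5 t + R5 t.+1); pose R7 := upd R6 t (R6 (R6 t)).
  have tt : (t == t.+1) = false by lia.
  have tt' : (t.+1 == t) = false by lia.
  have nt : (NV == t) = false by rewrite /t; lia.
  have nt' : (NV == t.+1) = false by rewrite /t; lia.
  have v3 : R3 t = i * NA by rewrite /R3 /R2 !updE !eqxx tt E1.
  have v4 : R4 t = i * NA + base.
    by rewrite /R4 updE eqxx v3 /R3 !updE nt /R2 updE nt' Eb.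
  have v5 : R5 t = i * NA + base by rewrite /R5 updE tt v4.
  have v6 : R6 t = base + i * NA + A.
    by rewrite /R6 updE eqxx v5 /R5 updE eqxx; lia.
  have v6' r : r <> t -> r <> t.+1 -> R6 r = R1 r.
    by move=> n1 n2; rewrite /R6 /R5 /R4 /R3 /R2 !updE; do ?case: ifP => //; lia.
  exists R7.
    have -> : p + et e + 6 = (p + et e).+1.+1.+1.+1.+1.+1 by lia.
    apply: (st_const HR1 i1) => [|HR2]; first by lia.
    apply: (st_mul HR2 i2) => [|HR3]; first by rewrite !updE !eqxx tt E1; lia.
    apply: (st_add HR3 i3) => [|HR4].
      by rewrite -/R2 -/R3 v3 /R3 updE nt /R2 updE nt' Eb; lia.
    apply: (st_const HR4 i4) => [|HR5]; first by lia.
    apply: (st_add HR5 i5) => [|HR6].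
      by rewrite -/R2 -/R3 -/R4 -/R5 v5 /R5 updE eqxx; lia.
    by apply: (st_load HR6 i6) => HR7; apply: steps_refl.
  split; last first.
    move=> r Hr'; rewrite /R7 updE ifF ?v6' ?F1 //; lia.
  rewrite /R7 updE eqxx v6 v6' ?Ea //; rewrite /t; lia.
- move=> Hc Hr HR; have [Hc1] := code_at_cat Hc; rewrite size_cexp => Hc2.
  have [Hc3] := code_at_cat Hc2; rewrite size_cexp => /code_at_cons [i1 _].
  have [Hd Hwa Hwb] : [/\ d + 2 <= FX - TB, wfe d a & wfe d.+1 b] by split; lia.
  have Hidx : base + NA * (ev m a + ev m b) + 2 * NA <= W.
    exact: (wok_ev (e := Add a b) (d := d) Hb H8 Hv).
  rewrite -addnA.
  apply: stepsR_trans (IHa _ _ _ Hwa Hc1 Hr HR) _ => R1 [E1 F1] HR1.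
  have Hr1 : sim base m R1 by apply: sim_eq Hr _ => r ?; apply: F1; lia.
  apply: stepsR_trans (IHb _ _ _ Hwb Hc3 Hr1 HR1) _ => R2 [E2 F2] HR2.
  rewrite addnS in E2.
  have E3 : R2 (TB + d) = ev m a by rewrite F2 ?E1 //; lia.
  exists (upd R2 (TB + d) (R2 (TB + d) + R2 (TB + d).+1)).
    apply: (st_add HR2 i1) => [|HR3]; first by rewrite E2 E3; lia.
    by rewrite !addnA addn1; apply: steps_refl.
  split=> [|r Hr']; first by rewrite updE eqxx E2 E3.
  by rewrite updE ifF ?F2 ?F1 //; lia.
- move=> Hc Hr HR; have [Hc1] := code_at_cat Hc; rewrite size_cexp => Hc2.
  have [Hc3] := code_at_cat Hc2; rewrite size_cexp => /code_at_cons [i1 _].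
  have [Hd Hwa Hwb] : [/\ d + 2 <= FX - TB, wfe d a & wfe d.+1 b] by split; lia.
  rewrite -addnA.
  apply: stepsR_trans (IHa _ _ _ Hwa Hc1 Hr HR) _ => R1 [E1 F1] HR1.
  have Hr1 : sim base m R1 by apply: sim_eq Hr _ => r ?; apply: F1; lia.
  apply: stepsR_trans (IHb _ _ _ Hwb Hc3 Hr1 HR1) _ => R2 [E2 F2] HR2.
  rewrite addnS in E2.
  have E3 : R2 (TB + d) = ev m a by rewrite F2 ?E1 //; lia.
  exists (upd R2 (TB + d) (R2 (TB + d) - R2 (TB + d).+1)).
    by apply: (st_sub HR2 i1) => HR3; rewrite !addnA addn1; apply: steps_refl.
  split=> [|r Hr']; first by rewrite updE eqxx E2 E3.
  by rewrite updE ifF ?F2 ?F1 //; lia.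
- move=> Hc Hr HR; have [Hc1] := code_at_cat Hc; rewrite size_cexp => Hc2.
  have [Hc3] := code_at_cat Hc2; rewrite size_cexp => /code_at_cons [i1 _].
  have [Hd Hwa Hwb] : [/\ d + 2 <= FX - TB, wfe d a & wfe d.+1 b] by split; lia.
  have Hidx : base + NA * (ev m a * ev m b) + 2 * NA <= W.
    exact: (wok_ev (e := Mul a b) (d := d) Hb H8 Hv).
  rewrite -addnA.
  apply: stepsR_trans (IHa _ _ _ Hwa Hc1 Hr HR) _ => R1 [E1 F1] HR1.
  have Hr1 : sim base m R1 by apply: sim_eq Hr _ => r ?; apply: F1; lia.
  apply: stepsR_trans (IHb _ _ _ Hwb Hc3 Hr1 HR1) _ => R2 [E2 F2] HR2.
  rewrite addnS in E2.
  have E3 : R2 (TB + d) = ev m a by rewrite F2 ?E1 //; lia.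
  exists (upd R2 (TB + d) (R2 (TB + d) * R2 (TB + d).+1)).
    apply: (st_mul HR2 i1) => [|HR3]; first by rewrite E2 E3; lia.
    by rewrite !addnA addn1; apply: steps_refl.
  split=> [|r Hr']; first by rewrite updE eqxx E2 E3.
  by rewrite updE ifF ?F2 ?F1 //; lia.
Qed.

Lemma sim_setv m R x a : sim base m R -> x < NV ->
  sim base (setv m x a) (upd R x a).
Proof.
move=> [H1 H2 H3] Hx; split=> [y Hy||A i HA]; rewrite /= /upd.
- by case: ifP => // _; apply: H1.
- by rewrite ifF ?H2 //; lia.
- by rewrite ifF ?H3 //; lia.
Qed.

Lemma sim_seta m R A i a : sim base m R -> A < NA ->
  sim base (seta m A i a) (upd R (base + i * NA + A) a).
Proof.
move=> [H1 H2 H3] HA; split=> [y Hy||B j HB]; rewrite /= /upd.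
- by rewrite ifF ?H1 //; lia.
- by rewrite ifF ?H2 //; lia.
- case: (eqVneq B A) => [->|nBA]; last by rewrite ifF ?H3 //; lia.
  case: (eqVneq j i) => [->|nji]; first by rewrite eqxx.
  by rewrite ifF ?H3 //; lia.
Qed.

Lemma code_ok c dl p m b R :
  dl <= 5 -> wf dl c -> bounded m b -> 8 <= b -> wok (b + 8 * tm c m) ->
  code_at P p (code c dl p) -> sim base m R -> allle W R ->
  stepsR p R (tm c m) (p + size (code c dl p)) (fun R' =>
    sim base (run c m) R' /\ forall r, LR <= r < LR + 2 * dl -> R' r = R r).
Proof.
elim: c dl p m b R.
- move=> dl p m b R _ _ _ _ _ _ Hr HR; rewrite addn0.
  by exists R => //; apply: steps_refl.
- move=> x e dl p m b R Hdl5 /= /and3P [Hx Hg Hw] Hb H8 Hk.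
  move=> /code_at_cat [Hc1]; rewrite size_cexp.
  move=> /code_at_cons [i1 /code_at_cons [i2 _]] Hr HR.
  have Hk' := wok_mono Hk (leq_addr _ _).
  rewrite size_cat size_cexp /= addnA.
  apply: stepsR_trans (cexp_ok Hw Hb H8 Hk' Hc1 Hr HR) _ => R1 [E1 F1] HR1.
  rewrite addn0 in E1.
  exists (upd (upd R1 TB.+1 0) x (ev m e)).
    apply: (st_const HR1 i1) => // HR2.
    apply: (st_add HR2 i2) => [|HR3]; first by rewrite /= /upd /= addn0.
    move: HR3; rewrite [upd _ _ _ TB]/upd [upd _ _ _ TB.+1]/upd /= E1 addn0.
    by rewrite addn2 => HR3; apply: steps_refl.
  split=> [|r Hr'].
    by apply: sim_setv => //; apply: sim_eq Hr _ => r Hr'; rewrite updE ifF ?F1; lia.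
  by rewrite !updE !ifF ?F1; lia.
- move=> A e1 e2 dl p m b R Hdl5 /= /and4P [HA Hg Hw1 Hw2] Hb H8 Hk.
  move=> /code_at_cat [Hc1]; rewrite size_cexp.
  move=> /code_at_cons [i1 /code_at_cons [i2 /code_at_cons [i3 /code_at_cons
    [i4 /code_at_cons [i5 Hc2]]]]] Hr HR.
  have Hk' := wok_mono Hk (leq_addr _ _).
  have := code_at_cat Hc2; rewrite size_cexp => -[Hc3 /code_at_cons [i6 _]].
  rewrite size_cat /= size_cat !size_cexp /=.
  have -> : et e1 + et e2 + 6 = et e1 + (5 + (et e2 + 1)) by lia.
  apply: stepsR_trans (cexp_ok Hw1 Hb H8 Hk' Hc1 Hr HR) _ => R1 [E1 F1] HR1.
  rewrite addn0 in E1 F1.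
  have Hr1 : sim base m R1 by apply: sim_eq Hr _ => r ?; apply: F1; lia.
  have [_ Eb _] := Hr1.
  have Hidx := wok_ev Hb H8 Hk' Hw1.
  set i := ev m e1 in E1 Hidx *.
  pose R2 := upd R1 TB.+1 NA; pose R3 := upd R2 TB (R2 TB * R2 TB.+1).
  pose R4 := upd R3 TB (R3 TB + R3 NV); pose R5 := upd R4 TB.+1 A.
  pose R6 := upd R5 TB (R5 TB + R5 TB.+1).
  have v6 : R6 TB = base + i * NA + A.
    by rewrite /R6 /R5 /R4 /R3 /R2 /upd /= E1 Eb; lia.
  have f6 r : r <> TB -> r <> TB.+1 -> R6 r = R1 r.
    by move=> n1 n2; rewrite /R6 /R5 /R4 /R3 /R2 !updE; do ?case: ifP => //; lia.
  apply: (@stepsR_trans _ _ _ (p + et e1).+1.+1.+1.+1.+1 (eq R6)).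
    exists R6 => //.
    apply: (st_const HR1 i1) => [|HR2]; first by lia.
    apply: (st_mul HR2 i2) => [|HR3]; first by rewrite /upd /= E1; lia.
    apply: (st_add HR3 i3) => [|HR4]; first by rewrite /upd /= E1 Eb; lia.
    apply: (st_const HR4 i4) => [|HR5]; first by lia.
    apply: (st_add HR5 i5) => [|HR6]; first by rewrite /upd /= E1 Eb; lia.
    exact: steps_refl.
  move=> _ <- HR6.
  have Hr6 : sim base m R6 by apply: sim_eq Hr1 _ => r ?; apply: f6; lia.
  have -> : p + (et e1 + (et e2 + 1).+1.+4) =
            (p + et e1).+1.+1.+1.+1.+1 + et e2 + 1 by lia.
  apply: stepsR_trans (cexp_ok Hw2 Hb H8 Hk' Hc3 Hr6 HR6) _ => R7 [E7 F7] HR7.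
  exists (upd R7 (base + i * NA + A) (ev m e2)).
    have v7 : R7 TB = base + i * NA + A by rewrite F7 ?v6 //; lia.
    apply: (st_store HR7 i6) => HR8; move: HR8.
    by rewrite addn1 v7 -E7 => HR8; apply: steps_refl.
  split=> [|r Hr'].
    by apply: sim_seta => //; apply: sim_eq Hr6 _ => r ?; apply: F7; lia.
  by rewrite updE ifF ?F7 ?f6 ?F1 //; lia.
- move=> c1 IH1 c2 IH2 dl p m b R Hdl5 /= /andP [Hw1 Hw2] Hb H8 Hk.
  move=> /code_at_cat [Hc1 Hc2] Hr HR; rewrite size_cat addnA.
  have Hk1 : wok (b + 8 * tm c1 m) by apply: wok_mono Hk _; lia.
  apply: stepsR_trans (IH1 _ _ _ _ _ Hdl5 Hw1 Hb H8 Hk1 Hc1 Hr HR) _.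
  move=> R1 [Hr1 F1] HR1.
  have Hb1 := run_bounded Hw1 Hb H8.
  have [||R2 s2 [Hr2 F2]] := IH2 _ _ _ _ _ Hdl5 Hw2 Hb1 _ _ Hc2 Hr1 HR1.
  + by lia.
  + by apply: wok_mono Hk _; lia.
  + by exists R2 => //; split=> // r Hr'; rewrite F2 ?F1.
- move=> e c1 IH1 c2 IH2 dl p m b R Hdl5 /= /and3P [Hw Hw1 Hw2] Hb H8 Hk.
  move=> /code_at_cat [Hc]; rewrite size_cexp.
  move=> /code_at_cons [i1 /code_at_cat [Hc1 /code_at_cons [i2
    /code_at_cons [i3 Hc2]]]] Hr HR.
  have Hk' := wok_mono Hk (leq_addr _ _).
  rewrite size_cat /= size_cat /= size_cexp.
  set k1 := code c1 dl _ in Hc1 i1 i2 i3 Hc2 *.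
  set p2 := p + et e + 1 + size k1 + 2 in i1 Hc2 i3 *.
  set k2 := code c2 dl _ in Hc2 i3 *.
  have -> : p + (et e + (size k1 + (size k2).+2).+1) = p2 + size k2.
    by rewrite /p2; lia.
  rewrite -addnA.
  apply: stepsR_trans (cexp_ok Hw Hb H8 Hk' Hc Hr HR) _ => R1 [E1 F1] HR1.
  rewrite addn0 in E1.
  have Hr1 : sim base m R1 by apply: sim_eq Hr _ => r ?; apply: F1; lia.
  apply: (@stepsR_trans _ _ _ (if ev m e == 0 then p2 else (p + et e).+1) (eq R1)).
    exists R1 => //; apply: (st_jz HR1 i1); rewrite E1; exact: steps_refl.
  move=> _ <- _; case: ifP Hk => [e0|e0] Hk.
    have [||R2 s2 [Hr2 F2]] := IH2 _ p2 _ _ _ Hdl5 Hw2 Hb H8 _ _ Hr1 HR1.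
    + by apply: wok_mono Hk _; lia.
    + have ep2 : ((p + et e).+1 + size k1).+2 = p2 by rewrite /p2; lia.
      by rewrite ep2 in Hc2.
    + by exists R2 => //; split=> // r Hr'; rewrite F2 ?F1 //; lia.
  have [||R2 s2 [Hr2 F2]] := IH1 dl (p + et e + 1) _ _ _ Hdl5 Hw1 Hb H8 _ _ Hr1 HR1.
  + by apply: wok_mono Hk _; lia.
  + have ep1 : (p + et e).+1 = p + et e + 1 by lia.
    by rewrite ep1 in Hc1.
  + have HR2 := steps_le s2; rewrite addn1 in s2.
    exists (upd R2 TB 0).
      apply: steps_trans s2 _.
      rewrite -/k1 -addn1 in i2 i3 *.
      apply: (st_const HR2 i2) => // HR3.
      by apply: (st_jz HR3 i3); rewrite /upd /=; apply: steps_refl.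
    split=> [|r Hr'].
      by apply: sim_eq Hr2 _ => r ?; rewrite updE ifF //; lia.
    by rewrite updE ifF ?F2 ?F1 //; lia.
- move=> x e c IH dl p m b R Hdl5 /= /and5P [Hx Hg Hw Hdl Hwc] Hb H8 Hk.
  move=> /code_at_cat [Hc]; rewrite size_cexp.
  set p1 := p + et e + 3; set k := code c dl.+1 _; set lc := LR + 2 * dl.
  move=> /code_at_cons [i1 /code_at_cons [i2 /code_at_cons [i3 /code_at_cons
    [i4 /code_at_cons [i5 /code_at_cons [i6 /code_at_cons [i7
    /code_at_cat [Hck /code_at_cons [j1 /code_at_cons [j2 /code_at_cons
    [j3 /code_at_cons [j4 _]]]]]]]]]]]] Hr HR.
  have Hk' := wok_mono Hk (leq_addr _ _).
  have Hidx := wok_ev Hb H8 Hk' Hw.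
  have Hgr := ev_gr Hb H8 Hw Hg.
  have ep1 : (p + et e).+1.+1.+1 = p1 by rewrite /p1; lia.
  have ep2 : p1.+4 = p1 + 4 by lia.
  rewrite ep1 in i4 i5 i6 i7 Hck j1 j2 j3 j4.
  rewrite ep2 in Hck j1 j2 j3 j4.
  set N := ev m e in Hk Hidx Hgr *.
  pose T j := \sum_(0 <= i < j) (tm c (setv (loop x c m i) x i) + 8).
  rewrite -/(T N) in Hk *.
  have TS j : T j.+1 = T j + (tm c (setv (loop x c m j) x j) + 8).
    by rewrite /T big_nat_recr.
  have Tle j : j <= N -> T j <= T N.
    by move=> jN; rewrite [T N](@big_cat_nat _ _ _ j) //=; apply: leq_addr.
  rewrite size_cat /= size_cat /= size_cexp -/k.
  have -> : p + (et e + (size k + 4).+4.+3) = p1 + size k + 8.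
    by rewrite /p1; lia.
  have -> : et e + 5 + T N = et e + (3 + (T N + 2)) by lia.
  apply: stepsR_trans (cexp_ok Hw Hb H8 Hk' Hc Hr HR) _ => R1 [E1 F1] HR1.
  rewrite addn0 -/N in E1 F1.
  have Hr1 : sim base m R1 by apply: sim_eq Hr _ => r ?; apply: F1; lia.
  pose R2 := upd (upd (upd R1 lc 0) TB.+1 0) lc.+1 N.
  apply: (@stepsR_trans _ _ _ p1 (eq R2)).
    exists R2 => //.
    apply: (st_const HR1 i1) => // HR2.
    apply: (st_const HR2 i2) => // HR3.
    have eN : upd (upd R1 lc 0) TB.+1 0 TB + upd (upd R1 lc 0) TB.+1 0 TB.+1 = N.
      by rewrite /upd eqxx addn0 /= ifF ?E1 //; rewrite /lc; lia.
    apply: (st_add HR3 i3); rewrite eN; first by lia.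
    by move=> HR4; rewrite ep1; apply: steps_refl.
  move=> _ <- HR2.
  have Hr2 : sim base m R2.
    apply: sim_eq Hr1 _ => r ?; rewrite /R2 /lc !updE !ifF //; lia.
  have F2 r : LR <= r < lc -> R2 r = R r.
    by move=> ?; rewrite /R2 /lc !updE !ifF ?F1 //; rewrite /lc; lia.
  have inv j : j <= N -> stepsR p1 R2 (T j) p1 (fun R' =>
      [/\ sim base (loop x c m j) R', R' lc = j, R' lc.+1 = N
        & forall r, LR <= r < lc -> R' r = R r]) /\
      bounded (loop x c m j) (b + 8 * (et e + 5 + T j)).
    elim: j => [_|j IHj jN].
      rewrite /T big_geq //; split; last by apply: bounded_mono Hb _; lia.
      exists R2; first exact: steps_refl.
      split=> //; rewrite /R2 !updE ?eqxx // !ifF ?eqxx //; rewrite /lc; lia.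
    have [Hs Hbj] := IHj (ltnW jN).
    have Hb' : bounded (setv (loop x c m j) x j) (b + 8 * (et e + 5 + T j)).
      by apply: bounded_setv => //; lia.
    have TjN := Tle _ jN; rewrite TS in TjN.
    split; last first.
      rewrite loopS TS; apply: bounded_mono (run_bounded Hwc Hb' _) _; lia.
    rewrite TS; apply: stepsR_trans Hs _ => R3 [Hr3 L3 M3 F3] HR3.
    set tj := tm c _ in TjN *; have -> : tj + 8 = 4 + (tj + 4) by lia.
    pose R4 := upd (upd (upd R3 TB (R3 lc.+1 - R3 lc)) TB 0) x j.
    apply: (@stepsR_trans _ _ _ (p1 + 4) (eq R4)).
      exists R4 => //; rewrite addn4.
      have lcT : (lc == TB) = false by rewrite /lc; lia.
      apply: (st_sub HR3 i4) => HR4; apply: (st_jz HR4 i5).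
      rewrite {1}/upd eqxx ifF; last by rewrite L3 M3; lia.
      apply: (st_const HR4 i6) => // HR5.
      have eN : upd (upd R3 TB (R3 lc.+1 - R3 lc)) TB 0 lc +
                upd (upd R3 TB (R3 lc.+1 - R3 lc)) TB 0 TB = j.
        by rewrite /upd eqxx addn0 /= lcT.
      apply: (st_add HR5 i7); rewrite eN; first by lia.
      by move=> HR6; apply: steps_refl.
    move=> _ <- HR4.
    have Hr4 : sim base (setv (loop x c m j) x j) R4.
      apply: sim_setv => //; apply: sim_eq Hr3 _ => r ?; rewrite !updE !ifF //; lia.
    have F4 r : LR <= r < TB -> R4 r = R3 r.
      by move=> ?; rewrite /R4 !updE !ifF //; lia.
    have [||R5 s5 [Hr5 F5]] := IH dl.+1 _ _ _ _ Hdl Hwc Hb' _ _ Hck Hr4 HR4.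
    + by lia.
    + by apply: wok_mono Hk _; lia.
    have HR5 := steps_le s5.
    have L5 : R5 lc = j by rewrite F5 ?F4 ?L3 // /lc; lia.
    have M5 : R5 lc.+1 = N by rewrite F5 ?F4 ?M3 // /lc; lia.
    pose R6 := upd (upd (upd R5 TB 1) lc j.+1) TB 0.
    exists R6; last first.
      have nlc : (lc == TB) = false by rewrite /lc; lia.
      have nlc' : (lc.+1 == TB) = false by rewrite /lc; lia.
      have nlc2 : (lc.+1 == lc) = false by lia.
      split.
      - by apply: sim_eq Hr5 _ => r ?; rewrite /R6 /lc !updE !ifF //; lia.
      - by rewrite /R6 !updE nlc eqxx.
      - by rewrite /R6 !updE nlc' nlc2.
      - by move=> r Hr'; rewrite /R6 !updE !ifF ?F5 ?F4 ?F3 //; move: Hr'; rewrite /lc; lia.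
    apply: steps_trans s5 _.
    apply: (st_const HR5 j1) => [|HR6]; first by lia.
    have eJ : upd R5 TB 1 lc + upd R5 TB 1 TB = j.+1.
      by rewrite /upd eqxx ifF ?L5 ?addn1 // /lc; lia.
    apply: (st_add HR6 j2); rewrite eJ; first by lia.
    move=> HR7; apply: (st_const HR7 j3) => // HR8.
    by apply: (st_jz HR8 j4); rewrite {1}/upd /=; apply: steps_refl.
  have [Hs _] := inv N (leqnn N).
  apply: stepsR_trans Hs _ => R3 [Hr3 L3 M3 F3] HR3.
  exists (upd R3 TB 0).
    apply: (st_sub HR3 i4); rewrite M3 L3 subnn => HR4.
    by apply: (st_jz HR4 i5); rewrite {1}/upd /=; apply: steps_refl.
  split=> [|r Hr']; first by apply: sim_eq Hr3 _ => r ?; rewrite updE ifF //; lia.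
  by rewrite updE ifF ?F3 //; rewrite /lc; lia.
Qed.

End Compile.

(** * Loading the input *)

(* The input occupies the registers from 0 on, so it is first copied to
   array 0.  Cell 2m+n lies beyond the input and temporarily holds
   register 2; registers 0 and 1 then suffice to free the others. *)
Definition pre1 (z : nat) : seq instr :=
  [:: IJz 1 z; IAdd 0 0 1; IAdd 0 0 1; IStore 0 2; IConst 2 FX; IAdd 0 0 2;
      IConst 2 (3 * NA); IAdd 2 2 0; IStore 2 3;
      IConst 3 FX; ISub 3 0 3; ILoad 3 3;
      IConst 2 (2 * NA); IAdd 2 2 0; IStore 2 3].

Definition pre2 (x k : nat) : seq instr :=
  flatten [seq [:: IConst 2 (y * NA); IAdd 2 2 0; IStore 2 y] | y <- iota x k].

Definition pre3 : seq instr :=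
  [:: IConst 2 0; IAdd NV 0 2; IConst 3 FX; ISub 3 0 3; ISub 3 3 1; ISub 3 3 1;
      IConst 4 FX; IConst 5 (NA * FX); IAdd 5 5 0; IConst 6 2; IAdd 6 6 1;
      IAdd 6 6 1; IConst 7 1; IConst 8 NA].

Definition pre4 (p : nat) : seq instr :=
  [:: ISub 9 6 4; IJz 9 (p + 8); ILoad 10 4; IStore 5 10; IAdd 4 4 7;
      IAdd 5 5 8; IConst 9 0; IJz 9 p].

Notation PM := 208.

Definition prog (c : cmd) : seq instr :=
  let k := code c 0 PM in
  pre1 (PM + size k + 1) ++ pre2 4 57 ++ pre3 ++ pre4 200 ++ k ++
  [:: IHalt; IConst 0 0; IHalt].

Lemma size_pre2 x k : size (pre2 x k) = 3 * k.
Proof. by elim: k x => //= k IH x; rewrite /pre2 /= -/(pre2 x.+1 k) IH; lia. Qed.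

Lemma halt_runs P n s W st t : 
  steps P W (init_state n s) t st -> nth IHalt P (pc st) = IHalt ->
  runs_in P n s t (regs st 0) W.
Proof. by move=> [e b] h; split; rewrite ?e // /halted /fetch h. Qed.

Ltac ifs := repeat match goal with |- context [if ?b then _ else _] =>
  let E := fresh "E" in destruct b eqn:E; try lia end; try lia.

Section Load.
Variables (P : seq instr) (W n m z : nat) (I0 : nat -> nat).
Hypotheses (n2 : 1 < n) (m1 : 0 < m).
Hypotheses (I00 : I0 0 = n) (I01 : I0 1 = m).
Hypothesis I0z : forall r, 2 * m + 2 <= r -> I0 r = 0.
Variables (a base : nat).
Hypotheses (Ha : a = n + m + m) (Hbase : base = a + FX).
Hypothesis HW : base + NA * (2 * m + FX + 2) <= W.
Hypothesis HI : allle W I0.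

Lemma pre1_ok : code_at P 0 (pre1 z) ->
  stepsR P W 0 I0 15 15 (fun R =>
    [/\ R 0 = base, R 1 = m, R (base + 2 * NA) = I0 2, R (base + 3 * NA) = I0 3
      & forall r, 1 < r -> r != 2 -> r != 3 -> r != a -> r != base + 2 * NA ->
          r != base + 3 * NA -> R r = I0 r]).
Proof.
move=> /code_at_cons [i0 /code_at_cons [i1 /code_at_cons [i2 /code_at_cons
 [i3 /code_at_cons [i4 /code_at_cons [i5 /code_at_cons [i6 /code_at_cons
 [i7 /code_at_cons [i8 /code_at_cons [i9 /code_at_cons [i10 /code_at_cons
 [i11 /code_at_cons [i12 /code_at_cons [i13 /code_at_cons [i14 _]]]]]]]]]]]]]]].
pose R1 := upd I0 0 (n + m); pose R2 := upd R1 0 a.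
pose R3 := upd R2 a (I0 2); pose R4 := upd R3 2 FX; pose R5 := upd R4 0 base.
pose R6 := upd R5 2 (3 * NA); pose R7 := upd R6 2 (3 * NA + base).
pose R8 := upd R7 (3 * NA + base) (I0 3); pose R9 := upd R8 3 FX.
pose R10 := upd R9 3 a; pose R11 := upd R10 3 (I0 2).
pose R12 := upd R11 2 (2 * NA); pose R13 := upd R12 2 (2 * NA + base).
pose R14 := upd R13 (2 * NA + base) (I0 2).
exists R14; last first.
  rewrite /R14 /R13 /R12 /R11 /R10 /R9 /R8 /R7 /R6 /R5 /R4 /R3 /R2 /R1.
  rewrite /upd; split; [| | | |move=> r *]; ifs.
apply: (st_jz HI i0); rewrite I01 ifF; last by lia.
apply: (st_add HI i1); rewrite I00 I01; first by lia.
rewrite -/R1 => H1; have e1 : R1 0 + R1 1 = a by rewrite /R1 /upd /= I01 Ha.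
apply: (st_add H1 i2); rewrite e1; first by lia.
rewrite -/R2 => H2.
have e2 : R2 0 = a by [].
have e2' : R2 2 = I0 2 by [].
apply: (st_store H2 i3); rewrite e2 e2' -/R3 => H3.
apply: (st_const H3 i4); first by lia.
rewrite -/R4 => H4.
have e4 : R4 0 + R4 2 = base by rewrite /R4 /R3 /upd; ifs.
apply: (st_add H4 i5); rewrite e4; first by lia.
rewrite -/R5 => H5.
apply: (st_const H5 i6); first by lia.
rewrite -/R6 => H6.
have e6 : R6 2 + R6 0 = 3 * NA + base by rewrite /R6 /R5 /upd; ifs.
apply: (st_add H6 i7); rewrite e6; first by lia.
rewrite -/R7 => H7.
have e7 : R7 3 = I0 3.
  by rewrite /R7 /R6 /R5 /R4 /R3 /R2 /R1 /upd; ifs.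
apply: (st_store H7 i8); rewrite e7 => H8.
apply: (st_const H8 i9); first by lia.
rewrite -/R8 -/R9 => H9.
have e9 : R9 0 - R9 3 = a.
  by rewrite /R9 /R8 /R7 /R6 /R5 /upd; ifs.
apply: (st_sub H9 i10); rewrite e9 -/R10 => H10.
have e10 : R10 (R10 3) = I0 2.
  rewrite {2}/R10 /upd eqxx /R10 /R9 /R8 /R7 /R6 /R5 /R4 /R3 /upd.
  by ifs.
apply: (st_load H10 i11); rewrite e10 -/R11 => H11.
apply: (st_const H11 i12); first by lia.
rewrite -/R12 => H12.
have e12 : R12 2 + R12 0 = 2 * NA + base.
  by rewrite /R12 /R11 /R10 /R9 /R8 /R7 /R6 /R5 /upd; ifs.
apply: (st_add H12 i13); rewrite e12; first by lia.
rewrite -/R13 => H13.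
by apply: (st_store H13 i14) => H14; apply: steps_refl.
Qed.

Lemma pre2_ok x k p R : code_at P p (pre2 x k) -> 4 <= x -> x + k <= FX ->
  R 0 = base -> allle W R ->
  stepsR P W p R (3 * k) (p + 3 * k) (fun R' =>
    (forall y, x <= y < x + k -> R' (base + y * NA) = R y) /\
    (forall r, r != 2 -> (forall y, x <= y < x + k -> r != base + y * NA) ->
      R' r = R r)).
Proof.
elim: k x p R => [|k IH] x p R.
  move=> _ _ _ _ HR; rewrite muln0 addn0; exists R; first exact: steps_refl.
  by split=> // y; lia.
rewrite /pre2 /= -/(pre2 x.+1 k).
move=> /code_at_cons [i1 /code_at_cons [i2 /code_at_cons [i3 Hc]]] Hx Hk R0 HR.
pose R1 := upd R 2 (x * NA); pose R2 := upd R1 2 (x * NA + base).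
pose R3 := upd R2 (x * NA + base) (R x).
rewrite mulnS.
apply: (@stepsR_trans _ _ _ _ _ p.+3 (eq R3)).
  exists R3 => //.
  apply: (st_const HR i1); first by lia.
  rewrite -/R1 => H1.
  have e1 : R1 2 + R1 0 = x * NA + base by rewrite /R1 /upd /= R0.
  apply: (st_add H1 i2); rewrite e1; first by lia.
  rewrite -/R2 => H2.
  have e2 : R2 x = R x by rewrite /R2 /R1 /upd; ifs.
  by apply: (st_store H2 i3); rewrite e2 => H3; apply: steps_refl.
move=> _ <- HR3.
have E3 r : r != 2 -> r != x * NA + base -> R3 r = R r.
  by move=> h1 h2; rewrite /R3 /R2 /R1 /upd; ifs.
have [||||R4 s4 [E4 F4]] := IH x.+1 _ R3 Hc.
- by lia.
- by lia.
- by rewrite E3; lia.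
- exact: HR3.
have -> : p + (3 + 3 * k) = p.+3 + 3 * k by lia.
exists R4 => //; split=> [y Hy|r r2 Hr].
  case: (eqVneq y x) => [->|nyx].
    rewrite F4 => [||y' Hy']; try lia.
    by rewrite addnC /R3 /upd eqxx.
  by rewrite E4 ?E3; lia.
rewrite F4 ?E3 //; first by have := Hr x; lia.
by move=> y Hy; apply: Hr; lia.
Qed.

Lemma pre3_ok p R : code_at P p pre3 -> R 0 = base -> R 1 = m -> allle W R ->
  stepsR P W p R 14 (p + 14) (fun R' =>
    [/\ R' NV = base, R' 1 = m, R' 3 = n, R' 4 = FX /\ R' 5 = base + NA * FX
      & [/\ R' 6 = 2 * m + 2, R' 7 = 1, R' 8 = NA
          & forall r, FX <= r -> R' r = R r]]).
Proof.
move=> /code_at_cons [i0 /code_at_cons [i1 /code_at_cons [i2 /code_at_cons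
 [i3 /code_at_cons [i4 /code_at_cons [i5 /code_at_cons [i6 /code_at_cons
 [i7 /code_at_cons [i8 /code_at_cons [i9 /code_at_cons [i10 /code_at_cons
 [i11 /code_at_cons [i12 /code_at_cons [i13 _]]]]]]]]]]]]]] e0 e1 H.
pose R1 := upd R 2 0; pose R2 := upd R1 NV base; pose R3 := upd R2 3 FX.
pose R4 := upd R3 3 a; pose R5 := upd R4 3 (n + m); pose R6 := upd R5 3 n.
pose R7 := upd R6 4 FX; pose R8 := upd R7 5 (NA * FX).
pose R9 := upd R8 5 (NA * FX + base); pose R10 := upd R9 6 2.
pose R11 := upd R10 6 (2 + m); pose R12 := upd R11 6 (2 + m + m).
pose R13 := upd R12 7 1; pose R14 := upd R13 8 NA.
exists R14; last first.
  rewrite /R14 /R13 /R12 /R11 /R10 /R9 /R8 /R7 /R6 /R5 /R4 /R3 /R2 /R1 /upd /=.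
  do ?split; try lia; move=> r Hr; by ifs.
have -> : p + 14 = p.+4.+4.+4.+2 by lia.
apply: (st_const H i0); first by lia.
rewrite -/R1 => H1.
have f1 : R1 0 + R1 2 = base by rewrite /R1 /upd; ifs.
apply: (st_add H1 i1); rewrite f1; first by lia.
rewrite -/R2 => H2; apply: (st_const H2 i2); first by lia.
rewrite -/R3 => H3; apply: (st_sub H3 i3).
have -> : R3 0 - R3 3 = a by rewrite /R3 /R2 /R1 /upd; ifs.
rewrite -/R4 => H4; apply: (st_sub H4 i4).
have -> : R4 3 - R4 1 = n + m by rewrite /R4 /R3 /R2 /R1 /upd; ifs.
rewrite -/R5 => H5; apply: (st_sub H5 i5).
have -> : R5 3 - R5 1 = n by rewrite /R5 /R4 /R3 /R2 /R1 /upd; ifs.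
rewrite -/R6 => H6; apply: (st_const H6 i6); first by lia.
rewrite -/R7 => H7; apply: (st_const H7 i7); first by lia.
have e8 : R8 5 + R8 0 = NA * FX + base.
  by rewrite /R8 /R7 /R6 /R5 /R4 /R3 /R2 /R1 /upd; ifs.
move=> H8; apply: (st_add H8 i8); rewrite e8; first by lia.
rewrite -/R9 => H9; apply: (st_const H9 i9); first by lia.
have e10 : R10 6 + R10 1 = 2 + m.
  by rewrite /R10 /R9 /R8 /R7 /R6 /R5 /R4 /R3 /R2 /R1 /upd; ifs.
move=> H10; apply: (st_add H10 i10); rewrite e10; first by lia.
have e11 : R11 6 + R11 1 = 2 + m + m.
  by rewrite /R11 /R10 /R9 /R8 /R7 /R6 /R5 /R4 /R3 /R2 /R1 /upd; ifs.
move=> H11; apply: (st_add H11 i11); rewrite e11; first by lia.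
move=> H12; apply: (st_const H12 i12); first by lia.
move=> H13; apply: (st_const H13 i13); first by lia.
by move=> H14; apply: steps_refl.
Qed.

Lemma pre4_ok p R : code_at P p (pre4 p) ->
  [/\ R NV = base, R 1 = m, R 3 = n, R 4 = FX /\ R 5 = base + NA * FX
    & [/\ R 6 = 2 * m + 2, R 7 = 1 & R 8 = NA]] -> allle W R ->
  let k := 2 * m + 2 - FX in
  stepsR P W p R (8 * k + 2) (p + 8) (fun R' =>
    [/\ R' NV = base, R' 1 = m, R' 3 = n,
        forall y, FX <= y < 2 * m + 2 -> R' (base + y * NA) = R y
      & forall r, FX <= r -> (forall y, FX <= y < 2 * m + 2 ->
          r != base + y * NA) -> R' r = R r]).
Proof.
move=> /code_at_cons [i0 /code_at_cons [i1 /code_at_cons [i2 /code_at_cons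
 [i3 /code_at_cons [i4 /code_at_cons [i5 /code_at_cons [i6 /code_at_cons
 [i7 _]]]]]]]] [e40 e1 e3 [e4 e5] [e6 e7 e8]] HR k.
have inv j : j <= k -> stepsR P W p R (8 * j) p (fun R' =>
  [/\ [/\ R' NV = base, R' 1 = m & R' 3 = n],
      [/\ R' 4 = FX + j, R' 5 = base + NA * (FX + j) & R' 6 = 2 * m + 2],
      R' 7 = 1 /\ R' 8 = NA,
        forall y, FX <= y < FX + j -> R' (base + y * NA) = R y
      & forall r, FX <= r -> (forall y, FX <= y < FX + j ->
          r != base + y * NA) -> R' r = R r]).
  elim: j => [_|j IH jk].
    rewrite muln0; exists R; first exact: steps_refl.
    by rewrite addn0; split=> // y; lia.
  rewrite mulnSr; apply: stepsR_trans (IH (ltnW jk)) _.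
  move=> R1 [[f40 f1 f3] [f4 f5 f6] [f7 f8] Fy Fr] H1.
  pose R2 := upd R1 9 (R1 6 - R1 4); pose R3 := upd R2 10 (R (FX + j)).
  pose R4 := upd R3 (base + NA * (FX + j)) (R (FX + j)).
  pose R5 := upd R4 4 (FX + j.+1); pose R6 := upd R5 5 (base + NA * (FX + j.+1)).
  pose R7 := upd R6 9 0.
  exists R7.
    apply: (st_sub H1 i0); rewrite -/R2 => H2.
    have e2 : (R2 9 == 0) = false.
      by rewrite /R2 /upd eqxx f6 f4; apply/negbTE; lia.
    apply: (st_jz H2 i1); rewrite e2.
    have r4 : R2 (R2 4) = R (FX + j).
      have -> : R2 4 = FX + j by rewrite /R2 /upd; ifs.
      have -> : R2 (FX + j) = R1 (FX + j) by rewrite /R2 /upd; ifs.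
      by apply: Fr; lia.
    apply: (st_load H2 i2); rewrite r4 -/R3 => H3.
    have r5 : R3 5 = base + NA * (FX + j) by rewrite /R3 /R2 /upd /=.
    have r10 : R3 10 = R (FX + j) by [].
    apply: (st_store H3 i3); rewrite r5 r10 -/R4 => H4.
    have q4 : R4 4 + R4 7 = FX + j.+1.
      by rewrite /R4 /R3 /R2 /upd; ifs.
    apply: (st_add H4 i4); rewrite q4; first by lia.
    rewrite -/R5 => H5.
    have q5 : R5 5 + R5 8 = base + NA * (FX + j.+1).
      by rewrite /R5 /R4 /R3 /R2 /upd; ifs.
    apply: (st_add H5 i5); rewrite q5; first by lia.
    rewrite -/R6 => H6; apply: (st_const H6 i6); first by lia.
    rewrite -/R7 => H7; apply: (st_jz H7 i7).
    by rewrite {1}/R7 {1}/upd /=; apply: steps_refl.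
  have E7 r : FX <= r -> r != base + NA * (FX + j) -> R7 r = R1 r.
    by move=> ??; rewrite /R7 /R6 /R5 /R4 /R3 /R2 /upd !ifF //; lia.
  split.
  - by rewrite /R7 /R6 /R5 /R4 /R3 /R2 /upd; split; ifs.
  - by rewrite /R7 /R6 /R5 /R4 /R3 /R2 /upd; split; ifs.
  - by rewrite /R7 /R6 /R5 /R4 /R3 /R2 /upd; split; ifs.
  - move=> y Hy; case: (eqVneq y (FX + j)) => [->|nyj].
      by rewrite /R7 /R6 /R5 /R4 /upd; ifs.
    by rewrite E7 ?Fy //; lia.
  - move=> r Hr Hy; rewrite E7 ?Fr //.
      by move=> y ?; apply: Hy; lia.
    by have := Hy (FX + j); lia.
apply: stepsR_trans (inv k (leqnn k)) _.
move=> R1 [[f40 f1 f3] [f4 f5 f6] [f7 f8] Fy Fr] H1.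
exists (upd R1 9 (R1 6 - R1 4)).
  apply: (st_sub H1 i0) => H2; apply: (st_jz H2 i1).
  have -> : (upd R1 9 (R1 6 - R1 4) 9 == 0) by rewrite /upd eqxx f6 f4 /k; lia.
  exact: steps_refl.
split=> //.
- by move=> y Hy; rewrite /upd ifF ?Fy // /k; lia.
- move=> r Hr Hy; rewrite /upd ifF ?Fr //; last by lia.
  by move=> y ?; apply: Hy; lia.
Qed.

Lemma load_ok p4 :
  code_at P 0 (pre1 z ++ pre2 4 57 ++ pre3 ++ pre4 200) -> p4 = PM ->
  let k := 2 * m + 2 - FX in
  stepsR P W 0 I0 (202 + 8 * k) p4 (fun R =>
    [/\ R NV = base, R 1 = m, R 3 = n,
        forall y, 2 <= y < 2 * m + 2 -> R (base + y * NA) = I0 y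
      & forall A i, 0 < A < NA -> R (base + i * NA + A) = 0]).
Proof.
move=> Hc -> k.
have [c1 /code_at_cat [c2 /code_at_cat [c3 c4]]] := code_at_cat Hc.
rewrite size_pre2 in c3 c4.
have -> : 202 + 8 * k = 15 + (3 * 57 + (14 + (8 * k + 2))) by lia.
apply: stepsR_trans (pre1_ok c1) _ => R1 [a0 a1 a2 a3 aF] H1.
apply: stepsR_trans (pre2_ok c2 _ _ a0 H1) _ => // R2 [b1 b2] H2.
have b0 : R2 0 = base by rewrite b2 ?a0 //; lia.
have b1' : R2 1 = m by rewrite b2 ?a1 //; lia.
apply: stepsR_trans (pre3_ok c3 b0 b1' H2) _ => R3 [d40 d1 d3 d45 [d6 d7 d8 dF]] H3.
have [//|R4 s4 [f40 f1 f3 fy fr]] := pre4_ok c4 (R := R3) _ H3.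
exists R4 => //; split=> //.
- move=> y Hy; case: (leqP FX y) => Hy2.
    rewrite fy ?dF ?b2 ?aF //; lia.
  rewrite fr ?dF; try lia.
  case: (leqP 4 y) => Hy3.
    by rewrite b1 ?aF //; lia.
  rewrite b2; try lia.
  by have [->|->] : y = 2 \/ y = 3 by lia.
- move=> A i HA; rewrite fr ?dF ?b2 ?aF ?I0z //; lia.
Qed.

End Load.

Definition ldst (base : nat) (R : nat -> nat) : store :=
  Store R (fun A i => R (base + i * NA + A)).


Lemma steps_mono P W W' st t st' :
  steps P W st t st' -> W <= W' -> steps P W' st t st'.
Proof. by move=> [e b] h; split=> // j r jt; apply: leq_trans h; apply: b. Qed.

Lemma init_regs_edge n s i : i < size s ->
  init_regs n s (2 * i + 2) = (nth (0, 0) s i).1 /\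
  init_regs n s (2 * i + 3) = (nth (0, 0) s i).2.
Proof.
move=> Hi; rewrite /init_regs.
have -> : (2 * i + 2 == 0) = false by lia.
have -> : (2 * i + 3 == 0) = false by lia.
have -> : (2 * i + 2 == 1) = false by lia.
have -> : (2 * i + 3 == 1) = false by lia.
have -> : (2 <= 2 * i + 2) && (2 * i + 2 < 2 + 2 * size s) by lia.
have -> : (2 <= 2 * i + 3) && (2 * i + 3 < 2 + 2 * size s) by lia.
have -> : odd (2 * i + 2) = false by lia.
have -> : odd (2 * i + 3) = true by lia.
have -> : (2 * i + 2 - 2) %/ 2 = i by lia.
by have -> : (2 * i + 3 - 2) %/ 2 = i by lia.
Qed.

Lemma init_regs_le n s r : valid_graph n s -> init_regs n s r <= n + size s.
Proof.
move=> [/allP H _ _]; rewrite /init_regs.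
case: ifP => _; first by rewrite leq_addr.
case: ifP => _; first by rewrite leq_addl.
case: ifP => // Hr; have Hi : (r - 2) %/ 2 < size s by lia.
have /H /andP [/andP [h1 h2] _] := mem_nth (0, 0) Hi.
case: ifP => _; apply: leq_trans (leq_addr _ _); exact: ltnW.
Qed.

Lemma leq_self_exp x k : 0 < k -> x <= x ^ k.
Proof. by case: k x => // k [|x] // _; rewrite expnS leq_pmulr // expn_gt0. Qed.

Lemma prog_runs c n s :
  wf 0 c -> 1 < n -> 0 < size s -> valid_graph n s ->
  let m := size s in
  exists m0 : store,
    [/\ var m0 1 = m, var m0 3 = n,
        forall i, i < m -> arr m0 0 (2 * i + 2) = (nth (0, 0) s i).1 /\
                           arr m0 0 (2 * i + 3) = (nth (0, 0) s i).2,
        forall A i, 0 < A < NA -> arr m0 A i = 0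
      & forall T W, tm c m0 <= T ->
          80 * (n + m + 2) + 18 * (8 * T + 40 * 50 * (n + m + 2)) ^ 8 <= W ->
          exists2 t, t <= 204 + 16 * m + T &
            runs_in (prog c) n s t (var (run c m0) 0) W].
Proof.
move=> Hwf n2 m1 Hv m.
set P := prog c; set I0 := init_regs n s; pose b0 := 40 * 30 * (n + m + 2).
pose a := n + m + m; pose base := a + FX; pose k := code c 0 PM.
have [c0 c1] : code_at P 0 (pre1 (PM + size k + 1) ++ pre2 4 57 ++ pre3 ++ pre4 200)
   /\ code_at P PM (k ++ [:: IHalt; IConst 0 0; IHalt]).
  set X := pre1 _ ++ _; set Y := k ++ _.
  have eP : P = X ++ Y by rewrite /X -!catA.
  have sX : size X = PM by rewrite /X !size_cat.
  by rewrite -[PM]add0n -sX; apply: code_at_cat; rewrite -eP.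
have HI : allle b0 I0.
  by move=> r; apply: leq_trans (init_regs_le _ Hv) _; rewrite /b0 -/m; lia.
have I0z r : 2 * m + 2 <= r -> I0 r = 0 by move=> Hr; rewrite /I0 /init_regs; ifs.
have [|R s1 [e40 e1 e3 ey eA]] :=
  @load_ok P b0 n m _ I0 n2 m1 erefl erefl I0z a base erefl erefl _ HI PM c0 erefl.
  by rewrite /base /a /b0; lia.
pose m0 := ldst base R.
have b8 : 8 <= b0 by rewrite /b0; lia.
have HR := steps_le s1.
exists m0; split=> //.
  move=> i Hi; have [<- <-] := init_regs_edge n Hi.
  by rewrite /= !addn0 !ey //; lia.
move=> T W HT HW.
have [c2] := code_at_cat c1; move=> /code_at_cons [c3 _].
have Hbd : bounded m0 b0 by split=> *; apply: HR.
have Hbase : FX <= base by rewrite /base; lia.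
have Hrel : sim base m0 R by split.
have bW : b0 <= W.
  apply: leq_trans HW; have := leq_self_exp (8 * T + 40 * 50 * (n + m + 2)) (isT : 0 < 8).
  by move: ((8 * T + _) ^ 8) => X; rewrite /b0; lia.
have HRW : allle W R by move=> r; apply: leq_trans bW.
have Hk : wok W base (b0 + 8 * tm c m0).
  rewrite /wok; apply: leq_trans HW.
  have : (b0 + 8 * tm c m0 + 2) ^ DG <= (8 * T + 40 * 50 * (n + m + 2)) ^ 8.
    rewrite leq_exp2r // /b0; lia.
  move: ((b0 + _ + 2) ^ 8) ((8 * T + _) ^ 8) => X Y; rewrite /base /a; lia.
have [R2 s2 [Hr2 _]] := code_ok Hbase (isT : 0 <= 5) Hwf Hbd b8 Hk c2 Hrel HRW.
have s3 := steps_trans (steps_mono s1 bW) s2.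
exists (202 + 8 * (2 * m + 2 - FX) + tm c m0); first by clear -HT; lia.
have [E _ _] := Hr2; rewrite -(E 0 isT).
by apply: (halt_runs s3).
Qed.

Lemma prog_runs1 c s W : size s = 0 -> 1 <= W -> valid_graph 1 s ->
  runs_in (prog c) 1 s 2 0 W.
Proof.
move=> s0 W1 Hv; pose k := code c 0 PM; set P := prog c.
pose z := PM + size k + 1.
pose X := pre1 z ++ pre2 4 57 ++ pre3 ++ pre4 200 ++ k ++ [:: IHalt].
have eP : P = X ++ [:: IConst 0 0; IHalt] by rewrite /X -!catA.
have sX : size X = z by rewrite /X /z !size_cat /=; lia.
have [i0 _] : nth IHalt P 0 = IJz 1 z /\ True by [].
have [_] : code_at P 0 X /\ code_at P (0 + size X) [:: IConst 0 0; IHalt].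
  by apply: code_at_cat; rewrite -eP.
rewrite add0n sX => /code_at_cons [i1 /code_at_cons [i2 _]].
have HI : allle W (init_regs 1 s).
  by move=> r; apply: leq_trans W1; have := init_regs_le r Hv; rewrite s0.
have s1 : steps P W (init_state 1 s) 2 (State z.+1 (upd (init_regs 1 s) 0 0)).
  apply: (st_jz HI i0).
  have -> : init_regs 1 s 1 = 0 by rewrite /init_regs /= s0.
  by apply: (st_const HI i1) => // H; apply: steps_refl.
exact: (halt_runs s1).
Qed.

(** * The program *)

Fixpoint mv (c : cmd) : seq nat :=
  match c with
  | Skip | St _ _ _ => [::]
  | Asg x _ => [:: x]
  | Seq a b | If _ a b => mv a ++ mv b
  | For x _ c => x :: mv c
  end.

Fixpoint ma (c : cmd) : seq nat :=
  match c with
  | Skip | Asg _ _ => [::]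
  | St A _ _ => [:: A]
  | Seq a b | If _ a b => ma a ++ ma b
  | For _ _ c => ma c
  end.

Lemma run_var c s x : x \notin mv c -> var (run c s) x = var s x.
Proof.
elim: c s => //= [y e|a IHa b IHb|e a IHa b IHb|y e c IH] s.
- by rewrite inE /upd => /negbTE ->.
- by rewrite mem_cat negb_or => /andP [ha hb]; rewrite IHb // IHa.
- by rewrite mem_cat negb_or => /andP [ha hb]; case: ifP; auto.
- rewrite inE negb_or => /andP [/negbTE hx hc].
  by elim: (ev s e) => //= k IHk; rewrite IH //= /upd hx.
Qed.

Lemma run_arr c s A : A \notin ma c -> arr (run c s) A = arr s A.
Proof.
elim: c s => //= [B e1 e2|a IHa b IHb|e a IHa b IHb|y e c IH] s.
- by rewrite inE => /negbTE ->.
- by rewrite mem_cat negb_or => /andP [ha hb]; rewrite IHb // IHa.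
- by rewrite mem_cat negb_or => /andP [ha hb]; case: ifP; auto.
- by move=> hc; elim: (ev s e) => //= k IHk; rewrite IH //= IHk.
Qed.

Lemma run_arr0 c s : ma c = [::] -> arr (run c s) = arr s.
Proof.
elim: c s => //= [a IHa b IHb|e a IHa b IHb|y e c IH] s.
- by move=> h; rewrite IHb ?IHa //; case: (ma a) h => //= ->.
- by move=> h; case: ifP => _; [apply: IHb|apply: IHa]; case: (ma a) h => //= ->.
- by move=> h; elim: (ev s e) => //= k IHk; rewrite IH.
Qed.

Definition same (vs As : seq nat) (s s' : store) : Prop :=
  (forall x, x \notin vs -> var s' x = var s x) /\
  (forall A, A \notin As -> arr s' A = arr s A).

Lemma run_same c s : same (mv c) (ma c) s (run c s).
Proof. by split=> *; [apply: run_var|apply: run_arr]. Qed.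

Lemma loop_same x c s k : same (x :: mv c) (ma c) s (loop x c s k).
Proof.
split=> y; first rewrite inE negb_or => /andP [/negbTE hx hc].
  by elim: k => //= k IHk; rewrite run_var //= /upd hx.
by move=> hc; elim: k => //= k IHk; rewrite run_arr //= IHk.
Qed.

Lemma loop_ind (I : nat -> store -> Prop) x c s N :
  I 0 s ->
  (forall k s', k < N -> same (x :: mv c) (ma c) s s' -> I k s' ->
     I k.+1 (run c (setv s' x k))) ->
  forall k, k <= N -> I k (loop x c s k).
Proof.
move=> I0 IS; elim=> // k IH kN; rewrite loopS; apply: IS => //.
  exact: loop_same.
exact: IH (ltnW kN).
Qed.

Lemma for_ind (I : nat -> store -> Prop) x e c s :
  I 0 s ->
  (forall k s', k < ev s e -> same (x :: mv c) (ma c) s s' -> I k s' ->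
     I k.+1 (run c (setv s' x k))) ->
  I (ev s e) (run (For x e c) s).
Proof. by move=> I0 IS; apply: (loop_ind I0 IS). Qed.

(* [cb c s] bounds the running time of [c] when its loop limits, evaluated
   in [s], do not change. *)
Fixpoint cb (c : cmd) (s : store) : nat :=
  match c with
  | Skip => 0
  | Asg x e => et e + 2
  | St A e1 e2 => et e1 + et e2 + 6
  | Seq a b => cb a s + cb b s
  | If e a b => et e + 1 + maxn (cb b s) (cb a s + 2)
  | For x e c => et e + 5 + ev s e * (cb c s + 8)
  end.

Fixpoint limits (Q : seq nat) (c : cmd) : bool :=
  match c with
  | Skip | Asg _ _ | St _ _ _ => true
  | Seq a b | If _ a b => limits Q a && limits Q b
  | For x e c =>
      match e with Var y => y \in Q | Num _ => true | _ => false end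
      && limits Q c
  end.

Lemma tm_cb Q c s s' : limits Q c -> ~~ has (mem Q) (mv c) ->
  (forall x, x \in Q -> var s' x = var s x) -> tm c s' <= cb c s.
Proof.
elim: c s' => //= [a IHa b IHb|e a IHa b IHb|x e c IH] s'.
- move=> /andP [la lb]; rewrite has_cat negb_or => /andP [ha hb] H.
  apply: leq_add; first exact: IHa.
  apply: IHb => // x xQ; rewrite run_var ?H //.
  by apply: contra ha => xa; apply/hasP; exists x.
- move=> /andP [la lb]; rewrite has_cat negb_or => /andP [ha hb] H.
  have := IHa _ la ha H; have := IHb _ lb hb H; case: ifP; lia.
- move=> /andP [le lc]; rewrite negb_or => /andP [hx hc] H.
  have -> : ev s' e = ev s e.
    by case: e le {IH} => //= y yQ; apply: H.
  rewrite leq_add2l -[X in X * _]subn0 -sum_nat_const_nat.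
  apply: leq_sum => k _; rewrite leq_add2r; apply: IH => // y yQ.
  have nyx : (y == x) = false by apply/negbTE; apply: contraNneq hx => <-.
  rewrite /= /upd nyx; have [Hv _] := loop_same x c s' k.
  rewrite Hv ?H // inE nyx /=.
  by apply: contra hc => yc; apply/hasP; exists y.
Qed.

Notation vOUT := 0. Notation vM := 1. Notation vM2 := 2. Notation vN := 3.
Notation vI := 4. Notation vU := 5. Notation vW := 6. Notation vV := 7.
Notation vKK := 8. Notation vDONE := 9. Notation vFOUND := 10.
Notation vP1 := 11. Notation vP2 := 12. Notation vP3 := 13. Notation vP4 := 14.
Notation vFL := 15. Notation vRR := 16. Notation vAA := 17. Notation vMM := 18.
Notation vBB := 19. Notation vMW := 20. Notation vADJ := 21. Notation vR := 22.
Notation vJ := 23. Notation vX := 24. Notation vNL := 26. Notation vZ := 27.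
Notation vIA := 28. Notation vIB := 29. Notation vRA := 30. Notation vRB := 31.
Notation vY := 32. Notation vD := 33. Notation vT := 34.

(* For a vertex v of G - K, LB1 is the least vertex of N[v], LB2 the least LB1 in
   N[v], attained at PAR; CNT counts the neighbours w with LB2 w < LB1 w.
   For a component with least vertex r, BEST r is the vertex a of the proof
   idea, and ADA marks its neighbours.  K is listed in KL and marked in INK.
   TT is the table of distances to K, with row i at i * n; ND maps a vertex to
   the representative of its class, RP lists the representatives, and MU marks
   those whose class meets several components. *)
Notation aIN := 0. Notation aSRC := 1. Notation aDST := 2. Notation aINK := 3.
Notation aLB1 := 4. Notation aLB2 := 5. Notation aPAR := 6. Notation aCNT := 7.
Notation aBEST := 8. Notation aADA := 9. Notation aYY := 10. Notation aKL := 11.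
Notation aLL := 12. Notation aTT := 13. Notation aND := 14. Notation aCH := 15.
Notation aRP := 16. Notation aMU := 17.

Notation "$ x" := (Var x) (at level 1, x at level 0, format "$ x").
Notation "a ;; b" := (Seq a b) (at level 65, right associativity).
Notation "x <~ e" := (Asg x e) (at level 64, e at level 60).

(* Conditions hold when their value is nonzero. *)
Notation lt a b := (Sub b a).
Notation ne a b := (Add (Sub a b) (Sub b a)).
Notation neg a := (Sub (Num 1) a).

Definition vfor (c : cmd) : cmd := For vV $vN c.

Definition arcs_for (c : cmd) : cmd :=
  For vI $vM2
   (vU <~ Rd aSRC $vI ;; vW <~ Rd aDST $vI ;;
    If (Mul (neg (Rd aINK $vU)) (neg (Rd aINK $vW))) c Skip).

Definition arcs (s : store) : seq (nat * nat) :=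
  [seq (arr s aSRC i, arr s aDST i) | i <- iota 0 (var s vM2)].

Definition live (s : store) (p : nat * nat) : bool :=
  (arr s aINK p.1 == 0) && (arr s aINK p.2 == 0).

Lemma arcs_for_ind (I : seq (nat * nat) -> store -> Prop) c s :
  ~~ has (mem [:: vI; vU; vW; vM2]) (mv c) ->
  ~~ has (mem [:: aSRC; aDST; aINK]) (ma c) ->
  (forall d s1 s2, I d s1 -> same [:: vI; vU; vW] [::] s1 s2 -> I d s2) ->
  I [::] s ->
  (forall (d : seq (nat * nat)) (u w : nat) s', {subset rcons d (u, w) <= filter (live s) (arcs s)} ->
     same (vI :: vU :: vW :: mv c) (ma c) s s' ->
     var s' vU = u -> var s' vW = w -> I d s' -> I (rcons d (u, w)) (run c s')) ->
  I (filter (live s) (arcs s)) (run (arcs_for c) s).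
Proof.
move=> hv hA stab I0 IS.
have nA A : A \in [:: aSRC; aDST; aINK] -> A \notin ma c.
  by move=> hin; apply: contra hA => Ac; apply/hasP; exists A.
pose pre k := filter (live s) (take k (arcs s)).
have sz : size (arcs s) = var s vM2 by rewrite size_map size_iota.
have -> : filter (live s) (arcs s) = pre (ev s $vM2) by rewrite /pre /= -sz take_size.
apply: (@for_ind (fun k s' => I (pre k) s')); first by rewrite /pre take0.
move=> k s' kM [Fv Fa] Ik; rewrite /= in kM.
have eA A : A \in [:: aSRC; aDST; aINK] -> arr s' A = arr s A.
  by move=> hin; apply: Fa; rewrite /= cats0 nA.
have preS : pre k.+1 = if live s (arr s aSRC k, arr s aDST k)
                       then rcons (pre k) (arr s aSRC k, arr s aDST k) else pre k.
  rewrite /pre (take_nth (0, 0)) ?sz // filter_rcons /arcs (nth_map 0) ?size_iota //.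
  by rewrite nth_iota.
set u := arr s aSRC k in preS *; set w := arr s aDST k in preS *.
rewrite preS [run _ _]/= /upd /= !eA // -/u -/w muln_eq0 !subn_eq0 !lt0n.
have -> : (arr s 3 u != 0) || (arr s 3 w != 0) = ~~ live s (u, w).
  by rewrite /live /= negb_and.
case: ifP => lv /=.
  apply: IS => //.
  - have <- : pre k.+1 = rcons (pre k) (u, w) by rewrite preS lv.
    move=> p.
    by rewrite /pre !mem_filter => /andP [-> hp]; apply: mem_take hp.
  - split=> [x|A].
      rewrite !inE !negb_or => /and4P [x1 x2 x3 xc] /=.
      rewrite /upd (negbTE x1) (negbTE x2) (negbTE x3); apply: Fv.
      by rewrite !inE !negb_or x1 x2 x3 /= cats0.
    by move=> Ac /=; apply: Fa; rewrite /= cats0.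
  - by apply: stab Ik _; split=> // x; rewrite !inE !negb_or /= /upd => /and3P [/negbTE -> /negbTE -> /negbTE ->].
apply: stab Ik _.
by split=> // x; rewrite !inE !negb_or /= /upd => /and3P [/negbTE -> /negbTE -> /negbTE ->].
Qed.

Lemma vfor_ind (I : nat -> store -> Prop) c s :
  I 0 s ->
  (forall k s', k < var s vN -> same (vV :: mv c) (ma c) s s' -> I k s' ->
     I k.+1 (run c (setv s' vV k))) ->
  I (var s vN) (run (vfor c) s).
Proof. exact: (@for_ind I vV (Var vN) c s). Qed.

Definition init_c : cmd :=
  vM2 <~ Num 0 ;; vKK <~ Num 0 ;; vDONE <~ Num 0 ;; vNL <~ Num 0 ;;
  For vI $vM
   (St aSRC $vI (Rd aIN (Add (Add $vI $vI) (Num 2))) ;;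
    St aDST $vI (Rd aIN (Add (Add $vI $vI) (Num 3))) ;;
    St aSRC (Add $vM $vI) (Rd aIN (Add (Add $vI $vI) (Num 3))) ;;
    St aDST (Add $vM $vI) (Rd aIN (Add (Add $vI $vI) (Num 2))) ;;
    vM2 <~ Add $vM2 (Num 2)).

Definition label1_c : cmd :=
  vfor (St aLB1 $vV $vV ;; St aCNT $vV (Num 0) ;; St aADA $vV (Num 0) ;;
        St aYY $vV (Num 0) ;; St aBEST $vV $vV) ;;
  arcs_for (If (lt $vW (Rd aLB1 $vU)) (St aLB1 $vU $vW) Skip).

Definition label2_c : cmd :=
  vfor (St aLB2 $vV (Rd aLB1 $vV) ;; St aPAR $vV $vV) ;;
  arcs_for (If (lt (Rd aLB1 $vW) (Rd aLB2 $vU))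
              (St aLB2 $vU (Rd aLB1 $vW) ;; St aPAR $vU $vW) Skip).

Definition setP (a b c d : expr) : cmd :=
  vFOUND <~ Num 1 ;; vP1 <~ a ;; vP2 <~ b ;; vP3 <~ c ;; vP4 <~ d.

Definition far_test_c : cmd :=
  vFOUND <~ Num 0 ;;
  arcs_for (If (lt (Rd aLB2 $vU) (Rd aLB2 $vW))
              (setP (Rd aLB2 $vU) (Rd aPAR $vU) $vU $vW) Skip).

Definition farE (v : expr) : expr := lt (Rd aLB2 v) (Rd aLB1 v).
Definition bestE (v : expr) : expr := Rd aBEST (Rd aLB2 v).

Definition count_c : cmd :=
  arcs_for (If (farE $vW) (St aCNT $vU (Add (Rd aCNT $vU) (Num 1))) Skip).

Definition best_c : cmd :=
  vfor (If (Mul (lt (Rd aCNT (bestE $vV)) (Rd aCNT $vV)) (neg (farE $vV)))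
           (St aBEST (Rd aLB2 $vV) $vV) Skip).

Definition ada_c : cmd :=
  arcs_for (If (ne $vU (bestE $vW)) Skip (St aADA $vW (Num 1))).

Definition setB (m b : expr) : cmd :=
  vFL <~ Num 1 ;; vRR <~ Rd aLB2 $vV ;; vAA <~ bestE $vV ;;
  vMM <~ m ;; vBB <~ b.

Definition bad_c : cmd :=
  vFL <~ Num 0 ;;
  vfor (If (Rd aADA $vV) Skip
         (If (farE $vV) (setB $vV (Rd aPAR $vV))
            (If (lt (Rd aCNT $vV) (Rd aCNT (bestE $vV))) (setB $vV $vV) Skip))).

Definition wit_c : cmd :=
  arcs_for (If (ne $vU $vBB) Skip (St aYY $vW (Num 1))) ;;
  vMW <~ Num 0 ;;
  vfor (If (Mul (Mul (farE $vV) (Rd aADA $vV))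
                (Mul (neg (Rd aYY $vV)) (neg (ne (Rd aLB2 $vV) $vRR))))
           (vMW <~ $vV) Skip) ;;
  vADJ <~ Num 0 ;;
  arcs_for (If (Add (ne $vU $vMM) (ne $vW $vMW)) Skip (vADJ <~ Num 1)) ;;
  If (Rd aADA $vBB)
    (If $vADJ (setP $vRR $vAA $vMW $vMM) (setP $vMW $vAA $vBB $vMM))
    (setP $vMW $vAA $vRR $vBB).

Definition remove_c (x : nat) : cmd :=
  St aKL $vKK $x ;; St aINK $x (Num 1) ;; vKK <~ Add $vKK (Num 1).

Definition search_c : cmd :=
  label1_c ;; label2_c ;; far_test_c ;;
  If $vFOUND Skip
    (count_c ;; best_c ;; ada_c ;; bad_c ;; If $vFL wit_c Skip).

Definition round_c : cmd :=
  search_c ;;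
  If $vFOUND (remove_c vP1 ;; remove_c vP2 ;; remove_c vP3 ;; remove_c vP4)
             (vDONE <~ Num 1).

Definition rounds_c : cmd := For vR $vN (If $vDONE Skip round_c).

Definition row (i v : expr) : expr := Add (Mul i $vN) v.

(* LL is 0 for unreached vertices and 1 + the local distance for the others. *)
Definition layers_c : cmd :=
  vfor (St aLL $vV (Num 0)) ;;
  St aLL $vX (Num 1) ;;
  For vR (Num 4)
   (For vI $vM2
     (vU <~ Rd aSRC $vI ;; vW <~ Rd aDST $vI ;;
      If (Mul (Mul (neg (ne (Rd aLL $vU) (Add $vR (Num 1))))
                   (Add (neg (Rd aINK $vU)) (neg $vR)))
              (neg (Rd aLL $vW)))
         (St aLL $vW (Add $vR (Num 2))) Skip)).

(* The factor 6 makes keys unique since LL is at most 5. *)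
Definition keyE : expr :=
  Add (Mul (Num 6) (row $vJ (Rd aND $vV))) (Rd aLL $vV).

Definition classes_c : cmd :=
  vfor (If (Rd aLL $vV) (St aTT (row $vJ $vV) (Sub (Rd aLL $vV) (Num 1)))
           (St aTT (row $vJ $vV) $vN) ;;
        If (Rd aCH keyE) Skip (St aCH keyE (Add $vV (Num 1))) ;;
        St aND $vV (Sub (Rd aCH keyE) (Num 1))).

Definition types_c : cmd :=
  For vJ $vKK (vX <~ Rd aKL $vJ ;; layers_c ;; classes_c).

Definition reps_c : cmd :=
  vfor (If (ne (Rd aND $vV) $vV) Skip
          (St aRP $vNL $vV ;; vNL <~ Add $vNL (Num 1)) ;;
        If (ne (Rd aLB2 $vV) (Rd aLB2 (Rd aND $vV)))
           (St aMU (Rd aND $vV) (Num 1)) Skip).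

Definition fw_c : cmd :=
  For vZ $vKK
   (vX <~ Rd aKL $vZ ;;
    For vIA $vNL
     (vV <~ Rd aRP $vIA ;;
      For vY $vKK
       (vT <~ Sub (Rd aTT (row $vY $vV))
                  (Sub (Rd aTT (row $vY $vV))
                       (Add (Rd aTT (row $vZ $vV)) (Rd aTT (row $vY $vX)))) ;;
        St aTT (row $vY $vV) $vT))).

Definition base_c : cmd :=
  If (lt $vM2 (Mul $vN (Sub $vN (Num 1)))) (vOUT <~ Num 2) (vOUT <~ Num 1).

Definition pairs_c : cmd :=
  For vIA $vNL
   (vRA <~ Rd aRP $vIA ;;
    For vIB $vNL
     (vRB <~ Rd aRP $vIB ;;
      If (Add (ne (Rd aLB2 $vRA) (Rd aLB2 $vRB)) (Add (Rd aMU $vRA) (Rd aMU $vRB)))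
        (vD <~ $vN ;;
         For vY $vKK
           (vD <~ Sub $vD (Sub $vD (Add (Rd aTT (row $vY $vRA))
                                        (Rd aTT (row $vY $vRB))))) ;;
         If (lt $vOUT $vD) (vOUT <~ $vD) Skip)
        Skip)).

Definition final_c : cmd := reps_c ;; fw_c ;; base_c ;; pairs_c.

Definition diam_c : cmd := init_c ;; rounds_c ;; types_c ;; final_c.

Lemma diam_wf : wf 0 diam_c.
Proof. by []. Qed.

(** * One search for an induced path *)

Definition Lv (s : store) : seq (nat * nat) := filter (live s) (arcs s).

Lemma Lv_eq s s' : var s' vM2 = var s vM2 ->
  (forall A, A \in [:: aSRC; aDST; aINK] -> arr s' A = arr s A) -> Lv s' = Lv s.
Proof.
move=> eM eA; rewrite /Lv /arcs eM !eA //; apply: eq_filter => p.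
by rewrite /live eA.
Qed.

Definition keepL (c : cmd) : bool :=
  (vM2 \notin mv c) && ~~ has (mem [:: aSRC; aDST; aINK]) (ma c).

Lemma Lv_run c s : keepL c -> Lv (run c s) = Lv s.
Proof.
move=> /andP [hv hA]; apply: Lv_eq => [|A hin]; first exact: run_var.
by apply: run_arr; apply: contra hA => Ac; apply/hasP; exists A.
Qed.

Lemma sub_rcons (d L : seq (nat * nat)) u w :
  {subset rcons d (u, w) <= L} -> (u, w) \in L.
Proof. by apply; rewrite mem_rcons mem_head. Qed.

Lemma run_seq a b s : run (Seq a b) s = run b (run a s).
Proof. by []. Qed.

Lemma ex_eq (T : Type) (x : T) : exists y, y = x.
Proof. by exists x. Qed.

Lemma run_if c a b s : run (If c a b) s = if ev s c == 0 then run b s else run a s.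
Proof. by []. Qed.

Ltac rcase := let x := fresh "x" in let y := fresh "y" in let xy := fresh "xy" in
  move=> x y; rewrite mem_rcons inE => /orP [/eqP [-> ->]|xy].

Section Round.
Variables (n : nat) (L : seq (nat * nat)).
Let e : rel nat := fun u w => (u, w) \in L.
Hypothesis L_uniq : uniq L.
Hypothesis e_sym : forall u w, e u w -> e w u.
Hypothesis e_irr : forall u, ~~ e u u.
Hypothesis e_lt : forall u w, e u w -> u < n.

Definition gst (s : store) : Prop := var s vN = n /\ Lv s = L.

Lemma gst_run c s : gst s -> keepL c -> vN \notin mv c -> gst (run c s).
Proof. by move=> [h3 h4] h1 h2; split; rewrite ?run_var ?Lv_run. Qed.

Lemma arcs_for_gst (I : seq (nat * nat) -> store -> Prop) c s :
  gst s -> keepL c -> ~~ has (mem [:: vI; vU; vW]) (mv c) ->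
  (forall d s1 s2, I d s1 -> same [:: vI; vU; vW] [::] s1 s2 -> I d s2) ->
  I [::] s ->
  (forall (d : seq (nat * nat)) (u w : nat) s', {subset rcons d (u, w) <= L} -> 
     same (vI :: vU :: vW :: mv c) (ma c) s s' ->
     var s' vU = u -> var s' vW = w -> I d s' -> I (rcons d (u, w)) (run c s')) ->
  I L (run (arcs_for c) s).
Proof.
move=> [_ eL] /andP [h1 h2] h3 h4 h5; rewrite -eL => h6; apply: arcs_for_ind => //.
apply/hasPn => x xc; move/hasPn: h3 => /(_ x xc); rewrite /= !inE.
have : x != vM2 by apply: contraNneq h1 => <-.
lia.
Qed.

Lemma vfor_gst (I : nat -> store -> Prop) c s :
  gst s -> I 0 s ->
  (forall k s', k < n -> same (vV :: mv c) (ma c) s s' -> I k s' ->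
     I k.+1 (run c (setv s' vV k))) ->
  I n (run (vfor c) s).
Proof. by move=> [eN _]; rewrite -eN; apply: vfor_ind. Qed.

Definition is_lb1 (s : store) : Prop :=
  [/\ forall v, v < n -> arr s aLB1 v = v \/ e v (arr s aLB1 v),
      forall v, v < n -> arr s aLB1 v <= v
    & forall u w, e u w -> arr s aLB1 u <= w].

Lemma label1_ok s : gst s -> let s' := run label1_c s in
  is_lb1 s' /\ forall v, v < n -> [/\ arr s' aCNT v = 0, arr s' aADA v = 0,
    arr s' aYY v = 0 & arr s' aBEST v = v].
Proof.
move=> gs; rewrite /label1_c run_seq.
set c1 := vfor _; set c2 := arcs_for _.
pose s1 := run c1 s.
have gs1 : gst s1 by apply: gst_run.
have H1 v : v < n -> [/\ arr s1 aLB1 v = v, arr s1 aCNT v = 0, arr s1 aADA v = 0,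
    arr s1 aYY v = 0 & arr s1 aBEST v = v].
  have := @vfor_gst (fun k s' => forall v, v < k -> [/\ arr s' aLB1 v = v, arr s' aCNT v = 0, arr s' aADA v = 0,
    arr s' aYY v = 0 & arr s' aBEST v = v]) _ s gs.
  apply=> // k s' kn _ IH x; rewrite ltnS leq_eqVlt /= /upd.
  by case: eqP => //= _ xk; apply: IH.
rewrite -/s1; set s2 := run c2 s1.
suff [I1 I2 I3] : is_lb1 s2.
  by split=> // v vn; have [_ E] := run_same c2 s1; rewrite !E //; have [] := H1 v vn.
pose I (d : seq (nat * nat)) s' := [/\ forall v, v < n -> arr s' aLB1 v = v \/ e v (arr s' aLB1 v),
      forall v, v < n -> arr s' aLB1 v <= v
    & forall u w : nat, (u, w) \in d -> arr s' aLB1 u <= w].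
apply: (@arcs_for_gst I) => //.
- by move=> d t1 t2 [i1 i2 i3] [_ ea]; rewrite /I (ea aLB1 isT); split.
- by split=> // v vn; have [->] := H1 v vn; auto.
move=> d u w s' sub F Eu Ew [i1 i2 i3] /=; rewrite Eu Ew.
have uw := sub_rcons sub.
have un := e_lt uw; have iu := i2 u un.
case: ifP => h; split=> //=.
- by rcase; [move: h; lia|auto].
- by move=> v vn; rewrite /upd; case: eqP => [->|_]; auto.
- by move=> v vn; rewrite /upd; case: eqP => [->|_]; [lia|auto].
- by rcase; rewrite /upd ?eqxx //; case: eqP => [E|_]; [have := i3 _ _ xy; rewrite E; lia|auto].
Qed.

Definition is_lb2 (s : store) : Prop :=
  [/\ forall v, v < n -> arr s aLB2 v = arr s aLB1 (arr s aPAR v),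
      forall v, v < n -> arr s aPAR v = v \/ e v (arr s aPAR v),
      forall v, v < n -> arr s aLB2 v <= arr s aLB1 v
    & forall u w, e u w -> arr s aLB2 u <= arr s aLB1 w].

Lemma label2_ok s : gst s -> is_lb2 (run label2_c s).
Proof.
move=> gs; rewrite /label2_c run_seq.
set c1 := vfor _; set c2 := arcs_for _.
pose s1 := run c1 s.
have gs1 : gst s1 by apply: gst_run.
have H1 v : v < n -> arr s1 aLB2 v = arr s1 aLB1 v /\ arr s1 aPAR v = v.
  have := @vfor_gst (fun k s' => forall v, v < k ->
    arr s' aLB2 v = arr s' aLB1 v /\ arr s' aPAR v = v) _ s gs.
  apply=> // k s' kn _ IH x; rewrite ltnS leq_eqVlt /= /upd.
  by case: eqP => [->|] //= _ xk; apply: IH.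
rewrite -/s1; pose lb1 := arr s1 aLB1.
pose I (d : seq (nat * nat)) s' := [/\ arr s' aLB1 = lb1,
      forall v, v < n -> arr s' aLB2 v = lb1 (arr s' aPAR v),
      forall v, v < n -> arr s' aPAR v = v \/ e v (arr s' aPAR v),
      forall v, v < n -> arr s' aLB2 v <= lb1 v
    & forall u w : nat, (u, w) \in d -> arr s' aLB2 u <= lb1 w].
suff : I L (run c2 s1).
  by move=> [i0 i1 i2 i3 i4]; split; rewrite ?i0.
apply: arcs_for_gst => //.
- by move=> d t1 t2 [i0 i1 i2 i3 i4] [_ ea]; rewrite /I !ea.
- by split=> // v vn; have [E1 E2] := H1 v vn; rewrite ?E1 ?E2 //; auto.
move=> d u w s' sub F Eu Ew [i0 i1 i2 i3 i4] /=; rewrite Eu Ew i0.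
have uw := sub_rcons sub.
have un := e_lt uw; have iu := i3 u un.
case: ifP => h; split=> //=.
- by rcase; [move: h; lia|auto].
- by move=> v vn; rewrite /upd; case: eqP => // _; auto.
- by move=> v vn; rewrite /upd; case: eqP => [->|_]; auto.
- by move=> v vn; rewrite /upd; case: eqP => [->|_]; [lia|auto].
- by rcase; rewrite /upd ?eqxx //; case: eqP => [E|_]; [have := i4 _ _ xy; rewrite E; lia|auto].
Qed.

Lemma far_test_ok s : gst s -> is_lb1 s -> is_lb2 s ->
  let s' := run far_test_c s in
  if var s' vFOUND == 0 then forall u w, e u w -> arr s aLB2 u = arr s aLB2 w
  else P4 e (var s' vP1) (var s' vP2) (var s' vP3) (var s' vP4).
Proof.
move=> gs [a1 a2 a3] [b1 b2 b3 b4]; rewrite /far_test_c run_seq.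
set s1 := run _ s; set c2 := arcs_for _.
have gs1 : gst s1 by apply: gst_run.
pose I (d : seq (nat * nat)) s' :=
  if var s' vFOUND == 0 then forall u w : nat, (u, w) \in d -> arr s aLB2 w <= arr s aLB2 u
  else P4 e (var s' vP1) (var s' vP2) (var s' vP3) (var s' vP4).
suff : I L (run c2 s1).
  rewrite /I; case: ifP => // _ H u w uw.
  by apply/eqP; rewrite eqn_leq !H //; apply: e_sym.
apply: arcs_for_gst => //.
- by move=> d t1 t2; rewrite /I => + [ev _]; rewrite !ev.
move=> d u w s' sub [_ F] Eu Ew; rewrite /I /= Eu Ew !F //= => IH.
have uw := sub_rcons sub.
rewrite subn_eq0; case: leqP => h /=.
  by move: IH; case: ifP => // _ IH; rcase => //; exact: (IH _ _ xy).
rewrite /upd /= Eu Ew.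
exact: (P4_far L_uniq e_sym e_irr e_lt a1 a2 a3 b1 b2 b3 b4 uw h).
Qed.

Definition fars (s : store) : nat -> bool := far (arr s aLB1) (arr s aLB2).

Lemma count_ok s : gst s -> (forall v, v < n -> arr s aCNT v = 0) ->
  forall v, v < n -> arr (run count_c s) aCNT v =
    size (fnb L (arr s aLB1) (arr s aLB2) v).
Proof.
move=> gs c0.
pose f (d : seq (nat * nat)) v := size [seq p.2 | p <- d & (p.1 == v) && fars s p.2].
pose I d s' := forall v, v < n -> arr s' aCNT v = f d v.
suff : I L (run count_c s) by [].
apply: arcs_for_gst => //.
- by move=> d t1 t2; rewrite /I => + [_ ea]; rewrite !ea.
move=> d u w s' sub [_ F] Eu Ew; rewrite /I /= Eu Ew.
rewrite (F aLB1 isT) (F aLB2 isT) => IH v vn.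
have un := e_lt (sub_rcons sub).
rewrite /f filter_rcons /= -/(fars s) subn_eq0 leqNgt.
rewrite -[arr s 5 w < arr s 4 w]/(fars s w).
case: (boolP (fars s w)) => fw /=; last by rewrite andbF; apply: IH.
rewrite andbT /upd [u == v]eq_sym; case: eqP => [->|_]; last exact: IH.
by rewrite map_rcons size_rcons addn1 IH.
Qed.

Lemma best_ok s : gst s -> is_lb1 s -> is_lb2 s ->
  (forall u w, e u w -> arr s aLB2 u = arr s aLB2 w) ->
  (forall v, v < n -> arr s aBEST v = v) ->
  let s' := run best_c s in
  (forall r, r < n -> arr s' aBEST r = r \/
    [/\ arr s' aBEST r < n, arr s aLB2 (arr s' aBEST r) = r
      & ~~ fars s (arr s' aBEST r)]) /\
  (forall v, v < n -> ~~ fars s v ->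
     arr s aCNT v <= arr s aCNT (arr s' aBEST (arr s aLB2 v))).
Proof.
move=> gs [a1 a2 a3] [b1 b2 b3 b4] Hc B0.
have lead v : v < n -> arr s aLB2 v < n.
  by move=> vn; have [] := leader L_uniq e_sym e_lt a1 a2 b1 b2 b3 Hc vn.
apply: (@vfor_gst (fun k s' => (forall r, r < n -> arr s' aBEST r = r \/
    [/\ arr s' aBEST r < n, arr s aLB2 (arr s' aBEST r) = r
      & ~~ fars s (arr s' aBEST r)]) /\
  (forall v, v < k -> ~~ fars s v ->
     arr s aCNT v <= arr s aCNT (arr s' aBEST (arr s aLB2 v)))) _ _ gs).
  by split=> // r rn; left; apply: B0.
move=> k s' kn [_ F] [i1 i2] /=; rewrite /upd /=.
rewrite !(F aLB1 isT) !(F aLB2 isT) !(F aCNT isT).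
set r := arr s 5 k; set b := arr s' 8.
rewrite muln_eq0 !subn_eq0.
rewrite subn_gt0 -[r < arr s 4 k]/(fars s k).
have rn : r < n by apply: lead.
case: (leqP (arr s 7 k) (arr s 7 (b r))) => h.
  by split=> // v; rewrite ltnS leq_eqVlt => /orP [/eqP ->|vk]; auto.
case: (boolP (fars s k)) => fk /=.
  split=> // v; rewrite ltnS leq_eqVlt => /orP [/eqP ->|vk]; last by auto.
  by rewrite fk.
split=> [r' rn'|v].
  by rewrite /upd; case: eqP => [->|_]; [right; split|apply: i1].
rewrite ltnS leq_eqVlt /upd => /orP [/eqP ->|vk nf]; first by rewrite eqxx.
case: eqP => [E|_]; last exact: i2.
by apply: leq_trans (ltnW h); rewrite /b -E; apply: i2.
Qed.

Lemma ada_ok s : gst s -> (forall v, v < n -> arr s aADA v = 0) ->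
  forall v, v < n -> (arr (run ada_c s) aADA v != 0) =
    e (arr s aBEST (arr s aLB2 v)) v.
Proof.
move=> gs c0.
pose I (d : seq (nat * nat)) s' := forall v, v < n ->
  (arr s' aADA v != 0) = ((arr s aBEST (arr s aLB2 v), v) \in d).
suff : I L (run ada_c s) by [].
apply: arcs_for_gst => //.
- by move=> d t1 t2; rewrite /I => + [_ ea]; rewrite !ea.
- by move=> v vn; rewrite c0.
move=> d u w s' sub [_ F] Eu Ew; rewrite /I /= Eu Ew.
rewrite !(F aBEST isT) !(F aLB2 isT) => IH v vn.
rewrite mem_rcons inE xpair_eqE addn_eq0 !subn_eq0 -eqn_leq [u == _]eq_sym.
case: (eqVneq (arr s 8 (arr s 5 w)) u) => Eb /=; rewrite /upd.
  by case: (eqVneq v w) => [->|nvw]; rewrite ?Eb ?eqxx //= ?andbF IH.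
rewrite IH //; case: (eqVneq v w) => [->|nvw]; last by rewrite andbF.
by rewrite (negbTE Eb).
Qed.

Definition best (s : store) (v : nat) := arr s aBEST (arr s aLB2 v).

Lemma bad_ok s : gst s ->
  (forall v, v < n -> (arr s aADA v != 0) = e (best s v) v) ->
  let s' := run bad_c s in
  if var s' vFL == 0 then
    (forall v, v < n -> fars s v -> e (best s v) v) /\
    (forall v, v < n -> ~~ fars s v -> ~~ e (best s v) v ->
      arr s aCNT (best s v) <= arr s aCNT v)
  else exists v, [/\ v < n, ~~ e (best s v) v,
         var s' vRR = arr s aLB2 v, var s' vAA = best s v
       & [/\ fars s v, var s' vMM = v & var s' vBB = arr s aPAR v] \/
         [/\ ~~ fars s v, arr s aCNT v < arr s aCNT (best s v) & var s' vBB = v]].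
Proof.
move=> gs A; rewrite /bad_c run_seq.
set s1 := run _ s; set c2 := vfor _.
have gs1 : gst s1 by apply: gst_run.
pose I k s' := if var s' vFL == 0 then
    (forall v, v < k -> fars s v -> e (best s v) v) /\
    (forall v, v < k -> ~~ fars s v -> ~~ e (best s v) v ->
      arr s aCNT (best s v) <= arr s aCNT v)
  else exists v, [/\ v < n, ~~ e (best s v) v,
         var s' vRR = arr s aLB2 v, var s' vAA = best s v
       & [/\ fars s v, var s' vMM = v & var s' vBB = arr s aPAR v] \/
         [/\ ~~ fars s v, arr s aCNT v < arr s aCNT (best s v) & var s' vBB = v]].
suff : I n (run c2 s1) by [].
apply: (@vfor_gst I) => //.
move=> k s' kn [_ F]; rewrite /I /=.
rewrite /upd /= !(F _ isT) -![arr s1 _]/(arr s _) => IH.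
have := A k kn; case: (eqVneq (arr s 9 k) 0) => [E0|E0] /= ek.
- rewrite subn_eq0 leqNgt -[arr s 5 k < arr s 4 k]/(fars s k).
  case: (boolP (fars s k)) => fk /=.
    exists k; split=> //; first by rewrite -ek.
    by left; split.
  rewrite subn_eq0 -/(best s k); case: leqP => h /=.
    case: ifP IH => // _ [i1 i2]; split=> v; rewrite ltnS leq_eqVlt => /orP [/eqP ->|vk]; auto.
    by rewrite (negbTE fk).
  exists k; split=> //; first by rewrite -ek.
  by right; split.
- case: ifP IH => // _ [i1 i2]; split=> v; rewrite ltnS leq_eqVlt => /orP [/eqP ->|vk]; auto.
  by move=> _; rewrite -ek.
Qed.

Lemma wit_ok s (r a m b : nat) : gst s ->
  (forall v, v < n -> (arr s aADA v != 0) = e (best s v) v) ->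
  (forall v, v < n -> arr s aYY v = 0) -> b < n ->
  var s vRR = r -> var s vAA = a -> var s vMM = m -> var s vBB = b ->
  (exists w, [/\ w < n, e (best s w) w, fars s w, ~~ e b w & arr s aLB2 w = r]) ->
  let s' := run wit_c s in
  var s' vFOUND = 1 /\ exists w,
  [/\ w < n, e (best s w) w, fars s w, ~~ e b w & arr s aLB2 w = r] /\
  [/\ var s' vP1 = if e (best s b) b then if e m w then r else w else w,
      var s' vP2 = a,
      var s' vP3 = if e (best s b) b then if e m w then w else b else r
    & var s' vP4 = if e (best s b) b then m else b].
Proof.
move=> gs A Y0 bn Er Ea Em Eb W; rewrite /wit_c !run_seq.
set s1 := run (arcs_for _) s; set s2 := run _ s1; set s3 := run (vfor _) s2.
set s4 := run _ s3; set s5 := run (arcs_for _) s4.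
have gs1 : gst s1 by apply: gst_run.
have gs2 : gst s2 by apply: gst_run.
have gs3 : gst s3 by apply: gst_run.
have gs4 : gst s4 by apply: gst_run.
have Y1 v : v < n -> (arr s1 aYY v != 0) = e b v.
  pose I (d : seq (nat * nat)) s' := forall v, v < n ->
    (arr s' aYY v != 0) = ((b, v) \in d).
  suff H : I L s1 by apply: H.
  apply: arcs_for_gst => //.
  - by move=> d t1 t2; rewrite /I => + [_ ea]; rewrite !ea.
  - by move=> x xn; rewrite Y0.
  move=> d u w s' sub [F _] Eu Ew; rewrite /I /= Eu Ew (F vBB isT) Eb => IH x xn.
  rewrite mem_rcons inE xpair_eqE addn_eq0 !subn_eq0 -eqn_leq [b == u]eq_sym.
  case: (eqVneq u b) => Eub /=; last by apply: IH.
  by rewrite /upd; case: (eqVneq x w) => //= _; apply: IH.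
pose Q w := [/\ w < n, e (best s w) w, fars s w, ~~ e b w & arr s aLB2 w = r].
have Qw : Q (var s3 vMW).
  pose I k s' := (exists2 w, w < k & Q w) -> Q (var s' vMW).
  suff H : I n s3 by apply: H; have [w Hw] := W; exists w => //; case: Hw.
  apply: (@vfor_gst I) => //; first by case.
  move=> k s' kn [F F']; rewrite /I /= /upd /= !(F' _ isT) (F vRR isT) => IH.
  have e2 A' : A' != aYY -> arr s2 A' = arr s A'.
    by move=> ?; rewrite /s2 /= run_arr // inE.
  have er : var s2 vRR = r by rewrite /s2 /= /upd /= run_var.
  rewrite er !(e2 aLB1 isT) !(e2 aLB2 isT) !(e2 aADA isT) -[arr s2 10]/(arr s1 10).
  pose q := [&& fars s k, arr s 9 k != 0, ~~ (arr s1 10 k != 0) & arr s 5 k == r].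
  have qP : reflect (Q k) q.
    rewrite /q A // Y1 //; apply: (iffP and4P) => [[h1 h2 h3 /eqP h4]|[_ h1 h2 h3 h4]].
      by split.
    by rewrite h4 eqxx.
  have -> : ((arr s 4 k - arr s 5 k) * arr s 9 k *
    ((1 - arr s1 10 k) * (1 - (arr s 5 k - r + (r - arr s 5 k)))) == 0) = ~~ q.
    rewrite !muln_eq0 /q /fars /far; lia.
  case: qP => [h _|h [w]] //=.
  rewrite ltnS leq_eqVlt => /orP [/eqP ->|wk Hw]; first by move/h.
  by apply: IH; exists w.
have M3 x : x \notin [:: vI; vU; vW; vMW; vV; vADJ] -> var s5 x = var s x.
  move=> hx; rewrite /s5 run_var; last by apply: contra hx; rewrite /= !inE => /or4P [] ->; rewrite ?orbT.
  rewrite /s4 run_var; last by apply: contra hx; rewrite /= !inE => ->; rewrite ?orbT.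
  rewrite /s3 run_var; last by apply: contra hx; rewrite /= !inE => /orP [] ->; rewrite ?orbT.
  rewrite /s2 run_var; last by apply: contra hx; rewrite /= !inE => ->; rewrite ?orbT.
  by rewrite /s1 run_var //; apply: contra hx; rewrite /= !inE => /or3P [] ->; rewrite ?orbT.
have eMW : var s5 vMW = var s3 vMW.
  by rewrite /s5 run_var // /s4 run_var.
have adj : (var s5 vADJ != 0) = e m (var s5 vMW).
  rewrite eMW.
  pose I (d : seq (nat * nat)) s' := (var s' vADJ != 0) = ((m, var s3 vMW) \in d).
  suff H : I L s5 by apply: H.
  apply: arcs_for_gst => //.
  - by move=> d t1 t2; rewrite /I => + [ev _]; rewrite !ev.
  move=> d u w s' sub [F _] Eu Ew; rewrite /I /= Eu Ew (F vMM isT) (F vMW isT).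
  have -> : var s4 vMM = m by rewrite -Em -(M3 vMM) // /s5 run_var.
  have -> : var s4 vMW = var s3 vMW by rewrite /s4 run_var.
  rewrite mem_rcons inE xpair_eqE !addn_eq0 !subn_eq0 -!eqn_leq => <-.
  rewrite [m == u]eq_sym [var s3 20 == w]eq_sym.
  by case: ifP.
have ea : arr s5 aADA b = arr s aADA b.
  by rewrite /s5 run_arr // /s4 run_arr // /s3 run_arr // /s2 run_arr // /s1 run_arr.
have [wn aw fw bw Ew] := Qw.
rewrite /= (M3 vBB isT) Eb ea -(A b bn).
case: (eqVneq (arr s aADA b) 0) => _ /=.
  by split=> //; exists (var s3 vMW); rewrite /upd /= eMW !M3 // Er Ea Eb.
case: (eqVneq (var s5 vADJ) 0) adj => ad /=; rewrite eMW => adj.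
  split=> //; exists (var s3 vMW); rewrite /upd /= eMW !M3 // Ea Eb Em.
  by rewrite -adj.
split=> //; exists (var s3 vMW); rewrite /upd /= eMW !M3 // Er Ea Em.
by rewrite -adj.
Qed.

Definition cert (lab : nat -> nat) : Prop :=
  (forall u w, e u w -> lab u = lab w) /\
  (forall u w, u < n -> w < n -> lab u = lab w ->
     [\/ u = w, e u w | exists2 c, e u c & e c w]).

Lemma search_ok s : gst s -> let s' := run search_c s in
  if var s' vFOUND == 0 then cert (arr s' aLB2)
  else P4 e (var s' vP1) (var s' vP2) (var s' vP3) (var s' vP4).
Proof.
move=> gs; rewrite /search_c 3!run_seq.
have [s1 E1] := ex_eq (run label1_c s); rewrite -E1.
have [s2 E2] := ex_eq (run label2_c s1); rewrite -E2.
have [s3 E3] := ex_eq (run far_test_c s2); rewrite -E3.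
have gs1 : gst s1 by rewrite E1; apply: gst_run.
have gs2 : gst s2 by rewrite E2; apply: gst_run.
have gs3 : gst s3 by rewrite E3; apply: gst_run.
have [L1 Z1] := label1_ok gs; rewrite -E1 in L1 Z1.
have L2 := label2_ok gs1; rewrite -E2 in L2.
have {}L1 : is_lb1 s2 by rewrite /is_lb1 E2 run_arr.
have := far_test_ok gs2 L1 L2; rewrite -E3; cbv zeta => FT.
rewrite run_if [ev s3 _]/=; case: (eqVneq (var s3 vFOUND) 0) FT => [F3|F3] Hc; last first.
  by rewrite (negbTE F3).
rewrite 4!run_seq.
have [s4 E4] := ex_eq (run count_c s3); rewrite -E4.
have [s5 E5] := ex_eq (run best_c s4); rewrite -E5.
have [s6 E6] := ex_eq (run ada_c s5); rewrite -E6.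
have [s7 E7] := ex_eq (run bad_c s6); rewrite -E7.
have gs4 : gst s4 by rewrite E4; apply: gst_run.
have gs5 : gst s5 by rewrite E5; apply: gst_run.
have gs6 : gst s6 by rewrite E6; apply: gst_run.
have gs7 : gst s7 by rewrite E7; apply: gst_run.
set lb1 := arr s2 aLB1; set lb2 := arr s2 aLB2; set par := arr s2 aPAR.
have [a1 a2 a3] := L1; have [b1 b2 b3 b4] := L2.
rewrite -/lb1 -/lb2 -/par in Hc a1 a2 a3 b1 b2 b3 b4.
pose cnt u := size (fnb L lb1 lb2 u).
have [_ k2] := run_same label2_c s1; rewrite -E2 in k2.
have [_ k3] := run_same far_test_c s2; rewrite -E3 in k3.
have [u4 k4] := run_same count_c s3; rewrite -E4 in u4 k4.
have [u5 k5] := run_same best_c s4; rewrite -E5 in u5 k5.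
have [u6 k6] := run_same ada_c s5; rewrite -E6 in u6 k6.
have [u7 k7] := run_same bad_c s6; rewrite -E7 in u7 k7.
have Zs v : v < n -> [/\ arr s3 aCNT v = 0, arr s5 aADA v = 0,
    arr s6 aYY v = 0 & arr s4 aBEST v = v].
  move=> vn; have [z1 z2 z3 z4] := Z1 v vn.
  split.
  - by rewrite (k3 aCNT isT) (k2 aCNT isT).
  - by rewrite (k5 aADA isT) (k4 aADA isT) (k3 aADA isT) (k2 aADA isT).
  - by rewrite (k6 aYY isT) (k5 aYY isT) (k4 aYY isT) (k3 aYY isT) (k2 aYY isT).
  - by rewrite (k4 aBEST isT) (k3 aBEST isT) (k2 aBEST isT).
have eqs A : A \in [:: aLB1; aLB2; aPAR] -> [/\ arr s4 A = arr s2 A, arr s5 A = arr s2 A,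
    arr s6 A = arr s2 A & arr s7 A = arr s2 A].
  rewrite !inE => /or3P [] /eqP ->;
  by split; rewrite ?k7 // ?k6 // ?k5 // ?k4 // k3.
have [e14 e15 e16 e17] := eqs aLB1 isT.
have [e24 e25 e26 e27] := eqs aLB2 isT.
have [e34 e35 e36 e37] := eqs aPAR isT.
have C4 v : v < n -> arr s4 aCNT v = cnt v.
  move=> vn; rewrite E4 (count_ok gs3) ?(k3 aLB1 isT) ?(k3 aLB2 isT) //.
  by move=> x xn; have [] := Zs x xn.
have [B1 B2] : (forall r, r < n -> arr s5 aBEST r = r \/
    [/\ arr s5 aBEST r < n, lb2 (arr s5 aBEST r) = r
      & ~~ far lb1 lb2 (arr s5 aBEST r)]) /\
  (forall v, v < n -> ~~ far lb1 lb2 v ->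
     arr s4 aCNT v <= arr s4 aCNT (arr s5 aBEST (lb2 v))).
  have M1 : is_lb1 s4 by rewrite /is_lb1 e14.
  have M2 : is_lb2 s4 by rewrite /is_lb2 e14 e24 e34.
  have M3 : forall u w, e u w -> arr s4 aLB2 u = arr s4 aLB2 w by rewrite e24.
  have M4 v : v < n -> arr s4 aBEST v = v by move=> vn; have [] := Zs v vn.
  by have := best_ok gs4 M1 M2 M3 M4; rewrite -E5 /fars e14 e24.
set bst := arr s5 aBEST in B1 B2.
have lead v : v < n -> lb2 v < n.
  by move=> vn; have [] := leader L_uniq e_sym e_lt a1 a2 b1 b2 b3 Hc vn.
have bn v : v < n -> bst (lb2 v) < n.
  by move=> /lead rn; case: (B1 _ rn) => [->|[]].
have B3 v : v < n -> ~~ far lb1 lb2 v -> cnt v <= cnt (bst (lb2 v)).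
  by move=> vn nf; rewrite -!C4 ?bn //; apply: B2.
have bE t v : arr t aBEST = bst -> arr t aLB2 = lb2 -> best t v = bst (lb2 v).
  by rewrite /best => -> ->.
have b6 v : best s6 v = bst (lb2 v) by apply: bE; rewrite ?e26 // (k6 aBEST isT).
have b7 v : best s7 v = bst (lb2 v).
  by apply: bE; rewrite ?e27 // (k7 aBEST isT) (k6 aBEST isT).
have f6 v : fars s6 v = far lb1 lb2 v by rewrite /fars e16 e26.
have f7 v : fars s7 v = far lb1 lb2 v by rewrite /fars e17 e27.
have C6 v : v < n -> arr s6 aCNT v = cnt v.
  by move=> vn; rewrite -C4 // (k6 aCNT isT) (k5 aCNT isT).
have A6 v : v < n -> (arr s6 aADA v != 0) = e (bst (lb2 v)) v.
  move=> vn; rewrite E6 ada_ok //; last by move=> x xn; have [] := Zs x xn.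
  by rewrite e25.
have := bad_ok gs6 (fun v vn => etrans (A6 v vn) (congr1 (e^~ v) (esym (b6 v)))).
rewrite -E7 run_if [ev s7 _]/=; cbv zeta.
case: (eqVneq (var s7 vFL) 0) => [_ [h1 h2]|_ [v [vn nv Er Ea Hv]]].
  have -> : var s7 vFOUND = 0.
    by rewrite (u7 vFOUND isT) (u6 vFOUND isT) (u5 vFOUND isT) (u4 vFOUND isT).
  rewrite eqxx e27; split=> // u w un wn.
  apply: (diam2 L_uniq e_sym e_irr e_lt (cnt := cnt) (best := bst) a1 a2 a3 b1 b2 b3 Hc) => //.
  - by move=> x xn; rewrite -f6 -b6; apply: h1.
  - by move=> x xn; rewrite -f6 -b6 -!C6 ?b6 ?bn //; rewrite -b6; apply: h2.
set r := lb2 v; set m := var s7 vMM; set b := var s7 vBB.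
have B : bad n L lb1 lb2 par cnt bst r m b.
  rewrite b6 in nv Hv; case: Hv => -[].
    by rewrite f6 e36 /m /b => fv -> ->; left; split.
  rewrite f6 !C6 ?bn // /b => fv cl ->; right; split=> //.
have [bnn Eb2] : b < n /\ lb2 b = r.
  case: B => -[mn Em fm _ Eb] //.
  have [mp _ _] := far_par L_uniq e_sym e_lt a1 a3 b1 b2 Hc mn fm.
  by rewrite -Eb in mp; split; [exact: e_lt (e_sym mp)|rewrite -(Hc _ _ mp)].
have rn : r < n by apply: lead.
have lr : lb2 (bst r) = r.
  case: (B1 r rn) => [->|[]] //.
  by have [_] := leader L_uniq e_sym e_lt a1 a2 b1 b2 b3 Hc vn.
have lw w : e (bst r) w -> lb2 w = r by move=> /Hc <-.
have [w0 [aw0 fw0 bw0]] := bad_wit L_uniq e_sym e_lt a1 a2 a3 b1 b2 b3 Hc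
  (fun u => erefl) B3 B.
have A7 x : x < n -> (arr s7 aADA x != 0) = e (best s7 x) x.
  by move=> xn; rewrite b7 (k7 aADA isT); apply: A6.
have Y7 x : x < n -> arr s7 aYY x = 0.
  by move=> xn; rewrite (k7 aYY isT); have [] := Zs x xn.
rewrite e26 in Er; rewrite b6 -/r in Ea.
have Ex : exists w, [/\ w < n, e (best s7 w) w, fars s7 w, ~~ e b w
                      & arr s7 aLB2 w = r].
  exists w0; rewrite b7 f7 e27 (lw _ aw0); split=> //; last exact: lw.
  exact: e_lt (e_sym aw0).
have := @wit_ok s7 r (bst r) m b gs7 A7 Y7 bnn Er Ea erefl erefl Ex.
cbv zeta; have [s8 E8] := ex_eq (run wit_c s7); rewrite -E8.
case=> -> [w [[wn aw fw bw Ew] [-> -> -> ->]]] /=.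
rewrite e27 -/lb2 in Ew; rewrite b7 Ew in aw; rewrite f7 in fw; rewrite b7 Eb2.
have := bad_P4 L_uniq e_sym e_irr e_lt a1 a2 a3 b1 b2 b3 Hc
  (fun u => erefl) B1 B3 B aw fw bw.
by rewrite -[_ \in L]/(e (bst r) b) -[_ \in L]/(e m w); case: (e (bst r) b) => //; case: (e m w).
Qed.

End Round.

(** * The deletion set *)

Definition swap (p : nat * nat) : nat * nat := (p.2, p.1).
Definition arcl (s : seq (nat * nat)) := s ++ map swap s.

Lemma mem_arcl s u w : ((u, w) \in arcl s) = adj s u w.
Proof.
rewrite mem_cat /adj; congr (_ || _); apply/mapP/idP => [[[a b] h [-> ->]] //|h].
by exists (w, u).
Qed.

Lemma run_for x e c st : run (For x e c) st = loop x c st (ev st e).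
Proof. by []. Qed.

Lemma tm_for x e c st : tm (For x e c) st = et e + 5 +
  \sum_(0 <= j < ev st e) (tm c (setv (loop x c st j) x j) + 8).
Proof. by []. Qed.

Lemma tm_if e a b st : tm (If e a b) st =
  et e + 1 + (if ev st e == 0 then tm b st else tm a st + 2).
Proof. by []. Qed.

Lemma sum_prefix n k c : \sum_(0 <= j < n) (if j <= k then c else 0) <= k.+1 * c.
Proof.
have H : \sum_(0 <= j < n) (if j <= k then c else 0) = minn n k.+1 * c.
  elim: n => [|n IH]; first by rewrite big_geq // min0n.
  rewrite big_nat_recr //= IH; case: leqP => h.
    by rewrite !(minn_idPl _) ?mulSnr //; lia.
  by rewrite !(minn_idPr _) ?addn0 //; lia.
by rewrite H leq_mul2r geq_minr orbT.
Qed.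

Section Graph.
Variables (n : nat) (s : seq (nat * nat)).
Hypothesis Hs : valid_graph n s.

Lemma adj_sym u w : adj s u w = adj s w u.
Proof. by rewrite /adj orbC. Qed.

Lemma adj_lt u w : adj s u w -> u < n.
Proof.
case: Hs => /allP H _ _ /orP [] /H /andP [/andP [h1 h2] _] //.
Qed.

Lemma adj_lt2 u w : adj s u w -> w < n.
Proof. by rewrite adj_sym; apply: adj_lt. Qed.

Lemma adj_irr u : ~~ adj s u u.
Proof.
by case: Hs => /allP H _ _; apply/negP => /orP [] /H /andP [_] /=; rewrite eqxx.
Qed.

Lemma arcl_uniq : uniq (arcl s).
Proof.
case: Hs => _ us ns; rewrite cat_uniq us /= map_inj_in_uniq ?us ?andbT.
  apply/hasPn => p /mapP [[u w] /ns uw ->]; exact: uw.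
by move=> [a b] [c d] _ _ [-> ->].
Qed.

Definition Klist (st : store) : seq nat :=
  [seq arr st aKL i | i <- iota 0 (var st vKK)].

Definition cst (st : store) : Prop :=
  [/\ var st vN = n, arcs st = arcl s, uniq (Klist st), all (fun v => v < n) (Klist st)
    & forall v, (arr st aINK v != 0) = (v \in Klist st)].

Lemma Lv_mem st u w : cst st ->
  ((u, w) \in Lv st) = [&& adj s u w, u \notin Klist st & w \notin Klist st].
Proof.
move=> [_ eA _ _ eI]; rewrite /Lv mem_filter eA mem_arcl andbC /live /=.
by rewrite -!eI !negbK.
Qed.

Lemma cst_gst st : cst st -> gst n (Lv st) st.
Proof. by case. Qed.

Lemma Lv_facts st : cst st ->
  [/\ uniq (Lv st), forall u w, (u, w) \in Lv st -> (w, u) \in Lv st,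
      forall u, (u, u) \notin Lv st & forall u w, (u, w) \in Lv st -> u < n].
Proof.
move=> C; split.
- by case: C => _ eA _ _ _; rewrite /Lv filter_uniq // eA arcl_uniq.
- by move=> u w; rewrite !Lv_mem // adj_sym => /and3P [-> -> ->].
- by move=> u; rewrite Lv_mem // (negbTE (adj_irr u)).
- by move=> u w; rewrite Lv_mem // => /and3P [/adj_lt].
Qed.

Definition keepC (c : cmd) : bool :=
  [&& vN \notin mv c, vM2 \notin mv c, vKK \notin mv c
    & ~~ has (mem [:: aSRC; aDST; aINK; aKL]) (ma c)].

Lemma cst_run c st : keepC c -> cst st -> 
  cst (run c st) /\ Klist (run c st) = Klist st.
Proof.
move=> /and4P [h1 h2 h3 h4] [c1 c2 c3 c4 c5].
have nA A : A \in [:: aSRC; aDST; aINK; aKL] -> arr (run c st) A = arr st A.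
  by move=> hin; apply: run_arr; apply: contra h4 => Ac; apply/hasP; exists A.
have eK : Klist (run c st) = Klist st by rewrite /Klist run_var // nA.
split=> //; split; rewrite ?eK ?run_var // ?nA //.
by rewrite /arcs run_var // !nA.
Qed.

Lemma remove_ok x st : x != vKK -> x < NV ->
  let st' := run (remove_c x) st in
  Klist st' = rcons (Klist st) (var st x) /\
  (forall v, (arr st' aINK v != 0) = (v == var st x) || (arr st aINK v != 0)) /\
  var st' vN = var st vN /\ arcs st' = arcs st /\
  forall y, y != vKK -> var st' y = var st y.
Proof.
move=> xk xn /=; split.
  rewrite /Klist /= /upd /= iotaD map_cat cats1 add0n /=.
  rewrite eqxx; congr rcons; apply/eq_in_map => i; rewrite mem_iota => ik.
  by rewrite ifF //; lia.
split=> [v|]; first by rewrite /= /upd; case: (v == var st x).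
by split=> //; split=> // y /negbTE yk; rewrite /upd yk.
Qed.

Lemma P4_hit st S a b c d : cst st -> cograph_deletion_set n s S ->
  P4 (fun u w => (u, w) \in Lv st) a b c d -> has (mem S) [:: a; b; c; d].
Proof.
move=> C [_ _ HS] [u ab bc cd [nac nbd nad]]; apply: contraT => /= hS; exfalso.
apply: (HS a b c d).
move: ab bc cd nac nbd nad; rewrite !Lv_mem //.
move=> /and3P [ab ka kb] /and3P [bc _ kc] /and3P [cd _ kd].
rewrite ka kb kc kd !andbT => nac nbd nad.
move: hS; rewrite !negb_or => /and4P [ha hb hc /andP [hd _]].
split=> //; split=> //; [exact: adj_lt ab|exact: adj_lt bc|exact: adj_lt cd|exact: adj_lt2 cd].
Qed.

Definition certK (st : store) : Prop :=
  cert n (Lv st) (arr st aLB2).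

Definition round_inv (r : nat) (st : store) : Prop :=
  [/\ cst st,
      forall S, cograph_deletion_set n s S ->
        size (Klist st) <= 4 * count (mem S) (Klist st)
    & if var st vDONE == 0 then size (Klist st) = 4 * r else certK st].

Lemma Klist_size st : size (Klist st) = var st vKK.
Proof. by rewrite size_map size_iota. Qed.

Lemma round_ok r st : round_inv r st -> var st vDONE = 0 ->
  round_inv r.+1 (run round_c st).
Proof.
move=> [C H1]; move=> H2 D0; rewrite D0 /= in H2.
have [Lu Ls Li Ll] := Lv_facts C.
have := search_ok Lu Ls Li Ll (cst_gst C).
rewrite /round_c run_seq run_if; cbv zeta.
have [C1 eK1] := @cst_run search_c st isT C.
have eL1 : Lv (run search_c st) = Lv st by apply: Lv_run.
have eD1 : var (run search_c st) vDONE = 0 by rewrite run_var.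
have [s1 E1] := ex_eq (run search_c st); rewrite -E1 in C1 eK1 eL1 eD1 *.
rewrite [ev _ _]/=.
case: eqVneq => [_ Hc|_ HP].
  have -> : run (vDONE <~ Num 1) s1 = setv s1 vDONE 1 by [].
  split=> //=; rewrite /Klist /= /upd /= -/(Klist s1) ?eK1 //.
  - rewrite /certK.
    have -> : Lv (setv s1 vDONE 1) = Lv st by rewrite -eL1.
    exact: Hc.
rewrite 3!run_seq.
have [k1 [i1 [n1 [a1 v1]]]] := @remove_ok vP1 s1 isT isT.
have [s2 E2] := ex_eq (run (remove_c vP1) s1); rewrite -E2 in k1 i1 n1 a1 v1 *.
have [k2 [i2 [n2 [a2 v2]]]] := @remove_ok vP2 s2 isT isT.
have [s3 E3] := ex_eq (run (remove_c vP2) s2); rewrite -E3 in k2 i2 n2 a2 v2 *.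
have [k3 [i3 [n3 [a3 v3]]]] := @remove_ok vP3 s3 isT isT.
have [s4 E4] := ex_eq (run (remove_c vP3) s3); rewrite -E4 in k3 i3 n3 a3 v3 *.
have [k4 [i4 [n4 [a4 v4]]]] := @remove_ok vP4 s4 isT isT.
have [s5 E5] := ex_eq (run (remove_c vP4) s4); rewrite -E5 in k4 i4 n4 a4 v4 *.
set p1 := var s1 vP1 in HP k1 i1 *; set p2 := var s1 vP2 in HP.
set p3 := var s1 vP3 in HP; set p4 := var s1 vP4 in HP.
have e2 : var s2 vP2 = p2 by rewrite v1.
have e3 : var s3 vP3 = p3 by rewrite v2 // v1.
have e4 : var s4 vP4 = p4 by rewrite v3 // v2 // v1.
rewrite {}e2 {}e3 {}e4 in k2 i2 k3 i3 k4 i4.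
have eK : Klist s5 = Klist st ++ [:: p1; p2; p3; p4].
  by rewrite k4 k3 k2 k1 eK1 -!cats1 -!catA.
have [up q1 q2 q3 _] := HP.
have in1 x y : (x, y) \in Lv st -> [/\ x < n, y < n, x \notin Klist st & y \notin Klist st].
  by rewrite Lv_mem // => /and3P [h -> ->]; rewrite (adj_lt h) (adj_lt2 h).
have [l1 l2 m1 m2] := in1 _ _ q1; have [l3 l4 m3 m4] := in1 _ _ q3.
case: (C1) => c1 c2 c3 c4 c5.
split.
- split.
  + by rewrite n4 n3 n2 n1.
  + by rewrite a4 a3 a2 a1.
  + rewrite eK cat_uniq up andbT; apply/andP; split; first by rewrite -eK1.
    by rewrite /= !negb_or m1 m2 m3 m4.
  + by rewrite eK all_cat -eK1 c4 /= l1 l2 l3 l4.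
  + move=> v; rewrite i4 i3 i2 i1 c5 eK1 eK mem_cat !inE.
    by case: (v \in Klist st); rewrite ?orbT //= !orbF !orbA; do !case: (_ == _).
- move=> S HS; have := P4_hit C HS HP; have := H1 S HS.
  rewrite eK size_cat count_cat has_count [size [:: _; _; _; _]]/= mulnDr => h1 h2.
  by apply: leq_add => //; rewrite -[4]muln1 leq_mul2l.
- have -> : var s5 vDONE = 0 by rewrite v4 // v3 // v2 // v1.
  by rewrite /= eK size_cat H2 /= mulnS addnC.
Qed.

Lemma rounds_inv st k : k <= n ->
  cst st -> Klist st = [::] -> var st vDONE = 0 ->
  round_inv k (loop vR (If $vDONE Skip round_c) st k).
Proof.
move=> kn C K0 D0.
suff H j : j <= n -> round_inv j (loop vR (If $vDONE Skip round_c) st j) by apply: H.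
apply: (@loop_ind (fun k s => round_inv k s)).
  by split; rewrite ?K0 ?D0.
move=> i st' ik _ I; rewrite run_if [ev _ _]/= [upd _ _ _ _]/=.
have I' : round_inv i (setv st' vR i) by case: I => -[] *; split.
case: eqVneq => D; first exact: round_ok I' D.
case: I' => C' H1; rewrite [var _ _]/= [upd _ _ _ _]/= (negbTE D) => H2.
split=> //.
by rewrite [var _ _]/= [upd _ _ _ _]/= (negbTE D).
Qed.

Lemma rounds_ok st : 0 < n -> cst st -> Klist st = [::] -> var st vDONE = 0 ->
  let st' := run rounds_c st in
  [/\ cst st', certK st'
    & forall S, cograph_deletion_set n s S -> var st' vKK <= 4 * size S].
Proof.
move=> n0 C K0 D0; cbv zeta; have eN : var st vN = n by case: C.
have := rounds_inv (leqnn n) C K0 D0.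
rewrite /rounds_c run_for [ev _ _]/= eN.
have [s1 E1] := ex_eq (loop vR (If $vDONE Skip round_c) st n); rewrite -E1.
have cnt_le S : uniq (Klist s1) -> cograph_deletion_set n s S -> count (mem S) (Klist s1) <= size S.
  move=> uK _; rewrite -size_filter; apply: uniq_leq_size; first exact: filter_uniq.
  by move=> x; rewrite mem_filter => /andP [].
case=> C1 H1; case: eqVneq => _ H2.
  exfalso; case: C1 => _ _ uK aK _.
  have : size (Klist s1) <= size (iota 0 n).
    by apply: uniq_leq_size => // x xK; rewrite mem_iota; apply: (allP aK).
  by rewrite size_iota H2; lia.
split=> // S HS; rewrite -Klist_size; apply: leq_trans (H1 S HS) _.
by rewrite leq_mul2l; apply: cnt_le => //; case: C1.
Qed.

Lemma rounds_tm st k C0 : cst st -> Klist st = [::] -> var st vDONE = 0 ->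
  is_dist_to_cograph n s k -> cb round_c st <= C0 ->
  tm rounds_c st <= 20 * n + 20 + k.+1 * (C0 + 20).
Proof.
move=> C K0 D0 [[S [HS <-]] _] HC; have eN : var st vN = n by case: C.
have -> : tm rounds_c st = 7 + \sum_(0 <= j < n)
    (tm (If $vDONE Skip round_c) (setv (loop vR (If $vDONE Skip round_c) st j) vR j) + 8).
  by rewrite /rounds_c tm_for [ev _ _]/= eN.
have le j : 0 <= j < n ->
    tm (If $vDONE Skip round_c) (setv (loop vR (If $vDONE Skip round_c) st j) vR j) + 8 <=
    13 + (if j <= size S then C0 else 0).
  move=> /andP [_ jn]; have [C1 H1 H2] := rounds_inv (ltnW jn) C K0 D0.
  have [Fv _] := loop_same vR (If $vDONE Skip round_c) st j.
  set t := loop _ _ _ j in C1 H1 H2 Fv *.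
  rewrite tm_if [ev _ _]/= [upd _ _ _ _]/=.
  case: eqVneq H2 => D H2; last by rewrite /=; lia.
  have -> : j <= size S.
    have := H1 S HS; rewrite H2 leq_mul2l /= => /leq_trans; apply.
    rewrite -size_filter; apply: uniq_leq_size; first by case: C1 => _ _ u _ _; exact: filter_uniq.
    by move=> x; rewrite mem_filter => /andP [].
  have : tm round_c (setv t vR j) <= cb round_c st.
    apply: (@tm_cb [:: vN; vM2]) => // x; rewrite !inE => /orP [] /eqP ->;
    by rewrite /= /upd /= Fv.
  by rewrite [et _]/=; lia.
apply: leq_trans (leq_add (leqnn 7) (_ : _ <= \sum_(0 <= j < n) (13 + (if j <= size S then C0 else 0)))) _.
  by rewrite big_nat_cond [X in _ <= X]big_nat_cond; apply: leq_sum => j; rewrite andbT; apply: le.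
rewrite big_split /= sum_nat_const_nat subn0.
have := sum_prefix n (size S) C0.
move: (\sum_(_ <= _ < _) _) => X; lia.
Qed.

Lemma init_ok m0 : var m0 vM = size s -> var m0 vN = n ->
  (forall i, i < size s -> arr m0 aIN (2 * i + 2) = (nth (0, 0) s i).1 /\
                           arr m0 aIN (2 * i + 3) = (nth (0, 0) s i).2) ->
  (forall A i, 0 < A < NA -> arr m0 A i = 0) ->
  let st := run init_c m0 in
  [/\ cst st, Klist st = [::], var st vDONE = 0, var st vNL = 0
    & var st vM2 = 2 * size s /\
      forall A i, aINK <= A < NA -> arr st A i = 0].
Proof.
move=> eM eN eI eZ; rewrite /init_c 4!run_seq.
set s1 := run (vNL <~ _) _; set c := For _ _ _.
have [v1 [n1 [d1 [k1 z1]]]] : var s1 vM = size s /\ var s1 vN = n /\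
  var s1 vDONE = 0 /\ var s1 vKK = 0 /\ var s1 vNL = 0 by [].
have a1 : arr s1 = arr m0 by [].
have m1 : var s1 vM2 = 0 by [].
clearbody s1; rewrite -a1 in eI eZ.
pose I k st := [/\ var st vM2 = 2 * k, forall i, i < k ->
    arr st aSRC i = (nth (0, 0) s i).1 /\ arr st aDST i = (nth (0, 0) s i).2
  & forall i, i < k -> arr st aSRC (size s + i) = (nth (0, 0) s i).2 /\
                       arr st aDST (size s + i) = (nth (0, 0) s i).1].
have [] : I (size s) (run c s1).
  rewrite -v1 /c; apply: (@for_ind I vI (Var vM)) => [|k s']; first by split.
  rewrite [ev _ _]/= v1 => kM [Fv Fa] [i0 i1 i2].
  have [e1 e2] := eI k kM.
  rewrite /I /= /upd /= (Fv vM isT) v1 (Fa aIN isT) i0 addnn -mul2n e1 e2.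
  have k' : k != size s + k by lia.
  split=> [|i|i]; first by lia.
  - rewrite ltnS leq_eqVlt => /orP [/eqP ->|ik].
      by rewrite eqxx (negbTE k').
    have -> : (i == size s + k) = false by lia.
    have -> : (i == k) = false by lia.
    exact: i1.
  - rewrite ltnS leq_eqVlt eqn_add2l => /orP [/eqP ->|ik].
      by rewrite eqxx.
    have -> : (i == k) = false by lia.
    have -> : (size s + i == k) = false by lia.
    exact: i2.
have [Fv Fa] := run_same c s1.
have [st E] := ex_eq (run c s1); rewrite -E in Fv Fa *.
move=> i0 i1 i2.
have K0 : Klist st = [::] by rewrite /Klist (Fv vKK isT) k1.
have Z A i : aINK <= A < NA -> arr st A i = 0.
  move=> hA; rewrite Fa; first by apply: eZ; lia.
  by rewrite /= !inE !negb_or; do !(apply/andP; split); lia.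
split; [|by []|by rewrite (Fv vDONE isT)|by rewrite (Fv vNL isT)|by split].
split.
- by rewrite (Fv vN isT).
- rewrite /arcs i0 mul2n -addnn iotaD map_cat /arcl add0n; congr (_ ++ _).
    rewrite -[RHS](mkseq_nth (0, 0)); apply/eq_in_map => i; rewrite mem_iota => /i1 [-> ->].
    by rewrite -surjective_pairing.
  rewrite -{1}[size s]addn0 iotaDl -map_comp -[in RHS](mkseq_nth (0, 0) s) -map_comp.
  by apply/eq_in_map => i; rewrite mem_iota => /i2 /= [-> ->].
- by rewrite K0.
- by rewrite K0.
- by move=> v; rewrite K0 Z.
Qed.

End Graph.

(** * Local distances *)

Section Walks.
Variables (n : nat) (s : seq (nat * nat)) (K : seq nat) (lab : nat -> nat).
Hypothesis Hs : valid_graph n s.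
Let E := adj s.
Let out (v : nat) := v \notin K.

Definition lwalk (x : nat) (q : seq nat) (v : nat) : Prop :=
  [/\ path E x q, last x q = v & all out (behead (belast x q))].

Lemma lwalk_rcons x q v w : lwalk x (rcons q v) w <->
  [/\ path E x q, E (last x q) v, all out q & v = w].
Proof.
rewrite /lwalk rcons_path last_rcons belast_rcons /=; split.
  by case=> /andP [h1 h2] h3 h4; split.
by case=> h1 h2 h3 h4; split=> //; apply/andP.
Qed.

Lemma lwalk_prefix x q : path E x q -> all out q -> lwalk x q (last x q).
Proof.
move=> h1 h2; split=> //; case/lastP: q h1 h2 => // q y _.
by rewrite all_rcons belast_rcons => /andP [_].
Qed.

Lemma lwalk_ext x q u w : lwalk x q u -> E u w -> q = [::] \/ out u ->
  lwalk x (rcons q w) w.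
Proof.
move=> [h1 h2 h3] uw ou; apply/lwalk_rcons; rewrite h2; split=> //.
case: ou => [->//|ou]; case/lastP: q h1 h2 h3 => // q y _.
by rewrite last_rcons belast_rcons all_rcons => -> /= ->; rewrite ou.
Qed.

Definition layers_spec (x : nat) (l : nat -> nat) : Prop :=
  [/\ forall v, v < n -> l v <= 5,
      forall v d, v < n -> l v = d.+1 -> exists2 q, lwalk x q v & size q = d,
      forall q v, lwalk x q v -> size q <= 4 -> 0 < l v <= (size q).+1
    & forall v, v < n -> (l v == 1) = (v == x)].

Hypothesis cert1 : forall u w, E u w -> out u -> out w -> lab u = lab w.
Hypothesis cert2 : forall u w, u < n -> w < n -> lab u = lab w ->
  [\/ u = w, [/\ E u w, out u & out w]
    | exists c, [/\ E u c, E c w, out u, out w & out c]].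

Lemma path_lab a q : path E a q -> out a -> all out q -> lab (last a q) = lab a.
Proof.
elim: q a => //= b q IH a /andP [ab pq] oa /andP [ob oq].
by rewrite IH // -(cert1 ab).
Qed.

Lemma shortcut x q v : lwalk x q v ->
  exists q', [/\ lwalk x q' v, size q' <= size q, size q' <= 4
    & x != v -> out v -> size q' <= 3].
Proof.
case/lastP: q => [[_ <- _]|q v']; first by exists [::]; split=> //; rewrite ?eqxx.
move=> W; have /lwalk_rcons [pq lv oq ev] := W; rewrite {v'}ev in W lv *.
case: q W pq lv oq => [|a q] W.
  by move=> _ _ _; exists [:: v]; split.
rewrite /= => /andP [xa pq] lv /andP [oa oq]; set b := last a q in lv.
have ob : out b.
  by rewrite /b; have := mem_last a q; rewrite inE => /orP [/eqP ->//|/(allP oq)].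
have an : a < n := adj_lt2 Hs xa.
have bn : b < n := adj_lt Hs lv.
have vn : v < n := adj_lt2 Hs lv.
case: (boolP (out v)) => ov; last first.
  case: (leqP (size (rcons (a :: q) v)) 4) => sz.
    by exists (rcons (a :: q) v); split.
  have Lab : lab a = lab b by rewrite /b path_lab.
  move: sz; rewrite size_rcons /= => sz.
  case: (cert2 an bn Lab) => [ab|[ab _ _]|[c [ac cb _ _ oc]]].
  - exists [:: a; v]; split=> //=; try by rewrite size_rcons; clear -sz; lia.
    by apply/(lwalk_rcons _ [:: a]); split=> //=; rewrite ?xa ?oa // ab.
  - exists [:: a; b; v]; split=> //=; try by rewrite size_rcons; clear -sz; lia.
    by apply/(lwalk_rcons _ [:: a; b]); split=> //=; rewrite ?xa ?oa ?ab ?ob.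
  - exists [:: a; c; b; v]; split=> //=; try by rewrite size_rcons; clear -sz; lia.
    by apply/(lwalk_rcons _ [:: a; c; b]); split=> //=; rewrite ?xa ?ac ?oa ?cb ?ob ?oc.
have Lab : lab a = lab v by rewrite -(cert1 lv) // /b path_lab.
case: (leqP (size (rcons (a :: q) v)) 3) => sz.
  by exists (rcons (a :: q) v); split=> //; lia.
move: sz; rewrite size_rcons /= => sz.
case: (cert2 an vn Lab) => [av|[av _ _]|[c [ac cv _ _ oc]]].
- exists [:: v]; split=> //=; try by rewrite size_rcons; clear -sz; lia.
  by apply/(lwalk_rcons _ [::]); split=> //=; rewrite -av.
- exists [:: a; v]; split=> //=; try by rewrite size_rcons; clear -sz; lia.
  by apply/(lwalk_rcons _ [:: a]); split=> //=; rewrite ?xa ?oa.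
- exists [:: a; c; v]; split=> //=; try by rewrite size_rcons; clear -sz; lia.
  by apply/(lwalk_rcons _ [:: a; c]); split=> //=; rewrite ?xa ?ac ?oa ?oc.
Qed.

Lemma layers_le x l q v : layers_spec x l -> lwalk x q v ->
  0 < l v <= (size q).+1.
Proof.
move=> [_ _ H _] /shortcut [q' [W sz s4 _]]; have := H _ _ W s4; lia.
Qed.

Lemma layers_out x l v : x < n -> layers_spec x l -> v < n -> x \in K -> out v ->
  l v <= 4 /\ l v != 1.
Proof.
move=> xn [H0 H1 H2 H3] vn xK ov.
have nxv : x != v by apply: contraTneq xK => ->.
split; last by rewrite H3 // eq_sym.
case E0 : (l v) => [//|d]; have [q W _] := H1 _ _ vn E0.
have [q' [W' _ s4 s3]] := shortcut W.
by have := H2 _ _ W' s4; have := s3 nxv ov; rewrite E0; lia.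
Qed.

End Walks.

Lemma layer_cond a r b c :
  ((1 - (a - (r + 1) + (r + 1 - a))) * (1 - b + (1 - r)) * (1 - c) == 0) =
  ~~ [&& a == r.+1, (b == 0) || (r == 0) & c == 0].
Proof. by rewrite !muln_eq0 !addn_eq0; lia. Qed.

Section Layers.
Variables (n : nat) (s : seq (nat * nat)) (st : store) (x : nat).
Hypothesis Hs : valid_graph n s.
Hypothesis C : cst n s st.
Let K := Klist st.
Let E := adj s.
Hypothesis Ex : var st vX = x.
Hypothesis xn : x < n.

Lemma arc_ex u w : E u w -> exists2 i, i < var st vM2 & arr st aSRC i = u /\ arr st aDST i = w.
Proof.
rewrite /E -mem_arcl; case: C => _ <- _ _ _ /mapP [i]; rewrite mem_iota => im [-> ->].
by exists i.
Qed.

Lemma arc_adj i : i < var st vM2 -> E (arr st aSRC i) (arr st aDST i).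
Proof.
move=> im; rewrite /E -mem_arcl; case: C => _ <- _ _ _; apply/mapP; exists i => //.
by rewrite mem_iota.
Qed.

Definition layer_inv (r : nat) (l : nat -> nat) : Prop :=
  [/\ forall v, v < n -> l v <= r.+1,
      forall v d, v < n -> l v = d.+1 -> exists2 q, lwalk s K x q v & size q = d,
      forall q v, lwalk s K x q v -> size q <= r -> 0 < l v <= (size q).+1
    & forall v, v < n -> (l v == 1) = (v == x)].

Definition layer_body : cmd :=
  vU <~ Rd aSRC $vI ;; vW <~ Rd aDST $vI ;;
      If (Mul (Mul (neg (ne (Rd aLL $vU) (Add $vR (Num 1))))
                   (Add (neg (Rd aINK $vU)) (neg $vR)))
              (neg (Rd aLL $vW)))
         (St aLL $vW (Add $vR (Num 2))) Skip.

Lemma layer_step r st1 : var st1 vR = r -> var st1 vM2 = var st vM2 ->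
  (forall A, A != aLL -> arr st1 A = arr st A) ->
  layer_inv r (arr st1 aLL) -> layer_inv r.+1 (arr (run (For vI $vM2 layer_body) st1) aLL).
Proof.
move=> Er Em Ea [i1 i2 i3 i4]; set l := arr st1 aLL in i1 i2 i3 i4.
pose I i s' := let l' := arr s' aLL in
  [/\ forall v, v < n -> l v != 0 -> l' v = l v,
      forall v, v < n -> l v = 0 -> l' v = 0 \/
        (l' v = r.+2 /\ exists2 q, lwalk s K x q v & size q = r.+1)
    & forall j, j < i -> l (arr st aSRC j) = r.+1 ->
        (arr st aSRC j \notin K \/ r = 0) -> l' (arr st aDST j) != 0].
have [] : I (var st vM2) (run (For vI $vM2 layer_body) st1).
  rewrite -Em; apply: (@for_ind I vI (Var vM2)); first by split; auto.
  move=> i s'; rewrite [ev _ _]/= Em => im [Fv Fa] [h1 h2 h3].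
  have uw := arc_adj im; have un := adj_lt Hs uw; have wn := adj_lt2 Hs uw.
  rewrite /I /layer_body /= /upd /= (Fa aSRC isT) (Fa aDST isT) (Fa aINK isT) (Fv vR isT) Er.
  rewrite !Ea //; set u := arr st aSRC i in uw un *; set w := arr st aDST i in uw wn *.
  have eu : (arr s' aLL u == r.+1) = (l u == r.+1).
    case: (eqVneq (l u) 0) => [lu|lu]; last by rewrite h1.
    by case: (h2 u un lu) => [->|[-> _]]; rewrite lu; lia.
  have eK : (arr st aINK u == 0) = (u \notin K) by case: C => _ _ _ _ <-; rewrite negbK.
  rewrite layer_cond eu eK.
  case: and3P => /= [[/eqP lu ku /eqP lw]|nc].
    have lw0 : l w = 0.
      by apply/eqP/negP => /negP lw0; rewrite h1 // in lw; rewrite lw in lw0.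
    split=> [v vn lv|v vn lv|j].
    - by rewrite /upd ifF ?h1 //; apply/eqP => E'; rewrite E' lw0 in lv.
    - rewrite /upd; case: eqP => [->|_]; last exact: h2.
      right; split; first by lia.
      have [q W sz] := i2 _ _ un lu; exists (rcons q w); last by rewrite size_rcons sz.
      apply: lwalk_ext W uw _; case/orP: ku => [|/eqP r0]; first by right.
      by left; apply/size0nil; rewrite sz.
    - rewrite ltnS leq_eqVlt /upd => /orP [/eqP ->|ji] h4 h5; first by rewrite eqxx; lia.
      by case: (arr st aDST j == w); [lia|apply: h3].
  split=> // j; rewrite ltnS leq_eqVlt => /orP [/eqP ->|ji] h4 h5; last exact: h3.
  apply/eqP => lw; apply: nc; split; rewrite ?h4 ?lw //.
  by case: h5 => [->//|->]; rewrite eqxx orbT.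
set l' := arr (run _ _) aLL; move=> h1 h2 h3; split.
- move=> v vn; case: (eqVneq (l v) 0) => lv; last by rewrite h1 // ltnW // ltnS i1.
  by case: (h2 v vn lv) => [->|[-> _]].
- move=> v d vn; case: (eqVneq (l v) 0) => lv; last by rewrite h1 //; apply: i2.
  by case: (h2 v vn lv) => [->//|[-> W] [<-]].
- have keep q v : lwalk s K x q v -> v < n -> size q <= r -> 0 < l' v <= (size q).+1.
    move=> W vn sz; have := i3 _ _ W sz => lv; rewrite h1 //; lia.
  case/lastP=> [|q w] v W; first by move=> _; apply: keep => //; case: W => _ <- _.
  rewrite size_rcons ltnS => sz; have /lwalk_rcons [pq lw oq ew] := W; subst v.
  have un := adj_lt Hs lw; have wn := adj_lt2 Hs lw.
  have W' := lwalk_prefix pq oq; set u := last x q in lw W' un.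
  have ou : q = [::] \/ u \notin K.
    rewrite /u; case/lastP: q oq {W pq lw W' sz u un} => [|q y]; first by left.
    by rewrite all_rcons last_rcons => /andP [h _]; right.
  have lu := i3 _ _ W' sz.
  case: (ltnP (l u) (size q).+1) => lt.
    case El : (l u) lu => [//|d] _; have [q2 W2 s2] := i2 _ _ un El.
    have W3 : lwalk s K x (rcons q2 w) w.
      apply: lwalk_ext W2 lw _; case: ou => [q0|]; last by right.
      by rewrite q0 /= in lt; rewrite El in lt.
    by have := keep _ _ W3 wn; rewrite size_rcons s2; lia.
  have Elu : l u = (size q).+1 by lia.
  case: (eqVneq (size q) r) => [Er'|nr]; last first.
    by have := keep _ _ W wn; rewrite size_rcons; lia.
  have [j jm [eu ew]] := arc_ex lw.
  have := h3 j jm; rewrite eu ew Elu Er' => /(_ erefl) H.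
  have lw' : l' w != 0.
    by apply: H; case: ou => [q0|]; [right; rewrite -Er' q0|left].
  rewrite lt0n lw' /=.
  case: (eqVneq (l w) 0) => lv; last by rewrite h1 // ltnW // ltnS i1.
  by case: (h2 w wn lv) => [->|[-> _]].
- move=> v vn; case: (eqVneq (l v) 0) => lv; last by rewrite h1 // i4.
  rewrite -i4 //; case: (h2 v vn lv) => [->|[-> _]]; by rewrite lv.
Qed.

Lemma layers_ok : layers_spec n s K x (arr (run layers_c st) aLL).
Proof.
rewrite /layers_c 2!run_seq.
set s1 := run (vfor _) st.
have Z1 v : v < n -> arr s1 aLL v = 0.
  have eN : var st vN = n by case: C.
  have : forall v, v < var st vN -> arr s1 aLL v = 0.
    apply: (@vfor_ind (fun k s' => forall v, v < k -> arr s' aLL v = 0)) => //.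
    move=> k s' _ _ IH y; rewrite ltnS leq_eqVlt /= /upd.
    by case: eqP => //= _ yk; apply: IH.
  by rewrite eN; apply.
set s2 := run (St _ _ _) s1.
have S1 := run_same (vfor (St aLL $vV (Num 0))) st; rewrite -/s1 in S1.
have S2 := run_same (St aLL $vX (Num 1)) s1; rewrite -/s2 in S2.
have L2 v : v < n -> arr s2 aLL v = (v == x).
  move=> vn; rewrite /s2 /= /upd; case: S1 => + _ => -> //; rewrite Ex.
  by case: eqP => // _; rewrite Z1.
have A2 A : A != aLL -> arr s2 A = arr st A.
  move=> hA; case: S2 => _ -> //; last by rewrite inE.
  by case: S1 => _ -> //; rewrite inE.
have M2 : var s2 vM2 = var st vM2.
  by case: S2 => -> // _; case: S1 => ->.
clearbody s2; rewrite -/layer_body.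
apply: (@for_ind (fun r s' => layer_inv r (arr s' aLL))).
  split.
  - by move=> v vn; rewrite L2 //; case: (v == x).
  - move=> v d vn; rewrite L2 //; case: eqP => // -> [<-].
    by exists [::].
  - by move=> [|y q] v // [_ /= <- _] _; rewrite L2 // eqxx.
  - by move=> v vn; rewrite L2 //; case: (v == x).
move=> r s' _ [Fv Fa] H; apply: layer_step => //.
- by rewrite /= /upd /= Fv.
- by move=> A hA; rewrite /= Fa ?A2 // /= inE.
Qed.

End Layers.

(** * Classes of vertices *)

(* [n] stands for infinity, as distances in a connected graph are below [n]. *)
Definition dval (n d : nat) : nat := if d == 0 then n else d - 1.

Lemma key_inj n j a b c d : c <= 5 -> d <= 5 ->
  6 * (j * n + a) + c = 6 * (j * n + b) + d -> a = b /\ c = d.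
Proof. lia. Qed.

Lemma classes_ok n j st : let l := arr st aLL in let node := arr st aND in
  var st vN = n -> var st vJ = j ->
  (forall v, v < n -> l v <= 5) -> (forall v, v < n -> node v < n) ->
  (forall i, 6 * (j * n) <= i -> arr st aCH i = 0) ->
  let st' := run classes_c st in
  [/\ forall v, v < n -> arr st' aTT (j * n + v) = dval n (l v),
      forall i, i < j * n -> arr st' aTT i = arr st aTT i,
      forall v, v < n -> [/\ arr st' aND v < n, node (arr st' aND v) = node v
                           & l (arr st' aND v) = l v],
      forall u v, u < n -> v < n -> node u = node v -> l u = l v ->
        arr st' aND u = arr st' aND v
    & forall i, 6 * (j.+1 * n) <= i -> arr st' aCH i = 0].
Proof.
move=> l node eN eJ l5 noden Z; cbv zeta.
pose key w := 6 * (j * n + node w) + l w.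
pose I k s' :=
  [/\ forall v, v < k -> arr s' aTT (j * n + v) = dval n (l v),
      forall i, i < j * n -> arr s' aTT i = arr st aTT i,
      forall v, v < n -> arr s' aND v = if v < k then arr s' aCH (key v) - 1 else node v,
      forall v, v < k -> arr s' aCH (key v) != 0
    & forall i, 6 * (j * n) <= i -> arr s' aCH i != 0 ->
        exists w, [/\ w < k, w < n, i = key w & arr s' aCH i = w.+1]].
have : I n (run classes_c st).
  rewrite -eN; apply: (@vfor_ind I).
    by split=> // i; move/Z => ->.
  move=> k s'; rewrite eN => kn [Fv Fa] [i1 i2 i3 i4 i5].
  have ek : arr s' aND k = node k by rewrite i3 // ltnn.
  have kk : 6 * (j * n + node k) + l k = key k by [].
  have stage1 : let s1 := run (If (Rd aLL $vV) (St aTT (row $vJ $vV) (Sub (Rd aLL $vV) (Num 1)))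
           (St aTT (row $vJ $vV) $vN)) (setv s' vV k) in
      [/\ arr s1 aTT (j * n + k) = dval n (l k),
          forall i, i != j * n + k -> arr s1 aTT i = arr s' aTT i,
          forall A, A != aTT -> arr s1 A = arr s' A,
          var s1 vV = k & forall x, x != vV -> var s1 x = var s' x].
    rewrite /= /upd /= (Fa aLL isT) (Fv vJ isT) eJ (Fv vN isT) eN -/l /dval.
    case: eqVneq => lk /=; rewrite /upd.
      split=> [|i|A|//|x]; rewrite ?eqxx // => /negbTE -> //.
    split=> [|i|A|//|x]; rewrite ?eqxx // => /negbTE -> //.
  rewrite run_seq; move: stage1.
  have [s1 E1] := ex_eq (run (If (Rd aLL $vV) (St aTT (row $vJ $vV) (Sub (Rd aLL $vV) (Num 1)))
           (St aTT (row $vJ $vV) $vN)) (setv s' vV k)).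
  rewrite -E1; cbv zeta => -[t1 t2 t3 t4 t5].
  rewrite run_seq.
  have stage2 : let s2 := run (If (Rd aCH keyE) Skip (St aCH keyE (Add $vV (Num 1)))) s1 in
      [/\ arr s2 aCH = (if arr s' aCH (key k) == 0 then upd (arr s' aCH) (key k) k.+1 else arr s' aCH),
        forall A, A != aCH -> arr s2 A = arr s1 A & var s2 = var s1].
    rewrite /= t4 !t3 // (t5 vJ isT) (t5 vN isT) (Fv vJ isT) (Fv vN isT) eJ eN.
    rewrite ek (Fa aLL isT) -/l kk addn1.
    by case: eqVneq => c0 /=; rewrite ?t3 //; split=> // A /negbTE ->.
  move: stage2.
  have [s2 E2] := ex_eq (run (If (Rd aCH keyE) Skip (St aCH keyE (Add $vV (Num 1)))) s1).
  rewrite -E2; cbv zeta => -[c1 c2 c3].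
  rewrite /I /= c3 t4 (t5 vJ isT) (t5 vN isT) (Fv vJ isT) (Fv vN isT) eJ eN.
  rewrite !(c2 aTT isT) !(c2 aND isT) !(c2 aLL isT) !(t3 aND isT) !(t3 aLL isT).
  rewrite ek (Fa aLL isT) -/l kk.
  have keyP w : w < n -> 6 * (j * n) <= key w by rewrite /key; lia.
  have keep i : arr s' aCH i != 0 -> arr s2 aCH i = arr s' aCH i.
    rewrite c1; case: (eqVneq (arr s' aCH (key k)) 0) => // e0 ei.
    by rewrite /upd; case: (eqVneq i (key k)) ei => [->|] //; rewrite e0.
  have nz : arr s2 aCH (key k) != 0.
    by rewrite c1; case: (eqVneq (arr s' aCH (key k)) 0) => // e0; rewrite /upd eqxx.
  split.
  - move=> v; rewrite ltnS leq_eqVlt => /orP [/eqP -> //|vk].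
    by rewrite t2 ?i1 //; lia.
  - by move=> i ij; rewrite t2 ?i2 //; lia.
  - move=> v vn; rewrite /upd ltnS leq_eqVlt.
    case: (eqVneq v k) => [-> //|nvk] /=; rewrite i3 //.
    by case: ltnP => // vk; rewrite keep // i4.
  - move=> v; rewrite ltnS leq_eqVlt => /orP [/eqP -> //|vk].
    by rewrite keep i4.
  - move=> i ij; case: (eqVneq (arr s' aCH i) 0) => ci.
      rewrite c1; case: (eqVneq (arr s' aCH (key k)) 0) => e0; last by rewrite ci.
      rewrite /upd; case: (eqVneq i (key k)) => [-> _|_]; last by rewrite ci.
      by exists k; split.
    rewrite keep // => _; have [w [wk wn ew cw]] := i5 i ij ci.
    by exists w; split=> //; apply: ltnW.
have [s' E'] := ex_eq (run classes_c st); rewrite -E' => -[i1 i2 i3 i4 i5].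
have keyP w : w < n -> 6 * (j * n) <= key w by rewrite /key; lia.
have nd v : v < n -> arr s' aND v = arr s' aCH (key v) - 1 by move=> vn; rewrite i3 // vn.
split=> //.
- move=> v vn; have [w [_ wn ew cw]] := i5 _ (keyP v vn) (i4 v vn).
  have [e1 e2] := key_inj (l5 v vn) (l5 w wn) ew.
  by rewrite nd // cw subn1 /=.
- move=> u v un vn e1 e2; rewrite !nd // /key.
  by rewrite e1 e2.
- move=> i hi; apply/eqP; apply: contraT => ci.
  have hi' : 6 * (j * n) <= i by apply: leq_trans hi; rewrite leq_mul2l leq_mul2r leqnSn orbT.
  have [w [_ wn ew cw]] := i5 i hi' ci.
  have h5 := l5 w wn; have nw := noden w wn.
  move: hi; rewrite ew /key mulSn; lia.
Qed.

Section Types.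
Variables (n : nat) (s : seq (nat * nat)).
Hypothesis Hs : valid_graph n s.

Definition types_spec (K : seq nat) (st : store) (ll : nat -> nat -> nat) : Prop :=
  [/\ forall j, j < size K -> layers_spec n s K (nth 0 K j) (ll j),
      forall j v, j < size K -> v < n -> arr st aTT (j * n + v) = dval n (ll j v),
      forall v, v < n -> arr st aND v < n,
      forall j v, j < size K -> v < n -> ll j (arr st aND v) = ll j v
    & forall u v, u < n -> v < n -> (forall j, j < size K -> ll j u = ll j v) ->
        arr st aND u = arr st aND v].

Lemma types_ok st : 0 < n -> cst n s st ->
  (forall i, arr st aND i = 0) -> (forall i, arr st aCH i = 0) ->
  exists ll, types_spec (Klist st) (run types_c st) ll.
Proof.
move=> n0 C ND0 CH0; set K := Klist st.
have eK j : j < size K -> nth 0 K j = arr st aKL j.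
  by rewrite Klist_size => jk; rewrite (nth_map 0) ?size_iota // nth_iota.
pose I k s' := exists ll,
  [/\ forall j, j < k -> layers_spec n s K (nth 0 K j) (ll j) /\
        forall v, v < n -> arr s' aTT (j * n + v) = dval n (ll j v),
      forall v, v < n -> arr s' aND v < n,
      forall j v, j < k -> v < n -> ll j (arr s' aND v) = ll j v,
      forall u v, u < n -> v < n -> (forall j, j < k -> ll j u = ll j v) ->
        arr s' aND u = arr s' aND v
    & forall i, 6 * (k * n) <= i -> arr s' aCH i = 0].
suff : I (size K) (run types_c st).
  case=> ll [h1 h2 h3 h4 _]; exists ll; split=> //.
  - by move=> j /h1 [].
  - by move=> j v /h1 [_ h] /h.
rewrite Klist_size; apply: (@for_ind I vJ (Var vKK)).
  by exists (fun _ _ => 0); split=> // *; rewrite ?ND0.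
move=> k s'; rewrite [ev _ _]/= => kK [Fv Fa] [ll [h1 h2 h3 h4 h5]].
rewrite 2!run_seq.
set s1 := run (vX <~ _) _.
have [C1 K1] : cst n s s1 /\ Klist s1 = K.
  have e3 : arr s1 = arr s' by [].
  have e4 x : x \in [:: vN; vM2; vKK] -> var s1 x = var st x.
    by rewrite !inE => /or3P [] /eqP ->; rewrite /s1 /= /upd /= Fv.
  have e5 A : A \in [:: aSRC; aDST; aINK; aKL] -> arr s1 A = arr st A.
    by rewrite e3 !inE => /or4P [] /eqP ->; apply: Fa.
  case: C => c1 c2 c3 c4 c5.
  have eKK : Klist s1 = Klist st by rewrite /Klist e4 // e5.
  split=> //; split; rewrite ?eKK ?e4 // ?e5 //.
  by rewrite /arcs e4 // !e5.
have X1 : var s1 vX = nth 0 K k.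
  by rewrite /s1 /= /upd /= eK ?Klist_size // Fa.
have J1 : var s1 vJ = k by [].
have a1 : arr s1 = arr s' by [].
have [s2 E2] : exists s2, s2 = s1 by exists s1.
rewrite -/s1 -E2 in C1 K1 X1 J1 a1 *; clear E2.
have xn : nth 0 K k < n.
  by case: C => _ _ _ /allP aK _; apply: aK; apply: mem_nth; rewrite Klist_size.
have LS := layers_ok Hs C1 X1 xn; rewrite K1 in LS.
have [Fv2 Fa2] := run_same layers_c s2.
have [s3 E3] := ex_eq (run layers_c s2); rewrite -E3 in LS Fv2 Fa2 *.
have eN3 : var s3 vN = n by rewrite (Fv2 vN isT); case: C1.
have eJ3 : var s3 vJ = k by rewrite (Fv2 vJ isT).
have eT : arr s3 aTT = arr s' aTT by rewrite (Fa2 aTT isT) a1.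
have eD : arr s3 aND = arr s' aND by rewrite (Fa2 aND isT) a1.
have eC : arr s3 aCH = arr s' aCH by rewrite (Fa2 aCH isT) a1.
have := @classes_ok n k s3; cbv zeta; rewrite eT eD eC.
move=> /(_ eN3 eJ3 _ h2 h5) [|g1 g2 g3 g4 g5]; first by case: LS.
set l := arr s3 aLL in LS g1 g3 g4.
exists (fun i => if i == k then l else ll i); split=> //.
- move=> j; rewrite ltnS leq_eqVlt; case: eqVneq => [-> _|njk] /=; first by split.
  move=> jk; have [q1 q2] := h1 j jk; split=> // v vn.
  rewrite g2 ?q2 //.
  have : j.+1 * n <= k * n by rewrite leq_mul2r jk orbT.
  rewrite mulSn; lia.
- by move=> v /g3 [].
- move=> j v; rewrite ltnS leq_eqVlt; case: eqVneq => [-> _|njk] /=.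
    by move=> /g3 [].
  by move=> jk vn; have [q1 q2 q3] := g3 v vn; rewrite -[LHS]h3 // q2 h3.
- move=> u v un vn H; apply: g4 => //.
    apply: h4 => // j jk; have := H j (ltnW jk).
    by rewrite ifF //; apply/eqP => jk'; rewrite jk' ltnn in jk.
  by have := H k (ltnSn k); rewrite eqxx.
Qed.

End Types.

(** * Distances through the deletion set *)

Section Walks.
Variables (n : nat) (s : seq (nat * nat)).
Hypothesis Hs : valid_graph n s.
Hypothesis Hc : connected_graph n s.
Let E := adj s.

Definition inner (a : nat) (q : seq nat) := behead (belast a q).

Lemma inner_rcons a q v : inner a (rcons q v) = q.
Proof. by rewrite /inner belast_rcons. Qed.

Lemma path_lt a q : a < n -> path E a q -> all (fun v => v < n) (a :: q).
Proof.
elim: q a => [|b q IH] a an /=; first by rewrite an.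
by move=> /andP [ab pq]; rewrite an; exact: (IH b (adj_lt2 Hs ab) pq).
Qed.

Lemma walk_lt x v : x < n -> v < n -> exists p, walk s x v p /\ size p < n.
Proof.
move=> xn vn; have [p [pp lp]] := Hc xn vn.
case/shortenP: pp lp => p' pp' up' _ lp; exists p'; split; first by split.
have : size (x :: p') <= size (iota 0 n).
  apply: uniq_leq_size => // y /(allP (path_lt xn pp')); rewrite mem_iota; lia.
by rewrite size_iota.
Qed.

Lemma rev_walk x v p : walk s x v p -> exists2 p', walk s v x p' & size p' = size p.
Proof.
move=> [pp lp]; exists (rev (belast x p)); last by rewrite size_rev size_belast.
split; first by rewrite -lp rev_path; apply: sub_path pp => a b; rewrite /E adj_sym.
by case: p pp lp => [|b p] //= _ <-; rewrite rev_cons last_rcons.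
Qed.

Lemma cat_walk x y v p q : walk s x y p -> walk s y v q -> walk s x v (p ++ q).
Proof. by move=> [pp lp] [pq lq]; split; rewrite ?cat_path ?last_cat lp ?pp. Qed.

Lemma inner_split a v q x : walk s a v q -> x \in inner a q ->
  exists q1 q2, [/\ walk s a x q1, walk s x v q2, size q1 + size q2 = size q,
    size q1 < size q /\ size q2 < size q
    & {subset inner a q1 <= inner a q} /\ {subset inner x q2 <= inner a q}].
Proof.
case/lastP: q => // q v' [pq]; rewrite last_rcons inner_rcons => ev xq; subst v'.
case/splitPr: xq pq => p1 p2; rewrite rcons_path cat_path last_cat /=.
move=> /andP [/andP [pp1 /andP [ax pp2]] lv].
exists (rcons p1 x), (rcons p2 v); split.
- by split; rewrite ?last_rcons // rcons_path; apply/andP.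
- by split; rewrite ?last_rcons // rcons_path; apply/andP.
- by rewrite !size_rcons size_cat /=; lia.
- by rewrite !size_rcons size_cat /=; lia.
- rewrite !inner_rcons; split=> y yp; rewrite mem_cat; first by rewrite yp.
  by rewrite inE yp !orbT.
Qed.

Variables (K : seq nat) (lab : nat -> nat) (ll : nat -> nat -> nat).
Let out (v : nat) := v \notin K.
Let kk := size K.
Let X j := nth 0 K j.
Hypothesis Kn : all (fun v => v < n) K.
Hypothesis cert1 : forall u w, E u w -> out u -> out w -> lab u = lab w.
Hypothesis cert2 : forall u w, u < n -> w < n -> lab u = lab w ->
  [\/ u = w, [/\ E u w, out u & out w]
    | exists c, [/\ E u c, E c w, out u, out w & out c]].
Hypothesis LS : forall j, j < kk -> layers_spec n s K (X j) (ll j).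

Lemma X_lt j : j < kk -> X j < n.
Proof. by move=> jk; apply: (allP Kn); apply: mem_nth. Qed.

Lemma X_ex z : z \in K -> exists2 j, j < kk & X j = z.
Proof. by move=> zK; exists (index z K); rewrite ?index_mem // /X nth_index. Qed.

Lemma lwalk_walk a q v : lwalk s K a q v -> walk s a v q.
Proof. by case. Qed.

Lemma lwalk_last a q : path E a q -> a \in K ->
  exists z q1 q2, [/\ z \in K, walk s a z q1, lwalk s K z q2 (last a q)
    & size q1 + size q2 = size q].
Proof.
elim/last_ind: q => [|q w IH]; first by exists a, [::], [::].
rewrite rcons_path last_rcons => /andP [pq lw] aK.
have [z [q1 [q2 [zK w1 w2 sz]]]] := IH pq aK.
case: (boolP (out (last a q))) => o.
  exists z, q1, (rcons q2 w); split=> //; last by rewrite !size_rcons -sz addnS.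
  by apply: lwalk_ext w2 lw _; right.
rewrite negbK in o; exists (last a q), q, [:: w]; split=> //.
  by apply: (lwalk_ext (q := [::])) lw _ => //; left.
by rewrite size_rcons addn1.
Qed.

Lemma transfer u a y q : u < n -> a < n -> (forall j, j < kk -> ll j u = ll j a) ->
  y < kk -> walk s (X y) u q -> exists2 q', walk s (X y) a q' & size q' <= size q.
Proof.
move=> un an H yk [pq lq].
have [z [q1 [q2 [zK w1 w2 sz]]]] := lwalk_last pq (mem_nth 0 yk).
rewrite lq in w2; have [j jk ez] := X_ex zK; rewrite -ez in w1 w2.
have := layers_le Hs cert1 cert2 (LS jk) w2; rewrite (H j jk).
case El : (ll j a) => [|d] // le.
have [_ H1 _ _] := LS jk; have [q3 w3 s3] := H1 a d an El.
exists (q1 ++ q3); first exact: cat_walk w1 (lwalk_walk w3).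
by rewrite size_cat; lia.
Qed.

Lemma lab_walk u v p : walk s u v p -> lab u != lab v ->
  exists y p1 p2, [/\ y < kk, walk s (X y) u p1, walk s (X y) v p2
    & size p1 + size p2 = size p].
Proof.
move=> [pp lp] nl; case: (boolP (has (mem K) (u :: p))) => [/hasP [z]|]; last first.
  move=> /hasPn H; case/eqP: nl; rewrite -lp; apply/esym.
  apply: (path_lab cert1 pp); first by apply: H; rewrite mem_head.
  by apply/allP => w wp; apply: H; rewrite inE wp orbT.
move=> zp zK; have [j jk ez] := X_ex zK.
case/splitPl: zp pp lp => p1 p2 l1; rewrite cat_path last_cat l1 => /andP [pp1 pp2] l2.
have [p3 w3 s3] := @rev_walk u z p1 (conj pp1 l1).
by exists j, p3, p2; rewrite ez size_cat s3; split.
Qed.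

Definition sound (T : nat -> nat -> nat) : Prop :=
  forall y v, y < kk -> v < n -> exists2 q, walk s (X y) v q & size q <= T y v.

Definition below (z a : nat) : bool := (a \notin K) || (index a K < z).

Definition upper (R : seq nat) (z : nat) (T : nat -> nat -> nat) : Prop :=
  forall y v q, y < kk -> v \in R -> walk s (X y) v q ->
    all (below z) (inner (X y) q) -> T y v <= size q.

Lemma sound0 T : (forall y v, y < kk -> v < n -> T y v = dval n (ll y v)) -> sound T.
Proof.
move=> H y v yk vn; rewrite H // /dval; case: eqVneq => [_|l0].
  by have [p [wp sp]] := walk_lt (X_lt yk) vn; exists p => //; apply: ltnW.
have [_ H1 _ _] := LS yk; have [|q w sz] := H1 v (ll y v).-1 vn; first by lia.
by exists q; [exact: lwalk_walk w|lia].
Qed.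

Lemma upper0 R T : (forall y v, y < kk -> v < n -> T y v = dval n (ll y v)) ->
  {subset R <= gtn n} -> upper R 0 T.
Proof.
move=> H Rn y v q yk vR [pq lq] bq; rewrite H //; last exact: Rn.
have W : lwalk s K (X y) q v.
  by split=> //; apply: sub_all bq => w; rewrite /below ltn0 orbF.
have := layers_le Hs cert1 cert2 (LS yk) W; rewrite /dval.
by case: eqVneq => [->//|_]; lia.
Qed.

Lemma upper_step R z T T' : z < kk -> {subset K <= R} -> upper R z T ->
  (forall y v, y < kk -> v \in R -> T' y v <= T y v) ->
  (forall y v, y < kk -> v \in R -> T' y v <= T z v + T y (X z)) ->
  upper R z.+1 T'.
Proof.
move=> zk KR U le1 le2.
have XR : X z \in R by apply: KR; apply: mem_nth.
have belowS a : below z.+1 a -> a != X z -> below z a.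
  rewrite /below ltnS leq_eqVlt => /orP [->//|/orP [/eqP ea|->]]; last by rewrite orbT.
  case: (boolP (a \in K)) => // aK; rewrite /X -ea nth_index // eqxx.
  by [].
have noX y v q : y < kk -> v \in R -> walk s (X y) v q ->
    all (below z.+1) (inner (X y) q) -> X z \notin inner (X y) q -> T y v <= size q.
  move=> yk vR W bq nX; apply: U => //; apply/allP => a aq.
  by apply: belowS; [apply: (allP bq)|apply: contraNneq nX => <-].
have toX y q : y < kk -> walk s (X y) (X z) q ->
    all (below z.+1) (inner (X y) q) -> T y (X z) <= size q.
  move=> yk; have [k] := ubnP (size q); elim: k q => // k IH q qk W bq.
  case: (boolP (X z \in inner (X y) q)) => Xq; last exact: noX.
  have [q1 [q2 [w1 _ _ [lt _] [sub _]]]] := inner_split W Xq.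
  apply: leq_trans (IH q1 _ w1 _) (ltnW lt); first by lia.
  by apply/allP => a /sub; apply: (allP bq).
have fromX v q : v \in R -> walk s (X z) v q ->
    all (below z.+1) (inner (X z) q) -> T z v <= size q.
  move=> vR; have [k] := ubnP (size q); elim: k q => // k IH q qk W bq.
  case: (boolP (X z \in inner (X z) q)) => Xq; last exact: noX.
  have [q1 [q2 [_ w2 _ [_ lt] [_ sub]]]] := inner_split W Xq.
  apply: leq_trans (IH q2 _ w2 _) (ltnW lt); first by lia.
  by apply/allP => a /sub; apply: (allP bq).
move=> y v q yk vR W bq.
case: (boolP (X z \in inner (X y) q)) => Xq; last first.
  by apply: leq_trans (le1 y v yk vR) _; apply: noX.
have [q1 [q2 [w1 w2 <- _ [s1 s2]]]] := inner_split W Xq.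
apply: leq_trans (le2 y v yk vR) _; rewrite addnC; apply: leq_add.
  by apply: toX => //; apply/allP => a /s1; apply: (allP bq).
by apply: fromX => //; apply/allP => a /s2; apply: (allP bq).
Qed.

Lemma upper_all R T y v q : upper R kk T -> y < kk -> v \in R ->
  walk s (X y) v q -> T y v <= size q.
Proof.
move=> U yk vR W; apply: U => //; apply/allP => a _.
by rewrite /below index_mem; case: (a \in K).
Qed.

Fixpoint dmin (T : nat -> nat -> nat) (a b k : nat) : nat :=
  if k is k'.+1 then dmin T a b k' - (dmin T a b k' - (T k' a + T k' b)) else n.

Lemma dmin_le T a b k y : y < k -> dmin T a b k <= T y a + T y b.
Proof. by elim: k => // k IH; rewrite ltnS leq_eqVlt /= => /orP [/eqP ->|/IH]; lia. Qed.

Lemma dmin_in T a b k : dmin T a b k = n \/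
  exists2 y, y < k & dmin T a b k = T y a + T y b.
Proof.
elim: k => [|k [IH|[y yk IH]]]; first by left.
  case: (leqP n (T k a + T k b)) => h; first by left; rewrite /= IH; lia.
  by right; exists k => //=; rewrite IH; lia.
case: (leqP (dmin T a b k) (T k a + T k b)) => h.
  by right; exists y; [exact: ltnW|rewrite /= -IH; lia].
by right; exists k => //=; lia.
Qed.

Lemma dmin_dist R T node u v : sound T -> upper R kk T ->
  u < n -> v < n -> node u \in R -> node v \in R -> {subset R <= gtn n} ->
  (forall j, j < kk -> ll j (node u) = ll j u) ->
  (forall j, j < kk -> ll j (node v) = ll j v) ->
  lab u != lab v -> is_dist s u v (dmin T (node u) (node v) kk).
Proof.
move=> So U un vn uR vR Rn lu lv nl; set D := dmin _ _ _ _.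
have ge p : walk s u v p -> D <= size p.
  move=> W; have [y [p1 [p2 [yk w1 w2 <-]]]] := lab_walk W nl.
  have lu' j : j < kk -> ll j u = ll j (node u) by move=> ?; rewrite lu.
  have lv' j : j < kk -> ll j v = ll j (node v) by move=> ?; rewrite lv.
  have [q1 v1 s1] := transfer un (Rn _ uR) lu' yk w1.
  have [q2 v2 s2] := transfer vn (Rn _ vR) lv' yk w2.
  apply: leq_trans (dmin_le T _ _ yk) _; apply: leq_add.
    exact: leq_trans (upper_all U yk uR v1) s1.
  exact: leq_trans (upper_all U yk vR v2) s2.
split=> //.
have [p0 [w0 s0]] := walk_lt un vn; have ge0 := ge _ w0.
case: (dmin_in T (node u) (node v) kk) => [e|[y yk e]]; rewrite -/D in e; first by lia.
have [q1 v1 s1] := So y _ yk (Rn _ uR); have [q2 v2 s2] := So y _ yk (Rn _ vR).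
have [r1 w1 t1] := transfer (Rn _ uR) un lu yk v1.
have [r2 w2 t2] := transfer (Rn _ vR) vn lv yk v2.
have [r3 w3 t3] := rev_walk w1.
exists (r3 ++ r2); split; first exact: cat_walk w3 w2.
have := ge _ (cat_walk w3 w2); rewrite size_cat; lia.
Qed.

Lemma same_lab_dist u v d : u < n -> v < n -> lab u = lab v -> is_dist s u v d ->
  d <= 2 /\ (d = 2 -> u != v /\ ~~ E u v).
Proof.
move=> un vn Euv [_ le].
case: (eqVneq u v) => [e|nuv].
  by have := le [::] (conj isT e) => /=; case: d {le}.
case: (boolP (E u v)) => euv.
  have := le [:: v]; rewrite /walk /= andbT => /(_ (conj euv erefl)); lia.
split=> //; case: (cert2 un vn Euv) => [e|[e _ _]|[c [uc cv _ _ _]]].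
- by rewrite e eqxx in nuv.
- by rewrite e in euv.
- apply: (le [:: c; v]); split=> //=.
  by rewrite -[adj s u c]/(E u c) -[adj s c v]/(E c v) uc cv.
Qed.

(* Representatives outside [K] have pairwise distinct vectors over the four
   local distances 1, 2, 3 and infinity, encoded by 1, 2, 3 and 0. *)
Lemma reps_size R : uniq R -> {subset R <= gtn n} ->
  {in R &, forall u v, (forall j, j < kk -> ll j u = ll j v) -> u = v} ->
  size R <= 4 ^ kk + kk.
Proof.
move=> uR Rn inj; rewrite -(count_predC (mem K)) addnC; apply: leq_add; last first.
  rewrite -size_filter; apply: uniq_leq_size; first exact: filter_uniq.
  by move=> x; rewrite mem_filter => /andP [].
rewrite -size_filter; set R' := filter _ R.
pose f v : {ffun 'I_kk -> 'I_4} := [ffun j : 'I_kk => inord (ll j v).-1].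
have fi : {in R' &, injective f}.
  move=> u v; rewrite !mem_filter => /andP [ou uR'] /andP [ov vR'] ef.
  apply: inj => // j jk; have := congr1 (fun g : {ffun 'I_kk -> 'I_4} => val (g (Ordinal jk))) ef.
  rewrite !ffunE /=.
  have [u4 u1] := layers_out Hs cert1 cert2 (X_lt jk) (LS jk) (Rn _ uR') (mem_nth 0 jk) ou.
  have [v4 v1] := layers_out Hs cert1 cert2 (X_lt jk) (LS jk) (Rn _ vR') (mem_nth 0 jk) ov.
  rewrite !inordK; lia.
have : uniq (map f R') by rewrite map_inj_in_uniq // filter_uniq.
move=> /card_uniqP; rewrite size_map => <-.
by apply: leq_trans (max_card _) _; rewrite card_ffun !card_ord.
Qed.

End Walks.

Section Count.
Variables (n : nat) (s : seq (nat * nat)).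
Hypothesis Hs : valid_graph n s.

Let pairs := [seq p <- [seq (u, v) | u <- iota 0 n, v <- iota 0 n] | p.1 != p.2].

Lemma mem_pairs u v : ((u, v) \in pairs) = [&& u != v, u < n & v < n].
Proof.
rewrite mem_filter /=; congr (_ && _); apply/allpairsP/andP => [[[a b] /=]|[un vn]].
  by rewrite !mem_iota => -[h1 h2 [-> ->]].
by exists (u, v); rewrite !mem_iota.
Qed.

Lemma uniq_pairs : uniq pairs.
Proof. by rewrite filter_uniq // allpairs_uniq ?iota_uniq // => -[a b] [c d] _ _ /=. Qed.

Lemma size_pairs : size pairs = n * (n - 1).
Proof.
have := count_predC (fun p : nat * nat => p.1 != p.2) [seq (u, v) | u <- iota 0 n, v <- iota 0 n].
rewrite size_allpairs size_iota -size_filter -/pairs => e.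
suff d : count (predC (fun p : nat * nat => p.1 != p.2)) [seq (u, v) | u <- iota 0 n, v <- iota 0 n] = n.
  by rewrite d in e; rewrite mulnBr muln1 -e addnK.
rewrite -size_filter.
transitivity (size [seq (u, u) | u <- iota 0 n]); last by rewrite size_map size_iota.
apply/perm_size/uniq_perm.
- by rewrite filter_uniq // allpairs_uniq ?iota_uniq // => -[a b] [c d] _ _ /=.
- by rewrite map_inj_uniq ?iota_uniq // => a b [].
move=> [u v]; rewrite mem_filter /= negbK; apply/andP/mapP => [[/eqP -> /allpairsP [[a b] /=]]|].
  by rewrite mem_iota => -[h1 h2 [e1 e2]]; exists a; rewrite ?mem_iota ?e2 // -e2 e1.
move=> [a an [-> ->]]; split=> //; apply/allpairsP; by exists (a, a).
Qed.

Lemma incomplete : 2 * size s < n * (n - 1) ->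
  exists u v, [/\ u < n, v < n, u != v & ~~ adj s u v].
Proof.
move=> lt; case: (boolP (has (fun p => ~~ adj s p.1 p.2) pairs)) => [/hasP [[u v]]|/hasPn H].
  by rewrite mem_pairs => /and3P [h1 h2 h3] h4; exists u, v.
suff : size pairs <= size (arcl s) by rewrite size_pairs size_cat size_map; lia.
apply: uniq_leq_size uniq_pairs _ => -[u v] /H; rewrite negbK mem_arcl; exact.
Qed.

Lemma complete u v : n * (n - 1) <= 2 * size s -> u < n -> v < n -> u != v -> adj s u v.
Proof.
move=> le un vn nuv; apply: contraT => nad.
suff : size ((u, v) :: arcl s) <= size pairs by rewrite size_pairs /= size_cat size_map; lia.
apply: uniq_leq_size; first by rewrite /= mem_arcl nad (arcl_uniq Hs).
move=> [a b]; rewrite inE => /orP [/eqP [-> ->]|]; first by rewrite mem_pairs nuv un vn.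
rewrite mem_arcl mem_pairs => ab; rewrite (adj_lt Hs ab) (adj_lt2 Hs ab) !andbT.
by apply: contraTneq ab => ->; apply: adj_irr Hs _.
Qed.

End Count.

(** * Correctness of the final phase *)

Lemma iota_rcons k : iota 0 k.+1 = rcons (iota 0 k) k.
Proof. by rewrite -addn1 iotaD cats1. Qed.

Lemma row_inj n y y' v v' : v < n -> v' < n ->
  y * n + v = y' * n + v' -> y = y' /\ v = v'.
Proof.
move=> vn vn' e; have n0 : 0 < n by lia.
have := congr1 (divn^~ n) e; rewrite !divnMDl // !divn_small // !addn0 => ey.
by move: e; rewrite ey => /addnI.
Qed.

Definition multi (n : nat) (node lab : nat -> nat) (w : nat) : Prop :=
  exists v, [/\ v < n, node v = w & lab v <> lab w].

Lemma reps_ok n st : let node := arr st aND in let lab := arr st aLB2 in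
  var st vN = n -> var st vNL = 0 -> (forall i, arr st aMU i = 0) ->
  let R := [seq v <- iota 0 n | node v == v] in
  let st' := run reps_c st in
  [/\ var st' vNL = size R, forall i, i < size R -> arr st' aRP i = nth 0 R i
    & forall w, arr st' aMU w != 0 <-> multi n node lab w].
Proof.
move=> node lab eN eL M0 R; cbv zeta; rewrite {}/R.
pose Rk k := [seq v <- iota 0 k | node v == v].
pose I k s' :=
  [/\ var s' vNL = size (Rk k), forall i, i < size (Rk k) -> arr s' aRP i = nth 0 (Rk k) i
    & forall w, arr s' aMU w != 0 <-> multi k node lab w].
suff : I n (run reps_c st) by [].
rewrite -eN; apply: (@vfor_ind I).
  split=> //= w; rewrite M0; split=> //.
  by case=> v [].
move=> k s' kn [Fv Fa] [i1 i2 i3].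
have RS : Rk k.+1 = if node k == k then rcons (Rk k) k else Rk k.
  by rewrite /Rk iota_rcons filter_rcons.
rewrite run_seq.
have stage : let s1 := run (If (ne (Rd aND $vV) $vV) Skip
          (St aRP $vNL $vV ;; vNL <~ Add $vNL (Num 1))) (setv s' vV k) in
    [/\ var s1 vNL = size (Rk k.+1),
        forall i, i < size (Rk k.+1) -> arr s1 aRP i = nth 0 (Rk k.+1) i,
        forall A, A != aRP -> arr s1 A = arr s' A & var s1 vV = k].
  rewrite /= /upd /= (Fa aND isT) -/node addn_eq0 !subn_eq0 -eqn_leq RS.
  case: (node k == k) => /=; last by split.
  rewrite size_rcons i1 addn1; split=> // [i|A /negbTE ->//].
  rewrite ltnS leq_eqVlt nth_rcons /upd => /orP [/eqP ->|ik]; first by rewrite eqxx ltnn.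
  by rewrite ik ifF ?i2 //; apply/eqP => ek; rewrite ek ltnn in ik.
move: stage; have [s1 E1] := ex_eq (run (If (ne (Rd aND $vV) $vV) Skip
          (St aRP $vNL $vV ;; vNL <~ Add $vNL (Num 1))) (setv s' vV k)).
rewrite -E1; cbv zeta => -[t1 t2 t3 t4].
rewrite /I /= t4 !(t3 aND isT) !(t3 aLB2 isT) (Fa aND isT) (Fa aLB2 isT) -/node -/lab.
rewrite addn_eq0 !subn_eq0 -eqn_leq.
have ext w : multi k.+1 node lab w <-> multi k node lab w \/ (node k = w /\ lab k <> lab w).
  split=> [[v []]|[[v [vk h1 h2]]|[h1 h2]]].
  - rewrite ltnS leq_eqVlt => /orP [/eqP ->|vk] h1 h2; first by right.
    by left; exists v.
  - by exists v; split=> //; apply: ltnW.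
  - by exists k.
case: (eqVneq (lab k) (lab (node k))) => el /=; split=> // w.
- rewrite (t3 aMU isT) ext i3; split=> [|[//|[e1 e2]]]; first by left.
  by case: e2; rewrite -e1.
- rewrite /upd (t3 aMU isT) ext; case: (eqVneq w (node k)) => [->|nw].
    by split=> // _; right; split=> //; apply/eqP.
  rewrite i3; split=> [|[//|[e1 _]]]; first by left.
  by rewrite e1 eqxx in nw.
Qed.

Section Final.
Variables (n : nat) (s : seq (nat * nat)).
Hypothesis Hs : valid_graph n s.
Hypothesis Hc : connected_graph n s.
Variables (K R : seq nat).
Let kk := size K.
Let X j := nth 0 K j.
Hypothesis Kn : all (fun v => v < n) K.
Hypothesis Rn : {subset R <= gtn n}.
Hypothesis KR : {subset K <= R}.

Definition tab (st : store) (y v : nat) : nat := arr st aTT (y * n + v).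

Definition fst_ok (st : store) : Prop :=
  [/\ var st vN = n, var st vKK = kk, var st vNL = size R,
      forall j, j < kk -> arr st aKL j = X j
    & forall i, i < size R -> arr st aRP i = nth 0 R i].

Lemma Xn j : j < kk -> X j < n.
Proof. by move=> jk; apply: (allP Kn); apply: mem_nth. Qed.

Lemma Rin i : i < size R -> nth 0 R i < n.
Proof. by move=> ir; apply: Rn; apply: mem_nth. Qed.

Definition fw_inner : cmd :=
  For vY $vKK
       (vT <~ Sub (Rd aTT (row $vY $vV))
                  (Sub (Rd aTT (row $vY $vV))
                       (Add (Rd aTT (row $vZ $vV)) (Rd aTT (row $vY $vX)))) ;;
        St aTT (row $vY $vV) $vT).

Lemma fw_ok st : fst_ok st -> sound n s K (tab st) -> upper s K R 0 (tab st) ->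
  let st' := run fw_c st in
  sound n s K (tab st') /\ upper s K R kk (tab st').
Proof.
move=> [eN eK eL eX eR] S0 U0; cbv zeta.
pose I z s' := sound n s K (tab s') /\ upper s K R z (tab s').
suff : I kk (run fw_c st) by [].
rewrite -eK /fw_c -/fw_inner; apply: (@for_ind I vZ (Var vKK)) => //.
move=> z s'; rewrite [ev _ _]/= eK => zk [Fv Fa] [S1 U1].
rewrite run_seq; set s1 := run (vX <~ _) _.
have a1 : arr s1 = arr s' by [].
have vX1 : var s1 vX = X z by rewrite /s1 /= /upd /= (Fa aKL isT) eX.
have vZ1 : var s1 vZ = z by [].
have v1 x : x \in [:: vN; vKK; vNL] -> var s1 x = var st x.
  by rewrite !inE => /or3P [] /eqP ->; rewrite /s1 /= /upd /= Fv.
have [s2 E2] : exists s2, s2 = s1 by exists s1.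
rewrite -/s1 -E2 in a1 vX1 vZ1 v1 *; clear E2 s1.
set T0 := tab s' in S1 U1; have e0 : tab s2 = T0 by rewrite /T0 /tab a1.
have zn := Xn zk.
pose Q (T : nat -> nat -> nat) := sound n s K T /\
  forall y v, y < kk -> v < n -> T y v <= T0 y v.
pose I2 i s' := Q (tab s') /\ forall i' y, i' < i -> y < kk ->
  tab s' y (nth 0 R i') <= T0 z (nth 0 R i') + T0 y (X z).
have : I2 (size R) (run (For vIA $vNL (vV <~ Rd aRP $vIA ;; fw_inner)) s2).
  have eL2 : var s2 vNL = size R by rewrite v1.
  rewrite -{1}eL2; apply: (@for_ind I2 vIA (Var vNL)).
    by split=> //; rewrite e0; split.
  move=> i s3; rewrite [ev _ _]/= eL2 => iR [Fv3 Fa3] [[So3 Mo3] D3].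
  rewrite run_seq; set s4 := run (vV <~ _) _.
  have a4 : arr s4 = arr s3 by [].
  have vV4 : var s4 vV = nth 0 R i.
    by rewrite /s4 /= /upd /= (Fa3 aRP isT) a1 (Fa aRP isT) eR.
  have v4 x : x \in [:: vN; vKK; vX; vZ] -> var s4 x = var s2 x.
    by rewrite !inE => /or4P [] /eqP ->; rewrite /s4 /= /upd /= Fv3.
  have [s5 E5] : exists s5, s5 = s4 by exists s4.
  rewrite -/s4 -E5 in a4 vV4 v4 *; clear E5 s4.
  set v := nth 0 R i in vV4; have vn : v < n := Rin iR.
  pose I3 y s' := [/\ Q (tab s'), forall i' y, i' < i -> y < kk ->
       tab s' y (nth 0 R i') <= T0 z (nth 0 R i') + T0 y (X z)
     & forall y', y' < y -> tab s' y' v <= T0 z v + T0 y' (X z)].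
  have : I3 kk (run fw_inner s5).
    have eK5 : var s5 vKK = kk by rewrite v4 // v1.
    rewrite -eK5 /fw_inner; apply: (@for_ind I3 vY (Var vKK)).
      by rewrite /I3 /Q /tab a4.
    move=> y s6; rewrite [ev _ _]/= eK5 => yk [Fv6 Fa6] [[So6 Mo6] D6 Y6].
    set s7 := run _ _.
    pose m := tab s6 y v - (tab s6 y v - (tab s6 z v + tab s6 y (X z))).
    have T7 y' v' : v' < n -> tab s7 y' v' =
        if (y' == y) && (v' == v) then m else tab s6 y' v'.
      move=> vn'; rewrite /tab /s7 /= /upd /=.
      rewrite (Fv6 vV isT) (Fv6 vN isT) (Fv6 vZ isT) (Fv6 vX isT) vV4 !v4 // vX1 vZ1 v1 // eN.
      rewrite -/(tab s6 y v) -/(tab s6 z v) -/(tab s6 y (X z)) -/m.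
      case: andP => [[/eqP -> /eqP ->]|h]; first by rewrite eqxx.
      by rewrite ifF //; apply/eqP => /(row_inj vn' vn) [e1 e2]; apply: h; rewrite e1 e2.
    have mle : m <= tab s6 y v /\ m <= tab s6 z v + tab s6 y (X z) by rewrite /m; lia.
    have T7le y' v' : v' < n -> tab s7 y' v' <= tab s6 y' v'.
      by move=> vn'; rewrite T7 //; case: andP => // -[/eqP -> /eqP ->]; case: mle.
    split.
    - split=> [y' v' yk' vn'|y' v' yk' vn'].
        rewrite T7 //; case: andP => [[/eqP -> /eqP ->]|_]; last exact: So6.
        rewrite /m; case: (leqP (tab s6 y v) (tab s6 z v + tab s6 y (X z))) => h.
          by have [q w sq] := So6 y v yk vn; exists q => //; lia.
        have [q1 w1 q1s] := So6 y _ yk zn; have [q2 w2 q2s] := So6 z _ zk vn.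
        exists (q1 ++ q2); first exact: cat_walk w1 w2.
        by rewrite size_cat; lia.
      exact: leq_trans (T7le _ _ vn') (Mo6 _ _ yk' vn').
    - move=> i' y' ii' yk'.
      by apply: leq_trans (D6 i' y' ii' yk'); apply: T7le; apply: Rin; lia.
    - move=> y'; rewrite ltnS leq_eqVlt => /orP [/eqP ->|yy].
        rewrite T7 // !eqxx /=; have := Mo6 z v zk vn; have := Mo6 y _ yk zn; lia.
      by apply: leq_trans (Y6 y' yy); apply: T7le.
  case=> q6 d6 y6; split=> // i' y; rewrite ltnS leq_eqVlt => /orP [/eqP ->|ii] yk.
    exact: y6.
  exact: d6.
case=> [[So Mo] D]; split=> //.
apply: (upper_step Kn zk KR U1) => y v yk vR; first by apply: Mo => //; apply: Rn.
have ir : index v R < size R by rewrite index_mem.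
by have := D (index v R) y ir yk; rewrite nth_index.
Qed.

Definition apart (st : store) (a b : nat) : bool :=
  [|| arr st aLB2 a != arr st aLB2 b, arr st aMU a != 0 | arr st aMU b != 0].

Definition dist_body : cmd :=
  vD <~ $vN ;;
         For vY $vKK
           (vD <~ Sub $vD (Sub $vD (Add (Rd aTT (row $vY $vRA))
                                        (Rd aTT (row $vY $vRB))))).

Lemma dist_body_ok st a b : fst_ok st -> var st vRA = a -> var st vRB = b ->
  var (run dist_body st) vD = dmin n (tab st) a b kk.
Proof.
move=> [eN eK _ _ _] ea eb; rewrite /dist_body run_seq.
set s1 := run _ st.
have a1 : arr s1 = arr st by [].
have v1 x : x != vD -> var s1 x = var st x by move=> /negbTE h; rewrite /s1 /= /upd h.
have d1 : var s1 vD = n by [].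
have eK1 : var s1 vKK = kk by rewrite v1.
clearbody s1; rewrite -eK1.
apply: (@for_ind (fun k s' => var s' vD = dmin n (tab st) a b k)) => //.
move=> k s' _ [Fv Fa] IH; rewrite /= /upd /= (Fa aTT isT) a1.
by rewrite (Fv vRA isT) (Fv vRB isT) (Fv vN isT) !v1 // ea eb eN IH.
Qed.

Lemma pairs_ok st b0 : fst_ok st -> var st vOUT = b0 ->
  let o := var (run pairs_c st) vOUT in
  [/\ b0 <= o, forall a b, a \in R -> b \in R -> apart st a b ->
        dmin n (tab st) a b kk <= o
    & o = b0 \/ exists a b, [/\ a \in R, b \in R, apart st a b
                              & o = dmin n (tab st) a b kk]].
Proof.
move=> fo eO; have [eN eK eL eX eR] := fo; cbv zeta.
pose D i j := dmin n (tab st) (nth 0 R i) (nth 0 R j) kk.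
pose A i j := apart st (nth 0 R i) (nth 0 R j).
pose ex o := o = b0 \/ exists i j, [/\ i < size R, j < size R, A i j & o = D i j].
pose I i s' := [/\ arr s' = arr st, b0 <= var s' vOUT,
   forall i' j, i' < i -> j < size R -> A i' j -> D i' j <= var s' vOUT
   & ex (var s' vOUT)].
suff : I (size R) (run pairs_c st).
  case=> _ h1 h2 h3; split=> //.
    move=> a b aR bR ab.
    by have := h2 (index a R) (index b R); rewrite /A /D !nth_index ?index_mem //; apply.
  case: h3 => [->|[i [j [iR jR Aij ->]]]]; [by left|right].
  by exists (nth 0 R i), (nth 0 R j); split=> //; apply: mem_nth.
rewrite -eL /pairs_c; apply: (@for_ind I vIA (Var vNL)).
  by split; rewrite ?eO //; left.
move=> i s'; rewrite [ev _ _]/= eL => iR [Fv _] [i0 i1 i2 i3].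
rewrite run_seq; set s1 := run (vRA <~ _) _.
have a1 : arr s1 = arr st by [].
have o1 : var s1 vOUT = var s' vOUT by [].
have ra1 : var s1 vRA = nth 0 R i by rewrite /s1 /= /upd /= i0 eR.
have v1 x : x \in [:: vN; vKK; vNL] -> var s1 x = var st x.
  by rewrite !inE => /or3P [] /eqP ->; rewrite /s1 /= /upd /= Fv.
have [s2 E2] : exists s2, s2 = s1 by exists s1.
rewrite -/s1 -E2 in a1 o1 ra1 v1 *; clear E2 s1.
pose I2 k s' := [/\ arr s' = arr st, b0 <= var s' vOUT,
   forall i' j, i' < i -> j < size R -> A i' j -> D i' j <= var s' vOUT,
   forall j, j < k -> A i j -> D i j <= var s' vOUT
   & ex (var s' vOUT)].
set c := For _ _ _.
have : I2 (size R) (run c s2).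
  have eL2 : var s2 vNL = size R by rewrite v1.
  rewrite -{1}eL2 /c; apply: (@for_ind I2 vIB (Var vNL)).
    by split; rewrite ?o1.
  move=> j s3; rewrite [ev _ _]/= eL2 => jR [Fv3 _] [j0 j1 j2 j3 j4].
  rewrite run_seq; set s4 := run (vRB <~ _) _.
  have a4 : arr s4 = arr st by [].
  have o4 : var s4 vOUT = var s3 vOUT by [].
  have rb4 : var s4 vRB = nth 0 R j by rewrite /s4 /= /upd /= j0 eR.
  have ra4 : var s4 vRA = nth 0 R i by rewrite /s4 /= /upd /= Fv3.
  have v4 x : x \in [:: vN; vKK; vNL] -> var s4 x = var st x.
    by move=> hx; rewrite -(v1 _ hx); move: hx; rewrite !inE => /or3P [] /eqP ->;
      rewrite /s4 /= /upd /= Fv3.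
  have [s5 E5] : exists s5, s5 = s4 by exists s4.
  rewrite -/s4 -E5 in a4 o4 rb4 ra4 v4 *; clear E5 s4.
  have jS (o : nat) (h : forall j', j' < j -> A i j' -> D i j' <= o) :
      (A i j -> D i j <= o) -> forall j', j' < j.+1 -> A i j' -> D i j' <= o.
    by move=> hj j'; rewrite ltnS leq_eqVlt => /orP [/eqP ->|]; auto.
  rewrite run_if.
  have -> : (ev s5 (Add (ne (Rd aLB2 $vRA) (Rd aLB2 $vRB)) (Add (Rd aMU $vRA) (Rd aMU $vRB))) == 0)
      = ~~ A i j.
    by rewrite /= a4 ra4 rb4 /A /apart; lia.
  case: ifPn => Aij.
    rewrite -[run Skip s5]/s5 /I2 a4 o4; split=> //; apply: jS => //.
    by rewrite (negbTE Aij).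
  rewrite negbK in Aij; rewrite 2!run_seq -[run (For vY _ _) _]/(run dist_body s5).
  have f5 : fst_ok s5 by split; rewrite ?v4 // a4.
  have dE := dist_body_ok f5 ra4 rb4.
  have eD : dmin n (tab s5) (nth 0 R i) (nth 0 R j) kk = D i j by rewrite /D /tab a4.
  rewrite eD in dE.
  have o6 : var (run dist_body s5) vOUT = var s3 vOUT by rewrite run_var.
  have a6 : arr (run dist_body s5) = arr st by rewrite run_arr0.
  have [s6 E6] := ex_eq (run dist_body s5); rewrite -E6 in dE o6 a6 *.
  rewrite run_if [ev _ _]/= dE o6 subn_eq0.
  case: leqP => le.
    rewrite -[run Skip s6]/s6 /I2 a6 o6; split=> //.
    exact: jS.
  have -> : run (vOUT <~ $vD) s6 = setv s6 vOUT (D i j) by rewrite /= dE.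
  split.
  - by rewrite /= a6.
  - by rewrite /= /upd /=; apply: leq_trans (ltnW le).
  - move=> i' j' ii jj hA; rewrite /= /upd /=; apply: leq_trans (ltnW le).
    exact: j2.
  - rewrite /= /upd /=; apply: jS => // j' jj hA; apply: leq_trans (ltnW le).
    exact: j3.
  - by rewrite /= /upd /=; right; exists i, j.
case=> k0 k1 k2 k3 k4; split=> // i' j; rewrite ltnS leq_eqVlt => /orP [/eqP ->|ii] jR.
  exact: k3.
exact: k2.
Qed.

End Final.

(** * Main result *)

Lemma cb_init st : cb init_c st <= 200 * (var st vM + 1).
Proof. rewrite /=; move: (var st vM) => a; lia. Qed.

Lemma cb_round st : cb round_c st <= 3000 * (var st vN + var st vM2 + 1).
Proof. rewrite /=; move: (var st vN) (var st vM2) => a b; lia. Qed.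

Lemma cb_types st :
  cb types_c st <= 2000 * ((var st vKK).+1 * (var st vN + var st vM2 + 1)).
Proof. rewrite /=; move: (var st vN) (var st vM2) (var st vKK) => a b c; nia. Qed.

Lemma cb_reps st : cb reps_c st <= 200 * (var st vN + 1).
Proof. rewrite /=; move: (var st vN) => a; lia. Qed.

Lemma cb_fw st : cb fw_c st <= 500 * (1 + var st vKK * (var st vNL + 1) * (var st vKK + 1)).
Proof. rewrite /=; move: (var st vNL) (var st vKK) => a b; nia. Qed.

Lemma cb_base st : cb base_c st <= 100.
Proof. by []. Qed.

Lemma cb_pairs st : cb pairs_c st <= 500 * (1 + var st vNL * (var st vNL + 1) * (var st vKK + 1)).
Proof. rewrite /=; move: (var st vNL) (var st vKK) => a b; nia. Qed.

Lemma total_time n m k kk r t0 c1 t :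
  kk <= 4 * k -> r <= 4 ^ kk + kk -> t0 <= 20 * n + 20 + k.+1 * (c1 + 20) ->
  c1 <= 3000 * (n + 2 * m + 1) ->
  t <= 200 * (m + 1) + t0 + 2000 * (kk.+1 * (n + 2 * m + 1)) + 200 * (n + 1)
    + 500 * (1 + kk * (r + 1) * (kk + 1)) + 100
    + 500 * (1 + r * (r + 1) * (kk + 1)) ->
  t <= 10 * 1000 * 100 * ((k + 1) * (n + m) + 2 ^ (16 * k) * (k + 1)).
Proof.
move=> hk hr h0 h1 ht.
pose q := 2 ^ (8 * k).
have q0 : 0 < q by rewrite expn_gt0.
have eq2 : 2 ^ (16 * k) = q * q by rewrite -expnD; congr (_ ^ _); lia.
have kq : kk <= q.
  have := ltn_expl (8 * k) (isT : 1 < 2); rewrite -/q; lia.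
have rq : r <= 2 * q.
  have : 4 ^ kk <= q.
    by rewrite /q -[4]/(2 ^ 2) -expnM leq_exp2l //; lia.
  lia.
rewrite eq2; move: q q0 kq rq {eq2} => q q0 kq rq {hr}.
pose b := q * q * (k + 1).
have b1 : k + 1 <= b by rewrite /b -{1}[k + 1]mul1n leq_mul2r; apply/orP; right; nia.
have f1 : kk * (r + 1) * (kk + 1) <= 12 * b.
  have h : kk * (r + 1) <= 3 * (q * q).
    by apply: leq_trans (leq_mul kq (_ : r + 1 <= 3 * q)) _; lia.
  apply: leq_trans (leq_mul h (_ : kk + 1 <= 4 * (k + 1))) _; first by lia.
  by rewrite /b; move: (q * q) => w; nia.
have f2 : r * (r + 1) * (kk + 1) <= 24 * b.
  have h : r * (r + 1) <= 6 * (q * q).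
    by apply: leq_trans (leq_mul rq (_ : r + 1 <= 3 * q)) _; lia.
  apply: leq_trans (leq_mul h (_ : kk + 1 <= 4 * (k + 1))) _; first by lia.
  by rewrite /b; move: (q * q) => w; nia.
have f3 : kk.+1 * (n + 2 * m + 1) <= 8 * ((k + 1) * (n + m)) + 4 * (k + 1).
  apply: leq_trans (leq_mul (_ : kk.+1 <= 4 * (k + 1)) (leqnn _)) _; first by lia.
  by clear; nia.
have f4 : k.+1 * (c1 + 20) <= 2 * 3000 * ((k + 1) * (n + m)) + 3020 * (k + 1).
  have h : c1 + 20 <= 2 * 3000 * (n + m) + 3020 by clear -h1; lia.
  apply: leq_trans (leq_mul (leqnn k.+1) h) _; clear.
  by rewrite -addn1 mulnDr [2 * 3000 * (_ * _)]mulnCA [3020 * _]mulnC.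
have f5 : n + m <= (k + 1) * (n + m) by rewrite leq_pmull // addn1.
rewrite -/b; move: f1 f2 f3 f4 f5 b1 ht h0.
move: (kk * _ * _) (r * _ * _) (kk.+1 * _) (k.+1 * _) ((k + 1) * _) b => *.
lia.
Qed.

Section Main.
Variables (n k : nat) (s : seq (nat * nat)) (m0 : store).
Hypothesis Hs : valid_graph n s.
Hypothesis Hc : connected_graph n s.
Hypothesis Hk : is_dist_to_cograph n s k.
Hypothesis n2 : 1 < n.
Hypothesis eM : var m0 vM = size s.
Hypothesis eN : var m0 vN = n.
Hypothesis eI : forall i, i < size s -> arr m0 aIN (2 * i + 2) = (nth (0, 0) s i).1 /\
                           arr m0 aIN (2 * i + 3) = (nth (0, 0) s i).2.
Hypothesis eZ : forall A i, 0 < A < NA -> arr m0 A i = 0.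

Lemma is_dist_uniq x y d d' : is_dist s x y d -> is_dist s x y d' -> d = d'.
Proof.
move=> [[p [wp <-]] H] [[p' [wp' <-]] H'].
by apply/eqP; rewrite eqn_leq H // H'.
Qed.

Lemma walk_nonadj u v p : u != v -> ~~ adj s u v -> walk s u v p -> 2 <= size p.
Proof.
move=> nuv nad; case: p => [|a [|b p]] //= [].
  by move=> _ /= e; rewrite e eqxx in nuv.
by rewrite /= andbT => + e; rewrite e (negbTE nad).
Qed.

Lemma diam_c_correct : exists d, [/\ var (run diam_c m0) vOUT = d, is_diameter n s d &
  tm diam_c m0 <= 10 * 1000 * 100 * ((k + 1) * (n + size s) + 2 ^ (16 * k) * (k + 1))].
Proof.
have rE : run diam_c m0 = run pairs_c (run base_c (run fw_c (run reps_c
   (run types_c (run rounds_c (run init_c m0)))))) by [].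
have tE : tm diam_c m0 = tm init_c m0 + (tm rounds_c (run init_c m0) +
   (tm types_c (run rounds_c (run init_c m0)) +
    (tm reps_c (run types_c (run rounds_c (run init_c m0))) +
     (tm fw_c (run reps_c (run types_c (run rounds_c (run init_c m0)))) +
      (tm base_c (run fw_c (run reps_c (run types_c (run rounds_c (run init_c m0))))) +
       tm pairs_c (run base_c (run fw_c (run reps_c (run types_c (run rounds_c (run init_c m0)))))))))))
  by [].
rewrite {}rE {}tE.
have := init_ok eM eN eI eZ; cbv zeta.
have T0 : tm init_c m0 <= cb init_c m0 by apply: (@tm_cb [:: vM]).
have [st1 E1] := ex_eq (run init_c m0); rewrite -!E1.
move=> [C1 K1 D1 N1 [M1 Z1]].
have n0 : 0 < n by lia.
have := rounds_ok Hs n0 C1 K1 D1; cbv zeta.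
have T1 := rounds_tm Hs C1 K1 D1 Hk (leqnn _).
have [_ a2] := run_same rounds_c st1.
have u2 : var (run rounds_c st1) vNL = var st1 vNL by apply: run_var.
have u2' : var (run rounds_c st1) vM2 = var st1 vM2 by apply: run_var.
have [st2 E2] := ex_eq (run rounds_c st1); rewrite -!E2 in a2 u2 u2' *.
move=> [C2 Ce2 KK2].
have Z2 A i : A \in [:: aND; aCH; aMU] -> arr st2 A i = 0.
  by rewrite !inE => /or3P [] /eqP ->; rewrite a2 // Z1.
have [ll TS] := types_ok Hs n0 C2 (fun i => Z2 aND i isT) (fun i => Z2 aCH i isT).
have T2 : tm types_c st2 <= cb types_c st2 by apply: (@tm_cb [:: vN; vM2; vKK]).
have [C3 eK3] := @cst_run n s types_c st2 isT C2.
have [_ a3] := run_same types_c st2.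
have u3 : var (run types_c st2) vNL = var st2 vNL by apply: run_var.
have [st3 E3] := ex_eq (run types_c st2); rewrite -!E3 in C3 eK3 a3 u3 TS *.
set K := Klist st2 in eK3 TS *; set lab := arr st3 aLB2; set node := arr st3 aND.
have [L1 L2 L3 L4 L5] := TS.
have Kn : all (fun v => v < n) K by case: C2.
have kkE : size K = var st2 vKK by rewrite Klist_size.
have kk4 : size K <= 4 * k.
  by rewrite kkE; case: Hk => -[S [HS <-]] _; apply: KK2.
have eLab : arr st2 aLB2 = lab by rewrite /lab a3.
have [ce1 ce2] := Ce2; rewrite eLab in ce1 ce2.
have cert1 u w : adj s u w -> u \notin K -> w \notin K -> lab u = lab w.
  by move=> h1 h2 h3; apply: ce1; rewrite (Lv_mem _ _ C2) h1 h2 h3.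
have cert2 u w : u < n -> w < n -> lab u = lab w ->
    [\/ u = w, [/\ adj s u w, u \notin K & w \notin K]
      | exists c, [/\ adj s u c, adj s c w, u \notin K, w \notin K & c \notin K]].
  move=> un wn e; case: (ce2 u w un wn e) => [->|h|[c h1 h2]].
  - by constructor 1.
  - by constructor 2; move: h; rewrite (Lv_mem _ _ C2) => /and3P [].
  - constructor 3; exists c; move: h1 h2; rewrite !(Lv_mem _ _ C2).
    by move=> /and3P [? ? ?] /and3P [? ? ?].
have eN3 : var st3 vN = n by case: C3.
have NL3 : var st3 vNL = 0 by rewrite u3 u2.
have MU3 i : arr st3 aMU i = 0 by rewrite a3 // Z2.
have := reps_ok eN3 NL3 MU3; cbv zeta; rewrite -/node -/lab.
set R := [seq v <- iota 0 n | node v == v].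
have T3 : tm reps_c st3 <= cb reps_c st3 by apply: (@tm_cb [:: vN]).
have [v4 a4] := run_same reps_c st3.
have [st4 E4] := ex_eq (run reps_c st3); rewrite -!E4 in v4 a4 *.
move=> [NL4 RP4 MU4].
have mR v : (v \in R) = (node v == v) && (v < n) by rewrite mem_filter mem_iota.
have nodeK v : v < n -> node (node v) = node v.
  by move=> vn; apply: L5 => // [|j jk]; [apply: L3|rewrite L4].
have nodeR v : v < n -> node v \in R by move=> vn; rewrite mR nodeK // eqxx L3.
have Rn : {subset R <= gtn n} by move=> v; rewrite mR => /andP [].
have KR : {subset K <= R}.
  move=> x xK; have xn : x < n := allP Kn x xK; rewrite mR xn andbT.
  have jk : index x K < size K by rewrite index_mem.
  have [_ _ _ H] := L1 _ jk; have e := nth_index 0 xK; rewrite e in H.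
  by rewrite -H ?L3 // L4 // H.
have uR : uniq R by rewrite filter_uniq // iota_uniq.
have sR : size R <= 4 ^ size K + size K.
  apply: (reps_size Hs Kn cert1 cert2 L1 uR Rn) => u v.
  by rewrite !mR => /andP [/eqP eu un] /andP [/eqP ev vn] H; rewrite -eu -ev; apply: L5.
have tab4 y v : y < size K -> v < n -> tab n st4 y v = dval n (ll y v).
  by move=> yk vn; rewrite /tab (a4 aTT isT) L2.
have F4 : fst_ok n K R st4.
  split=> //.
  - by rewrite (v4 vN isT).
  - by rewrite (v4 vKK isT) -eK3 Klist_size.
  - move=> j jk; rewrite (a4 aKL isT) -eK3 /Klist (nth_map 0) ?nth_iota ?size_iota //;
    by rewrite -Klist_size eK3.
have S4 := sound0 Hs Hc Kn L1 tab4.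
have U4 := upper0 Hs Kn cert1 cert2 L1 tab4 Rn.
have := fw_ok Kn Rn KR F4 S4 U4; cbv zeta.
have T4 : tm fw_c st4 <= cb fw_c st4 by apply: (@tm_cb [:: vKK; vNL]).
have [v5 a5] := run_same fw_c st4.
have [st5 E5] := ex_eq (run fw_c st4); rewrite -!E5 in v5 a5 *.
move=> [S5 U5].
have T5 : tm base_c st5 <= cb base_c st5 by apply: (@tm_cb [::]).
have [v6 _] := run_same base_c st5.
have a6 : arr (run base_c st5) = arr st5 by rewrite run_arr0.
have M5 : var st5 vM2 = 2 * size s.
  by rewrite (v5 vM2 isT) (v4 vM2 isT) E3 run_var // u2' M1.
have N5 : var st5 vN = n by rewrite (v5 vN isT) (v4 vN isT).
have O6 : var (run base_c st5) vOUT = if 2 * size s < n * (n - 1) then 2 else 1.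
  by rewrite /base_c run_if [ev _ _]/= M5 N5 subn_eq0; case: ltnP.
have [st6 E6] := ex_eq (run base_c st5); rewrite -!E6 in v6 a6 O6 *.
have F6 : fst_ok n K R st6.
  have [f1 f2 f3 f4 f5] := F4; split.
  - by rewrite (v6 vN isT).
  - by rewrite (v6 vKK isT) (v5 vKK isT).
  - by rewrite (v6 vNL isT) (v5 vNL isT).
  - by move=> j jk; rewrite a6 (a5 aKL isT) f4.
  - by move=> j jk; rewrite a6 (a5 aRP isT) f5.
have tab6 : tab n st6 = tab n st5 by rewrite /tab a6.
have := pairs_ok Kn F6 O6; cbv zeta; rewrite tab6.
have T6 : tm pairs_c st6 <= cb pairs_c st6 by apply: (@tm_cb [:: vKK; vNL]).
set o := var (run pairs_c st6) vOUT; move=> [P1 P2 P3].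
have b1 : 1 <= o by apply: leq_trans P1; case: ifP.
have apartP u v : u < n -> v < n -> lab u != lab v -> apart st6 (node u) (node v).
  move=> un vn nl; rewrite /apart a6 !(a5 aLB2 isT) !(a5 aMU isT) (a4 aLB2 isT) -/lab.
  case: (eqVneq (lab (node u)) (lab (node v))) => //= e.
  apply/orP; case: (eqVneq (lab u) (lab (node u))) => eu.
    right; apply/MU4; exists v; split=> // ev; move: nl.
    by rewrite eu e ev eqxx.
  by left; apply/MU4; exists u; split=> // ev; rewrite ev eqxx in eu.
have nodeE u j : u < n -> j < size K -> ll j (node u) = ll j u by move=> un jk; apply: L4.
have distE u v : u < n -> v < n -> lab u != lab v ->
    is_dist s u v (dmin n (tab n st5) (node u) (node v) (size K)).
  move=> un vn nl; apply: (dmin_dist Hs Hc Kn cert1 cert2 L1 S5 U5) => //.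
  - exact: nodeR.
  - exact: nodeR.
  - by move=> j; apply: nodeE.
  - by move=> j; apply: nodeE.
have ub x y d : x < n -> y < n -> is_dist s x y d -> d <= o.
  move=> xn yn Hd; case: (eqVneq (lab x) (lab y)) => e.
    have [d2 Hd2] := same_lab_dist Kn cert2 xn yn e Hd.
    case: (leqP d 1) => d1; first exact: leq_trans d1 b1.
    have {}d2 : d = 2 by lia.
    have [nxy nad] := Hd2 d2; rewrite d2; apply: leq_trans P1.
    case: (ltnP (2 * size s) (n * (n - 1))) => // le; by rewrite (complete Hs le xn yn nxy) in nad.
  rewrite (is_dist_uniq Hd (distE _ _ xn yn e)); apply: P2; try exact: nodeR.
  exact: apartP.
exists o; split=> //.
  split=> //; case: P3 => [Eo|[a [b [aR bR ab Eo]]]]; last first.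
    move: (aR) (bR); rewrite !mR => /andP [/eqP na an] /andP [/eqP nb bn].
    have [u [v [un vn nu nv nl]]] : exists u v, [/\ u < n, v < n, node u = a, node v = b & lab u != lab v].
      case: (eqVneq (lab a) (lab b)) => e; last by exists a, b.
      move: ab; rewrite /apart a6 !(a5 aLB2 isT) !(a5 aMU isT) (a4 aLB2 isT) -/lab e eqxx /=.
      case/orP => /MU4 [v [vn nv /eqP lv]].
        by exists v, b; split=> //; rewrite -e.
      by exists a, v; split=> //; rewrite e eq_sym.
    exists u, v; split=> //; rewrite Eo -nu -nv; exact: distE.
  move: Eo; case: ifP => [lt|/negbT]; last rewrite -leqNgt => le.
    have [u [v [un vn nuv nad]]] := incomplete lt => Eo.
    exists u, v; split=> //; rewrite Eo.
    have [p wp sp] : exists2 p, walk s u v p & size p <= 2.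
      case: (eqVneq (lab u) (lab v)) => e.
        case: (cert2 u v un vn e) => [e'|[e' _ _]|[c [uc cv _ _ _]]].
        - by rewrite e' eqxx in nuv.
        - by rewrite e' in nad.
        - by exists [:: c; v] => //; split=> //=; rewrite uc cv.
      have D := distE _ _ un vn e; have := ub _ _ _ un vn D; rewrite Eo.
      by case: D => -[p [wp <-]] _ sp; exists p.
    split; last by move=> q; apply: walk_nonadj.
    by exists p; split=> //; apply/eqP; rewrite eqn_leq sp (walk_nonadj nuv nad wp).
  move=> Eo; exists 0, 1; split=> //; rewrite Eo.
  have ad : adj s 0 1 by apply: (complete Hs le).
  split; first by exists [:: 1]; split=> //; split=> //=; rewrite ad.
  by move=> [|a p] // [_ /= e].
have kR : var st4 vNL <= 4 ^ size K + size K by rewrite NL4.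
have e4 : var st4 vKK = size K by case: F4.
have e6 : var st6 vKK = size K /\ var st6 vNL = size R by case: F6.
have c0 := cb_init m0; have c1 := cb_round st1; have c2 := cb_types st2.
have c3 := cb_reps st3; have c4 := cb_fw st4; have c5 := cb_base st5.
have c6 := cb_pairs st6.
have e1 : var st1 vN = n by case: C1.
have e2 : var st2 vN = n by case: C2.
rewrite eM in c0; rewrite e1 M1 in c1; rewrite e2 u2' M1 -kkE in c2.
rewrite eN3 in c3; rewrite e4 NL4 in c4; rewrite (proj1 e6) (proj2 e6) in c6.
move: T0 T1 T2 T3 T4 T5 T6 c0 c1 c2 c3 c4 c5 c6 sR kk4.
move: (tm init_c _) (tm rounds_c _) (tm types_c _) (tm reps_c _) (tm fw_c _) (tm base_c _) (tm pairs_c _).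
move: (cb init_c _) (cb round_c _) (cb types_c _) (cb reps_c _) (cb fw_c _) (cb base_c _) (cb pairs_c _).
move: (size K) (size R) (size s) => kk r m; clear.
move=> b0 b1 b2 b3 b4 b5 b6 t0 t1 t2 t3 t4 t5 t6 *.
apply: (@total_time n m k kk r t1 b1); lia.
Qed.

End Main.

Lemma word_bound c1 n m B T : T <= c1 * B ->
  80 * (n + m + 2) + 18 * (8 * T + 40 * 50 * (n + m + 2)) ^ 8 <=
  (n + m + B + 2) ^ (8 * (8 * c1 + 40 * 50) + 15).
Proof.
move=> HT; set e := 8 * c1 + 40 * 50; set X := n + m + B + 2.
have X2 : 2 <= X by rewrite /X; lia.
have X0 : 0 < X by lia.
have le1 : 8 * T + 40 * 50 * (n + m + 2) <= e * X.
  apply: (@leq_trans (8 * c1 * X + 40 * 50 * X)); last by rewrite /e mulnDl.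
  apply: leq_add; last by rewrite leq_mul2l /X; lia.
  by rewrite -mulnA leq_mul2l /=; apply: leq_trans HT _; rewrite leq_mul2l /X; lia.
have le2 : e * X <= X ^ e.+1.
  rewrite expnSr leq_mul2r; apply/orP; right.
  by apply: leq_trans (ltnW (ltn_expl e (isT : 1 < 2))) _; case: (e) => // e'; rewrite leq_exp2r.
have le3 : (8 * T + 40 * 50 * (n + m + 2)) ^ 8 <= X ^ (8 * e + 8).
  apply: leq_trans (_ : (X ^ e.+1) ^ 8 <= _).
    by rewrite leq_exp2r //; apply: leq_trans le1 le2.
  by rewrite -expnM leq_exp2l //; lia.
have le4 : n + m + 2 <= X ^ (8 * e + 8).
  apply: (@leq_trans X); first by rewrite /X; lia.
  by apply: leq_self_exp; rewrite addnS.
have le5 : 98 <= X ^ 7.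
  apply: (@leq_trans (2 ^ 7)); first by [].
  by rewrite leq_exp2r.
have -> : 8 * e + 15 = 7 + (8 * e + 8) by rewrite -[15]/(7 + 8) addnCA.
rewrite expnD.
apply: leq_trans (_ : 98 * X ^ (8 * e + 8) <= _); last by rewrite leq_mul2r le5 orbT.
move: le3 le4; move: (_ ^ 8) (X ^ (8 * e + 8)) => Y Z; clear; lia.
Qed.

(* There is a word-RAM program solving Diameter in
   O(k(n+m) + 2^(16k) k) time (k read as k+1 inside the O, see NOTES.md),
   with word size O(log(input size + running-time bound)). *)
Theorem theorem2 :
  exists (P : seq instr) (c : nat),
    forall (n : nat) (s : seq (nat * nat)) (k : nat),
      0 < n ->
      valid_graph n s ->
      connected_graph n s ->
      is_dist_to_cograph n s k ->
      let B := (k + 1) * (n + size s) + 2 ^ (16 * k) * (k + 1) in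
      exists t d,
        [/\ t <= c * B,
            is_diameter n s d
          & runs_in P n s t d ((n + size s + B + 2) ^ c)].
Proof.
have [c1 E1] := ex_eq (10 * 1000 * 100).
pose c := c1 + 300 + (8 * (8 * c1 + 40 * 50) + 15).
exists (prog diam_c), c => n s k n0 Hs Hc Hk B.
set m := size s.
have B1 : m + 1 <= B.
  rewrite /B -/m; have := expn_gt0 2 (16 * k); move: (2 ^ (16 * k)) => q /= q0; nia.
have X2 : 2 <= n + m + B + 2 by lia.
case: (leqP n 1) => n1.
  have e1 : n = 1 by lia.
  subst n.
  have s0 : size s = 0.
    case: (Hs) => /allP H _ _; case: (s) H => // -[u w] s' H.
    by have := H (u, w) (mem_head _ _); rewrite /=; lia.
  exists 2, 0; split.
  - by rewrite /c; nia.
  - split; first by exists 0, 0; split=> //; split=> //; exists [::].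
    move=> x y d' x1 y1 [_ le]; apply: (le [::]); split=> //=; lia.
  - by apply: prog_runs1 => //; rewrite expn_gt0; lia.
have m0 : 0 < size s.
  have [p [pp lp]] := Hc 0 1 n0 n1; case: p pp lp => // a p /= /andP [+ _] _.
  by rewrite /adj; case: (s) => // ?.
have [st [eM eN eI eZ run]] := prog_runs diam_wf n1 m0 Hs.
have [d [ed Hd Ht]] := diam_c_correct Hs Hc Hk n1 eM eN eI eZ.
rewrite -E1 -/B in Ht.
have WB : 80 * (n + m + 2) + 18 * (8 * tm diam_c st + 40 * 50 * (n + m + 2)) ^ 8 <= (n + m + B + 2) ^ c.
  apply: leq_trans (word_bound n m Ht) _; rewrite leq_exp2l // /c; clear; lia.
have [t tle Hrun] := run _ _ (leqnn _) WB.
exists t, d; split=> //; last by rewrite -ed.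
rewrite -/m in tle; clear -tle Ht B1; rewrite /c; nia.
Qed.
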